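(* For $\alpha\ge1$, define the power-weighted compressive functional $$\mathcal K_{2,\alpha}(F,U)=-\int UF^2r^\alpha\,dr\,dz .$$ For every smooth rapidly decaying axis-compatible profile $F=F(r,z)$, put $\phi_{\rm src}=(-\Delta_5)^{-1}\partial_z(F^2)$ and $\dot U_{\rm src}=-\partial_z\phi_{\rm src}$. Then $$\int \dot U_{\rm src}F^2r^\alpha\,dr\,dz=\mathcal Q_\alpha[\phi_{\rm src}],$$ where $$\mathcal Q_1[\phi]=\int|\nabla\phi|^2r\,dr\,dz+\int_{\mathbb R}|\phi(0,z)|^2\,dz,$$ and, for $\alpha>1$, $$\mathcal Q_\alpha[\phi]=\int|\nabla\phi|^2r^\alpha\,dr\,dz+\frac{(3-\alpha)(\alpha-1)}2\int\phi^2r^{\alpha-2}\,dr\,dz .$$ Consequently $\mathcal Q_\alpha[\phi]\ge0$ for $1\le\alpha\le5$. More quantitatively, for $1<\alpha\le3$, $$\mathcal Q_\alpha[\phi]\ge\int|\nabla\phi|^2r^\alpha\,dr\,dz,$$ while for $3<\alpha<5$, $$\mathcal Q_\alpha[\phi]\ge\frac{5-\alpha}{\alpha-1}\int|\nabla\phi|^2r^\alpha\,dr\,dz .$$ At $\alpha=5$ the form is nonnegative but has no positive uniform full-gradient gap, i.e. there is no constant $c>0$ such that $\mathcal Q_5[\phi]\ge c\int|\nabla\phi|^2r^5\,dr\,dz$ for all $\phi$. Hence, throughout $1\le\alpha\le5$, for every $U$ (with $F$ frozen), $$\left.\frac{d}{d\varepsilon}\right|_{\varepsilon=0}\mathcal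 K_{2,\alpha}(F,U+\varepsilon\dot U_{\rm src})\le0 .$$
   Context: All integrals $\int\cdots dr\,dz$ are over the meridional half-plane $\{r>0,\ z\in\mathbb R\}$ and $\nabla=(\partial_r,\partial_z)$. The operator $\Delta_5=\partial_{rr}+\frac3r\partial_r+\partial_{zz}$ is the five-dimensional Laplacian acting on functions of $(r,z)$ (with $r$ the radius in $\mathbb R^4$), and $(-\Delta_5)^{-1}$ is its inverse (decaying solution). In the forms $\mathcal Q_\alpha[\phi]$, $\phi=\phi(r,z)$ ranges over smooth axis-compatible functions with sufficient decay; axis-compatible means compatible with smoothness of the corresponding axisymmetric function across the axis $r=0$. In the application, for an axisymmetric velocity field $u=u^re_r+u^\theta e_\theta+u^ze_z$, $F=u^\theta/r$ and $U=u^r/r$. With $G=\omega^\theta/r$, one has the relation $U=-\partial_z(-\Delta_5)^{-1}G$, so $\dot U_{\rm src}$ is the response of $U$ to the increment $\dot G_{\rm src}=\partial_z(F^2)$.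
   Formalization: The identity is unconditional only for 1 ≤ α < 8; for α ≥ 8 it is stated only when the integrals in Q_α[φ_src] converge, since for F ≠ 0 the source potential decays like ρ⁻⁴ and Q_α[φ_src] is then an undefined ∞ − ∞. *)

(* Defs.v *)
From mathcomp Require Import all_boot all_order all_algebra.
From mathcomp Require Import all_classical all_reals all_analysis.
Set Implicit Arguments.
Unset Strict Implicit.
Unset Printing Implicit Defensive.
Import Order.TTheory GRing.Theory Num.Theory.
Import numFieldNormedType.Exports.
Local Open Scope classical_set_scope.
Local Open Scope ring_scope.

(* Profiles on the meridional half-plane are functions f : R -> R -> R with
   f r z the value at radius r and height z.  Only their values for 0 <= r are
   ever used. *)

Section Smoothness.
Context {R : realType}.

Definition iter_derive {V : normedModType R} (vs : seq V) (f : V -> R) : V -> R :=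
  foldr (fun v g => 'D_v g) f vs.

(* On a finite-dimensional V this is C^oo: the iterated directional
   derivatives of every order are differentiable, hence continuous. *)
Definition smooth {V : normedModType R} (f : V -> R) : Prop :=
  forall (vs : seq V) (x : V), differentiable (iter_derive vs f) x.

Definition schwartz {V : normedModType R} (f : V -> R) : Prop :=
  smooth f /\
  forall (vs : seq V) (k : nat), exists C : R, forall x : V,
    (1 + `|x|) ^+ k * `|iter_derive vs f x| <= C.

Definition axisym (f : R -> R -> R) : R * R * R -> R :=
  fun x => f (Num.sqrt (x.1.1 ^+ 2 + x.1.2 ^+ 2)) x.2.

(* The dimension of the ambient space is immaterial here: smoothness of the
   axisymmetric function on R^3 or on R^5 (r the radius in R^4) both amount to
   f being the restriction to 0 <= r of a smooth function even in r. *)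
Definition axis_compatible (f : R -> R -> R) : Prop := smooth (axisym f).

Definition rapidly_decaying (f : R -> R -> R) : Prop := schwartz (axisym f).

End Smoothness.

Section Operators.
Context {R : realType}.

Definition dr (f : R -> R -> R) : R -> R -> R :=
  fun r z => derive1 (fun s => f s z) r.

Definition dz (f : R -> R -> R) : R -> R -> R := fun r z => derive1 (f r) z.

Definition grad_sq (f : R -> R -> R) : R -> R -> R :=
  fun r z => dr f r z ^+ 2 + dz f r z ^+ 2.

Definition Delta5 (f : R -> R -> R) : R -> R -> R :=
  fun r z => dr (dr f) r z + 3 / r * dr f r z + dz (dz f) r z.

Definition vanishes_at_infinity (f : R -> R -> R) : Prop :=
  forall e : R, 0 < e -> exists M : R, forall r z : R,
    0 <= r -> M <= r ^+ 2 + z ^+ 2 -> `|f r z| < e.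

(* phi = (-Delta5)^-1 g.  Smoothness across the axis is part of the notion: it
   makes phi a solution on the whole of R^5, thereby excluding solutions such as
   those behaving like r^-2 at r = 0, and phi is then unique for 0 <= r by the
   maximum principle. *)
Definition is_inv_neg_Delta5 (g phi : R -> R -> R) : Prop :=
  [/\ axis_compatible phi,
      forall r z : R, 0 < r -> - Delta5 phi r z = g r z
    & vanishes_at_infinity phi].

End Operators.

Section Functionals.
Context {R : realType}.

Definition half_plane : set (measurableTypeR R * measurableTypeR R) :=
  [set p | 0 < p.1].

Definition hp_integrable (f : R -> R -> R) : Prop :=
  (lebesgue_measure \x lebesgue_measure)%E.-integrable half_plane
    (fun p => (f p.1 p.2)%:E).

Definition hp_integral (f : R -> R -> R) : R :=
  \int[(lebesgue_measure \x lebesgue_measure)%E]_(p in half_plane) f p.1 p.2.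

Definition K2 (alpha : R) (F U : R -> R -> R) : R :=
  - hp_integral (fun r z => U r z * F r z ^+ 2 * r `^ alpha).

Definition energy (alpha : R) (phi : R -> R -> R) : R :=
  hp_integral (fun r z => grad_sq phi r z * r `^ alpha).

Definition Q (alpha : R) (phi : R -> R -> R) : R :=
  if alpha == 1 then
    energy 1 phi + \int[lebesgue_measure]_(z in [set: R]) (`|phi 0 z| ^+ 2)
  else
    energy alpha phi
    + (3 - alpha) * (alpha - 1) / 2
      * hp_integral (fun r z => phi r z ^+ 2 * r `^ (alpha - 2)).

(* Smooth axis-compatible functions with sufficient decay: every integral that
   enters Q alpha converges. *)
Definition Q_domain (alpha : R) (phi : R -> R -> R) : Prop :=
  [/\ axis_compatible phi,
      hp_integrable (fun r z => grad_sq phi r z * r `^ alpha)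
    & if alpha == 1 then
        (lebesgue_measure.-integrable [set: R]
           (fun z => (`|phi 0 z| ^+ 2)%:E) : Prop)
      else hp_integrable (fun r z => phi r z ^+ 2 * r `^ (alpha - 2))].

Definition Gdot_src (F : R -> R -> R) : R -> R -> R :=
  dz (fun r z => F r z ^+ 2).

Definition is_phi_src (F phi : R -> R -> R) : Prop :=
  is_inv_neg_Delta5 (Gdot_src F) phi.

Definition Udot_src (phi : R -> R -> R) : R -> R -> R :=
  fun r z => - dz phi r z.

End Functionals.

(* Main.v *)
(* Pairing [- Delta5 phi = dz (F^2)] with [phi r^alpha] and integrating by parts
   turns the source functional into [Q alpha phi]; the trace on the axis appears
   only for [alpha = 1].  The signs come from the weighted Hardy inequality
   [(alpha - 1)^2 / 4 * int phi^2 r^(alpha - 2) <= int |grad phi|^2 r^alpha],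
   obtained by expanding the square [(phi_r + c phi / r)^2 r^alpha].  At
   [alpha = 5] the square with [c = 2] is [Q 5 phi] itself; on its extremal
   [r^-2], truncated at the radii 1 and [s] and stretched in [z], [Q] stays
   bounded while the energy grows like [ln s].

   No decay rate of [phi] is assumed.  The maximum principle compares [phi]
   with [(1 + r^2 + z^2)^(-3/2)], and its odd part in [z] with
   [z (1 + r^2 + z^2)^(-5/2)].  The even part is the z-derivative of an odd
   solution whose source is the odd part of [F^2]; that solution has the faster
   decay, and its finite weighted energy bounds the even part.  Hence all
   integrals in [Q alpha phi] converge for [alpha < 8]. *)
Require Import Defs.
From mathcomp Require Import all_boot all_order all_algebra.
From mathcomp Require Import all_classical all_reals all_analysis.
From mathcomp Require Import ring lra measurable_realfun.
Set Implicit Arguments.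
Unset Strict Implicit.
Unset Printing Implicit Defensive.
Import Order.TTheory GRing.Theory Num.Theory.
Import numFieldNormedType.Exports.
Local Open Scope classical_set_scope.
Local Open Scope ring_scope.

(** * Derivatives and joint continuity *)

Section Calculus.
Context {R : realType}.
Implicit Types (f g : R -> R) (x : R).

(** The solution [phi] is known only through its equation, its smoothness and its vanishing at
    infinity: no Green representation enters, and the finiteness of its energy has to be proved. Two
    obstacles shape the argument. Decay: comparison in R^5 with a general source gives only
    [|x|^(-3)], whereas a source that is a z-derivative produces the dipole [z |x|^(-5)], of size
    [|x|^(-4)], whose square is integrable at infinity against [r^(alpha - 2)] exactly for
    [alpha < 8]. Oddness recovers the missing power, because the dipole is a positive harmonic
    function on [0 < z] and odd functions vanish on [z = 0]. Even functions satisfy no such boundary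
    condition, hence the passage to a primitive. Energy: integration by parts is carried out against
    explicit squared cutoffs, and a Caccioppoli-type absorption followed by Fatou gives finiteness.
    For [alpha > 1] the cutoff vanishes near the axis; for [alpha = 1] it must not, since the flux
    through the axis is the trace term. Profiles have a meaning only for [0 <= r], so the calculus
    takes place on the restriction of the axisymmetric function to a plane containing the axis,
    where it is even in [r]. *)

Lemma derE f x a b : is_derive x 1 f a -> a = b -> is_derive x 1 f b.
Proof. by move=> h <-. Qed.

Lemma der_cst (c x : R) : is_derive x 1 (fun _ : R => c) 0.
Proof. exact: is_derive_cst. Qed.

Lemma der_id x : is_derive x 1 (fun s : R => s) 1.
Proof. exact: is_derive_id. Qed.

Lemma derD f g x a b : is_derive x 1 f a -> is_derive x 1 g b ->
  is_derive x 1 (fun s => f s + g s) (a + b).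
Proof. by move=> ? ?; exact: is_deriveD. Qed.

Lemma derN f x a : is_derive x 1 f a -> is_derive x 1 (fun s => - f s) (- a).
Proof. by move=> ?; exact: is_deriveN. Qed.

Lemma derM f g x a b : is_derive x 1 f a -> is_derive x 1 g b ->
  is_derive x 1 (fun s => f s * g s) (a * g x + f x * b).
Proof.
move=> fa gb; apply: (derE (is_deriveM fa gb)).
by rewrite addrC /GRing.scale /= mulrC.
Qed.

Lemma derX f n x a : is_derive x 1 f a ->
  is_derive x 1 (fun s => f s ^+ n) (n%:R * f x ^+ n.-1 * a).
Proof.
by move=> fa; rewrite -[fun s => _]exprfctE; exact: (is_deriveX n fa).
Qed.

Lemma derV f x a : is_derive x 1 f a -> f x != 0 ->
  is_derive x 1 (fun s => (f s)^-1) (- a / f x ^+ 2).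
Proof.
move=> fa fx0; apply: (derE (is_deriveV fx0 fa)).
by rewrite /GRing.scale /= !mulNr mulrC.
Qed.

Lemma der_comp f g x a b : is_derive (g x) 1 f a -> is_derive x 1 g b ->
  is_derive x 1 (fun s => f (g s)) (a * b).
Proof. by move=> ? ?; exact: is_derive1_comp. Qed.

Lemma der_powR f p x a : is_derive x 1 f a -> 0 < f x ->
  is_derive x 1 (fun s => f s `^ p) (p * f x `^ (p - 1) * a).
Proof.
by move=> fa fx0; apply: (@der_comp (fun s => s `^ p)) => //; exact: is_derive1_powR.
Qed.

Lemma der_near f g x a : (\forall y \near x, f y = g y) ->
  is_derive x 1 f a -> is_derive x 1 g a.
Proof. by move=> fg; apply: near_eq_is_derive => //; rewrite oner_neq0. Qed.

Lemma der_cont f x a : is_derive x 1 f a -> {for x, continuous f}.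
Proof.
move=> [fx _]; apply: differentiable_continuous; exact/derivable1_diffP.
Qed.

Lemma der_derive1 f x a : is_derive x 1 f a -> derive1 f x = a.
Proof. by move=> [_ <-]; rewrite derive1E. Qed.

End Calculus.

(** Syntax-directed differentiation in which the value of the derivative stays an evar:
    [eapply derE; first by der] leaves one algebraic equation, and [eexists; der] followed by
    [der_cont] yields continuity. Positivity and nonvanishing side conditions are looked up in the
    context. *)
Ltac der_step := match goal with
  | |- is_derive _ _ (fun _ => ?c) _ => eapply der_cst
  | |- is_derive _ _ (fun s => s) _ => eapply der_id
  | H : is_derive ?x _ ?f _ |- is_derive ?x _ ?f _ => eexact H
  | H : is_derive ?x _ ?f _ |- is_derive ?x _ (fun s => ?f s) _ => eexact H
  | |- is_derive _ _ (fun s => @?f s + @?g s) _ => eapply (@derD _ f g)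
  | |- is_derive _ _ (fun s => - @?f s) _ => eapply (@derN _ f)
  | |- is_derive _ _ (fun s => @?f s * @?g s) _ => eapply (@derM _ f g)
  | |- is_derive _ _ (fun s => @?f s ^+ ?n) _ => eapply (@derX _ f n)
  | |- is_derive _ _ (fun s => (@?f s)^-1) _ => eapply (@derV _ f)
  | |- is_derive _ _ (fun s => @?f s `^ ?p) _ => eapply (@der_powR _ f p)
  end.

Ltac der := repeat der_step; try assumption.

Definition cont2 {R : realType} (f : R -> R -> R) (r z : R) : Prop :=
  {for (r, z), continuous (fun q : R * R => f q.1 q.2)}.

Section Cont2.
Context {R : realType}.
Implicit Types (f g : R -> R -> R) (r z : R).

Lemma c2_cst (c r z : R) : cont2 (fun _ _ : R => c) r z.
Proof. exact: cvg_cst. Qed.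

Lemma c2_r r z : cont2 (fun s _ : R => s) r z.
Proof. exact: cvg_fst. Qed.

Lemma c2_z r z : cont2 (fun _ t : R => t) r z.
Proof. exact: cvg_snd. Qed.

Lemma c2D f g r z : cont2 f r z -> cont2 g r z ->
  cont2 (fun s t => f s t + g s t) r z.
Proof. by move=> cf cg; exact: cvgD. Qed.

Lemma c2N f r z : cont2 f r z -> cont2 (fun s t => - f s t) r z.
Proof. by move=> cf; exact: cvgN. Qed.

Lemma c2M f g r z : cont2 f r z -> cont2 g r z ->
  cont2 (fun s t => f s t * g s t) r z.
Proof. by move=> cf cg; exact: cvgM. Qed.

Lemma c2X f n r z : cont2 f r z -> cont2 (fun s t => f s t ^+ n) r z.
Proof. by move=> cf; apply: (@cvg_comp _ _ _ _ (fun x => x ^+ n) _ _ _ cf); exact: exprn_continuous. Qed.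

Lemma c2V f r z : cont2 f r z -> f r z != 0 -> cont2 (fun s t => (f s t)^-1) r z.
Proof. by move=> cf f0; exact: cvgV. Qed.

Lemma c2_comp1 (h : R -> R) f r z : {for f r z, continuous h} -> cont2 f r z ->
  cont2 (fun s t => h (f s t)) r z.
Proof. by move=> ch cf; apply: (@cvg_comp _ _ _ _ h _ _ _ cf); exact: ch. Qed.

Lemma c2_powR f p r z : cont2 f r z -> 0 < f r z ->
  cont2 (fun s t => f s t `^ p) r z.
Proof.
move=> cf f0; apply: (c2_comp1 (h := fun x => x `^ p)) => //.
by apply: der_cont; exact: is_derive1_powR.
Qed.

Lemma c2_comp f (g h : R -> R -> R) r z : cont2 f (g r z) (h r z) ->
  cont2 g r z -> cont2 h r z -> cont2 (fun s t => f (g s t) (h s t)) r z.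
Proof.
move=> cf cg ch.
have gh : (g q.1 q.2, h q.1 q.2) @[q --> (r, z)] --> (g r z, h r z).
  exact: (cvg_pair cg ch).
exact: (@cvg_comp _ _ _ _ (fun q : R * R => f q.1 q.2) _ _ _ gh cf).
Qed.

Lemma c2_slicer f r z : cont2 f r z -> {for r, continuous (fun s => f s z)}.
Proof.
move=> cf; have h : (s, z) @[s --> r] --> (r, z).
  exact: (cvg_pair (@cvg_id _ _) (@cvg_cst _ _ _ _ _)).
exact: (@cvg_comp _ _ _ _ (fun q : R * R => f q.1 q.2) _ _ _ h cf).
Qed.

Lemma c2_slicez f r z : cont2 f r z -> {for z, continuous (f r)}.
Proof.
move=> cf; have h : (r, s) @[s --> z] --> (r, z).
  exact: (cvg_pair (@cvg_cst _ _ _ _ _) (@cvg_id _ _)).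
exact: (@cvg_comp _ _ _ _ (fun q : R * R => f q.1 q.2) _ _ _ h cf).
Qed.

(** Continuity holds at the points of [D] as points of the whole plane, so each point of [D] in a
    superlevel set is interior to it. This makes superlevel sets measurable relative to any
    measurable [D], open or not. *)
Lemma interior_c2 f (D : set (R * R)) (a : R) :
  (forall p, D p -> cont2 f p.1 p.2) ->
  D `&` [set p | a < f p.1 p.2] = D `&` interior [set p | a < f p.1 p.2].
Proof.
move=> cf; apply/seteqP; split=> p [Dp ap]; split => //.
  have := cf _ Dp; rewrite /cont2 -surjective_pairing => /(_ [set y | a < y]) /=.
  by apply; exact: lt_nbhsr.
exact: interior_subset ap.
Qed.

End Cont2.

Ltac c2_step := match goal with
  | |- cont2 (fun _ _ => ?c) _ _ => apply: c2_cst
  | |- cont2 (fun s _ => s) _ _ => apply: c2_r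
  | |- cont2 (fun _ t => t) _ _ => apply: c2_z
  | H : cont2 ?f ?r ?z |- cont2 ?f ?r ?z => exact H
  | H : cont2 ?f ?r ?z |- cont2 (fun s t => ?f s t) ?r ?z => exact H
  | |- cont2 (fun s t => @?f s t + @?g s t) _ _ => apply (@c2D _ f g)
  | |- cont2 (fun s t => - @?f s t) _ _ => apply (@c2N _ f)
  | |- cont2 (fun s t => @?f s t * @?g s t) _ _ => apply (@c2M _ f g)
  | |- cont2 (fun s t => @?f s t ^+ ?n) _ _ => apply (@c2X _ f n)
  | |- cont2 (fun s t => (@?f s t)^-1) _ _ => apply (@c2V _ f)
  | |- cont2 (fun s t => @?f s t `^ ?p) _ _ => apply (@c2_powR _ f p)
  end.

Ltac c2 := repeat c2_step; try assumption.

(** * Measurability of jointly continuous functions on the plane *)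

Section ProductBorel.
Context {R : realType}.

(** The sigma-algebra on the plane is the product one, generated by rectangles; an open set is the
    countable union of the rational boxes it contains. *)
Lemma open_prod_measurable (U : set (R * R)) : open U ->
  measurable (U : set (measurableTypeR R * measurableTypeR R)).
Proof.
move=> oU.
pose box (q : rat * rat * (rat * rat)) : set (R * R) :=
  `]ratr q.1.1, ratr q.1.2[ `*` `]ratr q.2.1, ratr q.2.2[.
have -> : U = \bigcup_(q in [set q | box q `<=` U]) box q.
  apply/seteqP; split=> [[x y] Uxy|p [q qU]]; last exact: qU.
  move: oU; rewrite openE => /(_ _ Uxy) /nbhs_ballP[e /= e0 eU].
  have [q1 /andP[q1l q1r]] : exists q : rat, x - e < ratr q < x.
    by have [|q] := @rat_in_itvoo R (x - e) x; [lra|rewrite in_itv /=; exists q].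
  have [q2 /andP[q2l q2r]] : exists q : rat, x < ratr q < x + e.
    by have [|q] := @rat_in_itvoo R x (x + e); [lra|rewrite in_itv /=; exists q].
  have [q3 /andP[q3l q3r]] : exists q : rat, y - e < ratr q < y.
    by have [|q] := @rat_in_itvoo R (y - e) y; [lra|rewrite in_itv /=; exists q].
  have [q4 /andP[q4l q4r]] : exists q : rat, y < ratr q < y + e.
    by have [|q] := @rat_in_itvoo R y (y + e); [lra|rewrite in_itv /=; exists q].
  exists (q1, q2, (q3, q4)); last first.
    by split => /=; rewrite in_itv /=; apply/andP.
  move=> [u v] [] /=; rewrite !in_itv /= => /andP[h1 h2] /andP[h3 h4].
  by apply: eU; split => /=; rewrite /ball /= ltr_distlC; apply/andP; split; lra.
rewrite bigcup_mkcond; apply: countable_bigcupT_measurable => [|q]; first exact: countableP.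
case: ifP => // _; apply: measurableX => /=; exact: measurable_itv.
Qed.

Lemma c2_measurable (f : R -> R -> R) (D : set (R * R)) :
  measurable (D : set (measurableTypeR R * measurableTypeR R)) ->
  (forall p, D p -> cont2 f p.1 p.2) ->
  measurable_fun (D : set (measurableTypeR R * measurableTypeR R))
    (fun p => f p.1 p.2).
Proof.
move=> mD cf; apply: (measurability _ (RGenOInfty.measurableE R)) => //.
move=> _ [_ [a ->] <-]; rewrite preimage_itvoy [X in measurable X](interior_c2 a cf).
by apply: measurableI => //; apply: open_prod_measurable; exact: open_interior.
Qed.

Lemma open_half_plane : open (@half_plane R : set (R * R)).
Proof.
rewrite openE => p p0; have : \forall q \near p.1, 0 < q by exact: lt_nbhsr.
move=> h; exact: (@cvg_fst _ _ (nbhs p.1) (nbhs p.2) _ _ h).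
Qed.

Lemma measurable_half_plane : measurable (@half_plane R).
Proof. exact: (open_prod_measurable open_half_plane). Qed.

Lemma hp_measurable (f : R -> R -> R) : (forall r z, 0 < r -> cont2 f r z) ->
  measurable_fun (@half_plane R) (fun p => f p.1 p.2).
Proof. by move=> cf; apply: (c2_measurable measurable_half_plane) => -[r z]; exact: cf. Qed.

End ProductBorel.

(** * Integration on the half-plane *)

Section Boxes.
Context {R : realType}.
Notation leb := (@lebesgue_measure R).
Notation leb2 := (leb \x leb)%E.

Lemma FTC_segment (a b : R) (f F : R -> R) : a < b ->
  (forall x, a <= x <= b -> is_derive x 1 F (f x)) ->
  (forall x, a <= x <= b -> {for x, continuous f}) ->
  (\int[leb]_(x in `[a, b]) (f x)%:E = (F b - F a)%:E)%E.
Proof.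
move=> ab dF cf; rewrite EFinB; apply: continuous_FTC2 => //.
- apply: continuous_in_subspaceT => x /set_mem /=; rewrite in_itv /=; exact: cf.
- split.
  + move=> x; rewrite in_itv /= => /andP[ax xb].
    have [] // : is_derive x 1 F (f x) by apply: dF; rewrite !ltW.
  + apply: cvg_at_right_filter; apply: (der_cont (dF _ _)); lra.
  + apply: cvg_at_left_filter; apply: (der_cont (dF _ _)); lra.
- move=> x; rewrite in_itv /= => /andP[ax xb].
  by apply/der_derive1/dF; rewrite !ltW.
Qed.

Definition box (a b c d : R) : set (measurableTypeR R * measurableTypeR R) :=
  `[a, b]%classic `*` `[c, d]%classic.

Lemma boxP a b c d r z : box a b c d (r, z) <-> (a <= r <= b) /\ (c <= z <= d).
Proof. by rewrite /box /= !in_itv. Qed.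

Lemma measurable_box a b c d : measurable (box a b c d).
Proof. by apply: measurableX; exact: measurable_itv. Qed.

Lemma box_compact a b c d : compact (box a b c d : set (R * R)).
Proof. by apply: compact_setX; exact: segment_compact. Qed.

Lemma box_bounded (f : R -> R -> R) a b c d :
  (forall r z, a <= r <= b -> c <= z <= d -> cont2 f r z) ->
  exists2 M : R, 0 < M & forall r z, a <= r <= b -> c <= z <= d -> `|f r z| <= M.
Proof.
move=> cf.
have : compact ((fun q : R * R => f q.1 q.2) @` (box a b c d : set (R * R))).
  apply: continuous_compact; last exact: box_compact.
  apply: continuous_in_subspaceT => -[r z] /set_mem /boxP [h1 h2].
  exact: cf.
move=> /compact_bounded[M0 [M0r hM]]; exists (`|M0| + 1); first by rewrite ltr_wpDl.
move=> r z rab zcd; apply: (hM (`|M0| + 1)).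
  by rewrite (le_lt_trans (ler_norm _)) // ltrDl.
by exists (r, z) => //; apply/boxP.
Qed.

Lemma box_integrable (f : R -> R -> R) a b c d :
  (forall r z, a <= r <= b -> c <= z <= d -> cont2 f r z) ->
  leb2.-integrable (box a b c d) (fun p => (f p.1 p.2)%:E).
Proof.
move=> cf; apply: measurable_bounded_integrable.
- exact: measurable_box.
- rewrite [ltLHS]product_measure1E; [|exact: measurable_itv..].
  by rewrite lte_mul_pinfty // ?ge0_fin_numE //= lebesgue_measure_itv /=; case: ifP => _; rewrite ?ltry.
- apply: (c2_measurable (measurable_box a b c d)) => -[r z] /boxP[h1 h2]; exact: cf.
- have [M M0 hM] := box_bounded cf.
  exists M; split; first exact: num_real.
  by move=> x Mx -[r z] /boxP[h1 h2]; exact: le_trans (hM _ _ h1 h2) (ltW Mx).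
Qed.

Lemma box_integral (f : R -> R -> R) a b c d :
  (forall r z, a <= r <= b -> c <= z <= d -> cont2 f r z) ->
  (\int[leb2]_(p in box a b c d) (f p.1 p.2)%:E =
   \int[leb]_(z in `[c, d]) \int[leb]_(r in `[a, b]) (f r z)%:E)%E.
Proof.
move=> cf; have mb := measurable_box a b c d.
rewrite integral_mkcond.
have /(integrable_mkcond _ mb) fi := box_integrable cf.
rewrite -[LHS](integral21_prod_meas1 fi).
rewrite [RHS]integral_mkcond; apply: eq_integral => z _.
rewrite /fubini_G patchE; case: ifPn => [/set_mem zcd|zcd].
  rewrite [RHS]integral_mkcond; apply: eq_integral => r _.
  rewrite !patchE; congr (if _ then _ else _).
  by apply/idP/idP => /set_mem h; apply/mem_set; [case: h|split].
apply: integral0_eq => r _; rewrite patchE; case: ifPn => // /set_mem[_ h].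
by move: zcd; rewrite mem_set.
Qed.

Lemma box_integralC (f : R -> R -> R) a b c d :
  (forall r z, a <= r <= b -> c <= z <= d -> cont2 f r z) ->
  (\int[leb2]_(p in box a b c d) (f p.1 p.2)%:E =
   \int[leb]_(r in `[a, b]) \int[leb]_(z in `[c, d]) (f r z)%:E)%E.
Proof.
move=> cf; have mb := measurable_box a b c d.
rewrite integral_mkcond.
have /(integrable_mkcond _ mb) fi := box_integrable cf.
rewrite -[LHS](integral12_prod_meas1 fi).
rewrite [RHS]integral_mkcond; apply: eq_integral => r _.
rewrite /fubini_F patchE; case: ifPn => [/set_mem rab|rab].
  rewrite [RHS]integral_mkcond; apply: eq_integral => z _.
  rewrite !patchE; congr (if _ then _ else _).
  by apply/idP/idP => /set_mem h; apply/mem_set; [case: h|split].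
apply: integral0_eq => z _; rewrite patchE; case: ifPn => // /set_mem[h _].
by move: rab; rewrite mem_set.
Qed.

Lemma box_dr (P P1 : R -> R -> R) (a b c d : R) : a < b ->
  (forall r z, a <= r <= b -> c <= z <= d -> is_derive r 1 (P ^~ z) (P1 r z)) ->
  (forall r z, a <= r <= b -> c <= z <= d -> cont2 P1 r z) ->
  (\int[leb2]_(p in box a b c d) (P1 p.1 p.2)%:E =
   \int[leb]_(z in `[c, d]) (P b z - P a z)%:E)%E.
Proof.
move=> ab dP cP; rewrite box_integral //; apply: eq_integral => z.
rewrite inE /= in_itv /= => zcd.
apply: (FTC_segment (f := P1 ^~ z) (F := P ^~ z)) => // x xab; first exact: dP.
exact: c2_slicer (cP _ _ xab zcd).
Qed.

Lemma box_dz (P P2 : R -> R -> R) (a b c d : R) : c < d ->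
  (forall r z, a <= r <= b -> c <= z <= d -> is_derive z 1 (P r) (P2 r z)) ->
  (forall r z, a <= r <= b -> c <= z <= d -> cont2 P2 r z) ->
  (\int[leb2]_(p in box a b c d) (P2 p.1 p.2)%:E =
   \int[leb]_(r in `[a, b]) (P r d - P r c)%:E)%E.
Proof.
move=> ab dP cP; rewrite box_integralC //; apply: eq_integral => r.
rewrite inE /= in_itv /= => rab.
apply: (FTC_segment (f := P2 r) (F := P r)) => // x xab; first exact: dP.
exact: c2_slicez (cP _ _ rab xab).
Qed.

End Boxes.

Section HalfPlane.
Context {R : realType}.
Notation leb := (@lebesgue_measure R).
Notation leb2 := (leb \x leb)%E.
Notation hp := (@half_plane R).
Implicit Types f g : R -> R -> R.

Lemma hp_integrable_eq f g : (forall r z, 0 < r -> f r z = g r z) ->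
  hp_integrable f -> hp_integrable g.
Proof.
by move=> fg; apply: eq_integrable => [|[r z] /set_mem /= /fg ->//]; exact: measurable_half_plane.
Qed.

Lemma hp_integral_eq f g : (forall r z, 0 < r -> f r z = g r z) ->
  hp_integral f = hp_integral g.
Proof. by move=> fg; apply: eq_Rintegral => -[r z] /set_mem /= /fg. Qed.

Lemma hp_integrableD f g : hp_integrable f -> hp_integrable g ->
  hp_integrable (fun r z => f r z + g r z).
Proof.
move=> fi gi; rewrite /hp_integrable; under eq_fun do rewrite EFinD.
exact: (integrableD measurable_half_plane fi gi).
Qed.

Lemma hp_integrableZ k f : hp_integrable f -> hp_integrable (fun r z => k * f r z).
Proof.
move=> fi; rewrite /hp_integrable; under eq_fun do rewrite EFinM.
exact: (integrableZl measurable_half_plane k fi).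
Qed.

Lemma hp_integrable_norm f : hp_integrable f -> hp_integrable (fun r z => `|f r z|).
Proof. by move=> ?; apply: integrable_norm. Qed.

Lemma hp_integralD f g : hp_integrable f -> hp_integrable g ->
  hp_integral (fun r z => f r z + g r z) = hp_integral f + hp_integral g.
Proof. by move=> ? ?; apply: RintegralD => //; exact: measurable_half_plane. Qed.

Lemma hp_integralZ k f : hp_integrable f ->
  hp_integral (fun r z => k * f r z) = k * hp_integral f.
Proof. by move=> ?; apply: RintegralZl => //; exact: measurable_half_plane. Qed.

Lemma hp_integral_ge0 f : (forall r z, 0 < r -> 0 <= f r z) -> 0 <= hp_integral f.
Proof. by move=> f0; apply: Rintegral_ge0 => -[r z] /=; exact: f0. Qed.

Lemma hp_integral_le f g : hp_integrable f -> hp_integrable g ->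
  (forall r z, 0 < r -> f r z <= g r z) -> hp_integral f <= hp_integral g.
Proof.
move=> fi gi fg; apply: le_Rintegral => //; first exact: measurable_half_plane.
by move=> -[r z] /=; exact: fg.
Qed.

Lemma hp_integrable_le f g : (forall r z, 0 < r -> cont2 f r z) ->
  hp_integrable g -> (forall r z, 0 < r -> `|f r z| <= g r z) -> hp_integrable f.
Proof.
move=> cf gi fg; apply: le_integrable gi => //; first exact: measurable_half_plane.
  by apply/measurable_EFinP; exact: hp_measurable.
by move=> -[r z] /= r0; rewrite lee_fin (le_trans (fg _ _ r0)) // ler_norm.
Qed.

Lemma hp_integralE f : hp_integrable f ->
  (\int[leb2]_(p in hp) (f p.1 p.2)%:E = (hp_integral f)%:E)%E.
Proof.
by move=> fi; rewrite /hp_integral /Rintegral fineK // integrable_fin_num //; exact: measurable_half_plane.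
Qed.

Lemma patch_hp (f : R -> R -> R) B : B `<=` hp ->
  (\int[leb2]_(p in hp) ((fun p => (f p.1 p.2)%:E) \_ B) p = \int[leb2]_(p in B) (f p.1 p.2)%:E)%E.
Proof. by move=> BD; rewrite -integral_mkcondr; congr (integral _ _ _); apply/setIidPr. Qed.

Lemma patch_hp_measurable (f : R -> R -> R) B : measurable B -> B `<=` hp ->
  (forall p, B p -> cont2 f p.1 p.2) ->
  measurable_fun hp ((fun p => (f p.1 p.2)%:E) \_ B).
Proof.
move=> mB BD cf; apply/(measurable_restrict _ mB measurable_half_plane).
have -> : hp `&` B = B by apply/setIidPr.
apply/measurable_EFinP; exact: c2_measurable.
Qed.

Section Exhaustion.
Variables (fn : nat -> R -> R -> R) (f : R -> R -> R).
Variable (B : nat -> set (measurableTypeR R * measurableTypeR R)).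
Hypothesis mB : forall n, measurable (B n).
Hypothesis Bhp : forall n, B n `<=` hp.
Hypothesis exhaust : forall p, hp p -> \forall n \near \oo, B n p.
Hypothesis cfn : forall n p, B n p -> cont2 (fn n) p.1 p.2.
Hypothesis fnf : forall r z, 0 < r -> fn n r z @[n --> \oo] --> f r z.

Let pn n := (fun p : measurableTypeR R * measurableTypeR R => (fn n p.1 p.2)%:E) \_ (B n).

Let pn_cvg p : hp p -> pn n p @[n --> \oo] --> (f p.1 p.2)%:E.
Proof.
move=> hpp.
have h : (fn n p.1 p.2)%:E @[n --> \oo] --> (f p.1 p.2)%:E.
  by apply: cvg_EFin; [exact: nearW|exact: fnf].
apply: cvg_trans h; apply: near_eq_cvg; near=> n; rewrite /pn patchE ifT //; apply/mem_set.
by near: n; exact: exhaust.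
Unshelve. all: by end_near. Qed.

(** Extended by zero outside [B n], the functions [fn n] converge pointwise on the half-plane
    because each point eventually stays in [B n]. Dominated convergence then applies although both
    the domain and the integrand vary. *)
Lemma exhaust_dominated (g : R -> R -> R) :
  hp_integrable g -> (forall n p, B n p -> `|fn n p.1 p.2| <= g p.1 p.2) ->
  (forall r z, 0 < r -> 0 <= g r z) ->
  hp_integrable f /\
  (\int[leb2]_(p in B n) (fn n p.1 p.2)%:E @[n --> \oo] --> (hp_integral f)%:E)%E.
Proof.
move=> gi fg g0.
have mpn n : measurable_fun hp (pn n).
  by apply: patch_hp_measurable => //; exact: cfn.
have mf : measurable_fun hp (fun p => (f p.1 p.2)%:E).
  by apply: (emeasurable_fun_cvg pn) => // p hpp; exact: pn_cvg.
have pg p n : hp p -> (`|pn n p| <= (g p.1 p.2)%:E)%E.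
  move=> hpp; rewrite /pn patchE; case: ifPn => [/set_mem Bp|_]; rewrite /= lee_fin; first exact: fg.
  by rewrite normr0; exact: g0.
have [fi _ h] := dominated_convergence measurable_half_plane mpn mf
  (aeW _ pn_cvg) gi (aeW _ pg).
split => //; rewrite -hp_integralE //; apply: cvg_trans h.
by apply: near_eq_cvg; near=> n; rewrite -[RHS](patch_hp _ (@Bhp n)).
Unshelve. all: by end_near. Qed.

(** The tool for proving finiteness: a bound on the truncated integrals that is uniform in [n]
    passes to the limit by Fatou, with no dominating function at hand. *)
Lemma exhaust_fatou (M : R) :
  (forall n p, B n p -> 0 <= fn n p.1 p.2) ->
  (forall n, \int[leb2]_(p in B n) (fn n p.1 p.2)%:E <= M%:E)%E -> hp_integrable f.
Proof.
move=> fn0 fnM.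
have mpn n : measurable_fun hp (pn n).
  by apply: patch_hp_measurable => //; exact: cfn.
have mf : measurable_fun hp (fun p => (f p.1 p.2)%:E).
  by apply: (emeasurable_fun_cvg pn) => // p hpp; exact: pn_cvg.
have pn0 n p : hp p -> (0 <= pn n p)%E.
  by move=> _; rewrite /pn patchE; case: ifPn => [/set_mem Bp|_] //; rewrite lee_fin fn0.
have f0 p : hp p -> 0 <= f p.1 p.2.
  move=> hpp; rewrite -lee_fin; apply: (closed_cvg _ (@closed_ereal_le_ereal _ 0)) (pn_cvg hpp).
  by apply: nearW => n; exact: pn0.
apply/integrableP; split => //.
apply: (@le_lt_trans _ _ M%:E); last exact: ltry.
have -> : (\int[leb2]_(p in hp) `|(f p.1 p.2)%:E| = \int[leb2]_(p in hp) limn_einf (pn ^~ p))%E.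
  apply: eq_integral => p /set_mem hpp; rewrite gee0_abs ?lee_fin ?f0 //.
  by rewrite (cvg_limn_einf_sup (pn_cvg hpp)).1.
apply: (le_trans (fatou _ measurable_half_plane mpn pn0)).
rewrite limn_einf_lim; apply: lime_le; first exact: is_cvg_einfs.
apply: nearW => n; apply: le_trans (fnM n); apply: ereal_inf_lbound.
by exists n => //=; rewrite patch_hp.
Qed.
End Exhaustion.
End HalfPlane.

(** * Divergence theorem with cutoffs *)

Section Cutoff.
Context {R : realType}.
Notation leb := (@lebesgue_measure R).
Notation leb2 := (leb \x leb)%E.
Notation hp := (@half_plane R).

(** The shift by 2 keeps [side n] above 1, so that the interval from its inverse to itself is not
    degenerate. With [eps n] the inverse square, the factors [1 - e r^2], [1 - e / r^2] and
    [1 - e z^2] vanish exactly on the sides of [cutoff_box n]. *)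
Definition side (n : nat) : R := n.+2%:R.
Definition eps (n : nat) : R := (side n ^+ 2)^-1.

Definition cutoff_box (n : nat) := box (side n)^-1 (side n) (- side n) (side n).

Lemma side_gt1 n : 1 < side n.
Proof. by rewrite /side ltr1n. Qed.

Lemma side_gt0 n : 0 < side n.
Proof. by have := side_gt1 n; lra. Qed.

Lemma eps_gt0 n : 0 < eps n.
Proof. by rewrite /eps invr_gt0 exprn_gt0 // side_gt0. Qed.

Lemma sideV_lt n : (side n)^-1 < side n.
Proof.
have h := side_gt1 n; apply: (@lt_trans _ _ 1) => //.
by rewrite invf_lt1 // side_gt0.
Qed.

Lemma epsE n : eps n * side n ^+ 2 = 1.
Proof. by rewrite /eps mulVf // expf_neq0 // gt_eqF // side_gt0. Qed.

Lemma near_side (x : R) : \forall n \near \oo, x <= side n.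
Proof.
near=> n; apply: (@le_trans _ _ n%:R); last by rewrite /side ler_nat; exact: leqW (leqnSn n).
by near: n; exact: nbhs_infty_ger.
Unshelve. all: by end_near. Qed.

Lemma eps_cvg : eps n @[n --> \oo] --> (0 : R).
Proof.
apply/cvgr0Pnorm_lt => e e0; near=> n.
rewrite ger0_norm ?(ltW (eps_gt0 n)) // /eps invf_plt ?posrE ?exprn_gt0 ?side_gt0 //.
have h1 := side_gt1 n.
have : e^-1 + 1 <= side n by near: n; exact: near_side.
by nra.
Unshelve. all: by end_near. Qed.

Lemma eps_r n (r : R) : (side n)^-1 <= r <= side n ->
  [/\ 0 < r, 0 <= eps n * r ^+ 2 <= 1 & 0 <= eps n / r ^+ 2 <= 1].
Proof.
move=> /andP[h1 h2]; have s0 := side_gt0 n; have e0 := eps_gt0 n.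
have r0 : 0 < r by apply: lt_le_trans h1; rewrite invr_gt0.
split => //.
  rewrite mulr_ge0 ?(ltW e0) ?sqr_ge0 //= -(epsE n) ler_pM2l //.
  by rewrite ler_sqr ?nnegrE ?(ltW r0) ?(ltW s0).
rewrite divr_ge0 ?(ltW e0) ?sqr_ge0 //= ler_pdivrMr ?exprn_gt0 // mul1r /eps -exprVn.
by rewrite ler_sqr ?nnegrE ?invr_ge0 ?(ltW r0) ?(ltW s0).
Qed.

Lemma eps_z n (z : R) : - side n <= z <= side n -> 0 <= eps n * z ^+ 2 <= 1.
Proof.
move=> h; have s0 := side_gt0 n; have e0 := eps_gt0 n.
rewrite mulr_ge0 ?(ltW e0) ?sqr_ge0 //= -(epsE n) ler_pM2l //.
by rewrite -(real_normK (num_real z)) ler_sqr ?nnegrE ?(ltW s0) // ler_norml.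
Qed.

(* [rcut1] and [rcut2] are [r] times the partial derivatives of [cut]; unlike
   the latter they are bounded uniformly in [e]. *)
Definition cut (e r z : R) : R := (1 - e * r ^+ 2) * (1 - e / r ^+ 2) * (1 - e * z ^+ 2).
Definition rcut1 (e r z : R) : R := 2 * (e / r ^+ 2 - e * r ^+ 2) * (1 - e * z ^+ 2).
Definition rcut2 (e r z : R) : R := - 2 * (1 - e * r ^+ 2) * (1 - e / r ^+ 2) * (e * z * r).

Lemma cut_bounds n r z : cutoff_box n (r, z) ->
  [/\ 0 <= cut (eps n) r z <= 1, `|rcut1 (eps n) r z| <= 2 &
      `|rcut2 (eps n) r z| <= 2].
Proof.
move=> /boxP[/eps_r [r0 /andP[u0 u1] /andP[v0 v1]] /eps_z/andP[w0 w1]].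
have := sqr_ge0 (r - z); have := sqr_ge0 (r + z).
have e0 := eps_gt0 n.
rewrite /cut /rcut1 /rcut2; set e := eps n in u0 u1 v0 v1 w0 w1 e0 *.
move=> sp sm.
(* Arithmetic-geometric mean: [e |z r|] is at most half of [e r^2 + e z^2], and both terms are at
   most 1. *)
have m1 : -1 <= e * z * r by nra.
have m2 : e * z * r <= 1 by nra.
move: u0 u1 v0 v1 w0 w1 m1 m2; move: (e * r ^+ 2) (e / r ^+ 2) (e * z ^+ 2) (e * z * r).
clear => u v w m u0 u1 v0 v1 w0 w1 m1 m2.
have p0 : 0 <= (1 - u) * (1 - v) by rewrite mulr_ge0 ?subr_ge0.
have p1 : (1 - u) * (1 - v) <= 1 by nra.
split.
- by rewrite mulr_ge0 ?subr_ge0 //=; nra.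
- rewrite ler_norml; nra.
- by rewrite ler_norml -mulrA; nra.
Qed.

(** The divergence of the field [cut^2 (P, Q)] when [f] is the divergence of [(P, Q)]. The flux is
    divided by [r] so that only the bounded quantities [rcut1] and [rcut2] multiply it; the square
    leaves one factor [cut] on the cross terms, which the absorption argument needs. *)
Definition cut_div (e : R) (P Q f : R -> R -> R) (r z : R) : R :=
  f r z * cut e r z ^+ 2 +
  2 * cut e r z * (P r z / r * rcut1 e r z + Q r z / r * rcut2 e r z).

Section Divergence.
Variables (P P1 Q Q2 : R -> R -> R).
Hypothesis dP : forall r z : R, 0 < r -> is_derive r 1 (P ^~ z) (P1 r z).
Hypothesis dQ : forall r z : R, 0 < r -> is_derive z 1 (Q r) (Q2 r z).
Hypothesis cP : forall r z : R, 0 < r -> cont2 P r z.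
Hypothesis cP1 : forall r z : R, 0 < r -> cont2 P1 r z.
Hypothesis cQ : forall r z : R, 0 < r -> cont2 Q r z.
Hypothesis cQ2 : forall r z : R, 0 < r -> cont2 Q2 r z.

Let f r z := P1 r z + Q2 r z.

Lemma c2_cut_div e r z : 0 < r -> cont2 (cut_div e P Q f) r z.
Proof.
move=> r0; have rn0 : r != 0 by rewrite gt_eqF.
have r2n0 : r ^+ 2 != 0 by rewrite expf_neq0.
have := @cP r z r0; have := @cQ r z r0; have := @cP1 r z r0; have := @cQ2 r z r0 => ? ? ? ?.
rewrite /cut_div /f /cut /rcut1 /rcut2; c2.
Qed.

(** The cutoff vanishes on all four sides of the box, so neither pair of opposite sides contributes
    a boundary term. *)
Lemma cut_div_integral0 n :
  (\int[leb2]_(p in cutoff_box n) (cut_div (eps n) P Q f p.1 p.2)%:E = 0)%E.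
Proof.
set e := eps n; have es := epsE n; rewrite -/e in es.
have s0 := side_gt0 n; have sn0 : side n != 0 by rewrite gt_eqF.
pose X r z := P r z * cut e r z ^+ 2.
pose X1 r z := P1 r z * cut e r z ^+ 2 + 2 * cut e r z * (P r z / r * rcut1 e r z).
pose Y r z := Q r z * cut e r z ^+ 2.
pose Y2 r z := Q2 r z * cut e r z ^+ 2 + 2 * cut e r z * (Q r z / r * rcut2 e r z).
have cX1 r z : (side n)^-1 <= r <= side n -> - side n <= z <= side n -> cont2 X1 r z.
  move=> /eps_r[r0 _ _] _; have rn0 : r != 0 by rewrite gt_eqF.
  have r2n0 : r ^+ 2 != 0 by rewrite expf_neq0.
  have := @cP r z r0; have := @cP1 r z r0 => ? ?.
  rewrite /X1 /cut /rcut1; c2.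
have cY2 r z : (side n)^-1 <= r <= side n -> - side n <= z <= side n -> cont2 Y2 r z.
  move=> /eps_r[r0 _ _] _; have rn0 : r != 0 by rewrite gt_eqF.
  have r2n0 : r ^+ 2 != 0 by rewrite expf_neq0.
  have := @cQ r z r0; have := @cQ2 r z r0 => ? ?.
  rewrite /Y2 /cut /rcut2; c2.
have -> : (fun p : R * R => (cut_div e P Q f p.1 p.2)%:E) =
    (fun p => (X1 p.1 p.2)%:E + (Y2 p.1 p.2)%:E)%E.
  apply/funext => -[r z] /=; rewrite -EFinD; congr (_%:E).
  by rewrite /cut_div /f /X1 /Y2; ring.
rewrite integralD; last 3 first.
- exact: measurable_box.
- exact: box_integrable.
- exact: box_integrable.
have -> : (\int[leb2]_(p in cutoff_box n) (X1 p.1 p.2)%:E =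
    \int[leb]_(z in `[(- side n)%R, side n]) (X (side n) z - X (side n)^-1%R z)%:E)%E.
  apply: box_dr => //; first exact: sideV_lt.
  move=> r z /eps_r[r0 _ _] _; have rn0 : r != 0 by rewrite gt_eqF.
  have r2n0 : r ^+ 2 != 0 by rewrite expf_neq0.
  have dPr := @dP r z r0.
  rewrite /X /cut; eapply derE; first by der.
  by rewrite /X1 /cut /rcut1 /=; field.
have -> : (\int[leb2]_(p in cutoff_box n) (Y2 p.1 p.2)%:E =
    \int[leb]_(r in `[(side n)^-1%R, side n]) (Y r (side n) - Y r (- side n)%R)%:E)%E.
  apply: box_dz => //; first by rewrite gtrN.
  move=> r z /eps_r[r0 _ _] _; have rn0 : r != 0 by rewrite gt_eqF.
  have dQr := @dQ r z r0.
  rewrite /Y /cut; eapply derE; first by der.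
  by rewrite /Y2 /cut /rcut2 /=; field.
rewrite !integral0_eq ?adde0 // => x _.
  rewrite /Y /cut sqrrN es subrr !mulr0 expr0n /= !mulr0; congr (_%:E); ring.
rewrite /X /cut exprVn invrK es subrr !mulr0 mul0r !mul0r expr0n /= !mulr0; congr (_%:E); ring.
Qed.

Lemma cutoff_box_hp n : cutoff_box n `<=` hp.
Proof. by move=> -[r z] /boxP[/eps_r[]]. Qed.

Lemma cutoff_box_exhaust p : hp p -> \forall n \near \oo, cutoff_box n p.
Proof.
case: p => r z /= r0; near=> n; apply/boxP; split; apply/andP; split.
- rewrite invf_ple ?posrE ?side_gt0 //; near: n; exact: near_side.
- by near: n; exact: near_side.
- by rewrite lerNl; near: n; exact: near_side.
- by near: n; exact: near_side.
Unshelve. all: by end_near. Qed.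

Lemma cut_div_cvg r z : 0 < r -> cut_div (eps n) P Q f r z @[n --> \oo] --> f r z.
Proof.
move=> r0; apply: (@cvg_comp _ _ _ _ (fun e => cut_div e P Q f r z) _ (nbhs (0 : R))).
  exact: eps_cvg.
(* At [e = 0] the cutoff is 1 and its scaled derivatives vanish; since the expression is polynomial
   in [e], the limit is its value at 0. *)
have -> : f r z = cut_div 0 P Q f r z.
  rewrite /cut_div /cut /rcut1 /rcut2.
  move: (f r z) (P r z / r) (Q r z / r) => F p q.
  by rewrite !mul0r; ring.
have : exists a, is_derive (0 : R) 1 (fun e => cut_div e P Q f r z) a.
  by eexists; rewrite /cut_div /cut /rcut1 /rcut2; der.
by move=> [a /der_cont]; exact.
Qed.

(* Integrability of [P / r] and [Q / r] makes the flux through the cutoff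
   region vanish in the limit. *)
Lemma hp_divergence : hp_integrable f ->
  hp_integrable (fun r z => P r z / r) -> hp_integrable (fun r z => Q r z / r) ->
  hp_integral f = 0.
Proof.
move=> fi Pi Qi.
(* The coefficients of the cross terms are [2 * cut * rcut], at most 4 in absolute value. *)
pose g r z := `|f r z| + (4 * `|P r z / r| + 4 * `|Q r z / r|).
have gi : hp_integrable g.
  by do ! apply: hp_integrableD; do ? apply: hp_integrableZ; apply: hp_integrable_norm.
have [||||_ h] := @exhaust_dominated R (fun n => cut_div (eps n) P Q f) f cutoff_box
  _ cutoff_box_hp cutoff_box_exhaust _ cut_div_cvg g gi.
- by move=> n; exact: measurable_box.
- by move=> n [r z] /cutoff_box_hp; exact: c2_cut_div.
- move=> n [r z] /cut_bounds[/andP[c0 c1] b1 b2] /=.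
  rewrite /cut_div /g; move: (cut _ _ _) (rcut1 _ _ _) (rcut2 _ _ _) c0 c1 b1 b2 => c x y c0 c1 b1 b2.
  move: (P r z / r) (Q r z / r) => p q.
  apply: le_trans (ler_normD _ _) _; rewrite normrM; apply: lerD.
    by rewrite ler_piMr // ger0_norm ?exprn_ge0 // exprn_ile1.
  rewrite normrM (@ger0_norm _ (2 * c)) ?mulr_ge0 //.
  apply: (@le_trans _ _ (2 * (`|p| * 2 + `|q| * 2))); last lra.
  have c2 : 2 * c <= 2 by lra.
  have c20 : 0 <= 2 * c by rewrite mulr_ge0.
  apply: ler_pM => //.
  apply: le_trans (ler_normD _ _) _.
  by apply: lerD; rewrite normrM ler_wpM2l.
- by move=> r z _; rewrite /g !addr_ge0 ?mulr_ge0.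
move: h; under eq_fun do rewrite cut_div_integral0.
move=> /(cvg_lim (@ereal_hausdorff R)).
by rewrite lim_cst // => -[].
Qed.

(* The cross terms of the cutoff identity are absorbed by the part
   [G cut^2 / 4] of the left-hand side, uniformly in the cutoff. *)
Lemma hp_absorption (G D : R -> R -> R) :
  (forall r z : R, 0 < r -> cont2 G r z) -> (forall r z : R, 0 < r -> cont2 D r z) ->
  (forall r z : R, 0 < r -> 0 <= G r z) -> (forall r z : R, 0 < r -> 0 <= D r z) ->
  hp_integrable D ->
  (forall r z : R, 0 < r -> G r z / 2 - D r z <= f r z) ->
  (forall r z : R, 0 < r -> (P r z / r) ^+ 2 <= G r z * D r z) ->
  (forall r z : R, 0 < r -> (Q r z / r) ^+ 2 <= G r z * D r z) ->
  hp_integrable G.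
Proof.
move=> cG cD G0 D0 Di fGD PGD QGD.
have mh := measurable_half_plane (R := R).
suff : hp_integrable (fun r z => 4^-1 * G r z).
  move=> /(hp_integrableZ 4); apply: hp_integrable_eq => r z _; lra.
pose fn n r z := 4^-1 * G r z * cut (eps n) r z ^+ 2.
have cfn n r z : 0 < r -> cont2 (fn n) r z.
  move=> r0; have rn0 : r != 0 by rewrite gt_eqF.
  have r2n0 : r ^+ 2 != 0 by rewrite expf_neq0.
  have ? := @cG r z r0.
  rewrite /fn /cut; c2.
apply: (@exhaust_fatou R fn _ cutoff_box _ cutoff_box_hp cutoff_box_exhaust _ _ (65 * hp_integral D)).
- by move=> n; exact: measurable_box.
- by move=> n [r z] /cutoff_box_hp; exact: cfn.
- move=> r z r0; pose h (e : R) := 4^-1 * G r z * cut e r z ^+ 2.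
  have -> : 4^-1 * G r z = h 0 by rewrite /h /cut; ring.
  apply: (@cvg_comp _ _ _ _ h _ (nbhs (0 : R))); first exact: eps_cvg.
  have : exists a, is_derive (0 : R) 1 h a by eexists; rewrite /h /cut; der.
  by move=> [a /der_cont]; exact.
- move=> n [r z] /cutoff_box_hp r0 /=.
  by rewrite /fn mulr_ge0 ?sqr_ge0 // mulr_ge0 ?invr_ge0 //; exact: G0.
move=> n; have mb : measurable (cutoff_box n) by exact: measurable_box.
have inb (F : R -> R -> R) : (forall r z : R, 0 < r -> cont2 F r z) ->
    leb2.-integrable (cutoff_box n) (fun p => (F p.1 p.2)%:E).
  move=> cF; apply: box_integrable => r z /eps_r[r0 _ _] _; exact: cF.
have icd : leb2.-integrable (cutoff_box n) (fun p => (cut_div (eps n) P Q f p.1 p.2)%:E).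
  by apply: inb => r z; exact: c2_cut_div.
have iD : leb2.-integrable (cutoff_box n) (fun p => (65 * D p.1 p.2)%:E).
  apply: (inb (fun r z => 65 * D r z)) => r z r0; have ? := @cD r z r0; c2.
apply: (@le_trans _ _ (\int[leb2]_(p in cutoff_box n)
    ((cut_div (eps n) P Q f p.1 p.2)%:E + (65 * D p.1 p.2)%:E))%E).
  apply: le_integral => //; first by apply: inb => r z; exact: cfn.
    exact: integrableD.
  move=> [r z] /set_mem hb; rewrite -EFinD lee_fin /=.
  have r0 := cutoff_box_hp hb.
  have [/andP[c0 c1] b1 b2] := cut_bounds hb.
  have := fGD r z r0; have := PGD r z r0; have := QGD r z r0.
  have := G0 r z r0; have := D0 r z r0.
  rewrite /fn /cut_div; move: (P r z / r) (Q r z / r) (G r z) (D r z) (f r z) => p q g d F d0 g0 qgd pgd fgd.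
  move: (cut _ _ _) (rcut1 _ _ _) (rcut2 _ _ _) c0 c1 b1 b2 => c x y c0 c1 b1 b2.
  (* Young's inequality balanced so that each cross term costs [c^2 g / 8]: the two of them leave
     [1/2 - 2/8 = 1/4] of [G]. The price in [D] is 32 for each, plus the original 1, which makes the
     constant 65. *)
  have key t s : t ^+ 2 <= g * d -> `|s| <= 2 -> - (c ^+ 2 * g / 8 + 32 * d) <= 2 * c * (t * s).
    move=> tgd s2.
    have : `|2 * c * (t * s)| <= c ^+ 2 * g / 8 + 32 * d.
      have A0 : 0 <= c ^+ 2 * g / 8 by rewrite divr_ge0 // mulr_ge0 // sqr_ge0.
      rewrite -ler_sqr ?nnegrE ?normr_ge0 ?addr_ge0 //; last by rewrite mulr_ge0.
      rewrite real_normK ?num_real //.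
      have s4 : s ^+ 2 <= 4.
        rewrite -(real_normK (num_real s)) (_ : 4 = 2 ^+ 2 :> R); last by ring.
        by rewrite ler_sqr ?nnegrE.
      have h1 : (2 * c * (t * s)) ^+ 2 <= 4 * c ^+ 2 * (g * d * 4).
        rewrite (_ : _ ^+ 2 = 4 * c ^+ 2 * (t ^+ 2 * s ^+ 2)); last by ring.
        apply: ler_wpM2l; first by have := sqr_ge0 c; lra.
        by apply: ler_pM; rewrite ?sqr_ge0.
      apply: le_trans h1 _.
      have := sqr_ge0 (c ^+ 2 * g / 8 - 32 * d); lra.
    by rewrite ler_norml => /andP[].
  have := key p x pgd b1; have := key q y qgd b2.
  have c21 : c ^+ 2 <= 1 by rewrite exprn_ile1.
  have c20 := sqr_ge0 c.
  nra.
rewrite integralD //= cut_div_integral0 add0e.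
apply: le_trans (ge0_subset_integral _ mb mh _ _ (@cutoff_box_hp n)) _.
- exact: (measurable_int _ (hp_integrableZ 65 Di)).
- by move=> [r z] /= r0; rewrite lee_fin mulr_ge0 // D0.
by rewrite (hp_integralE (hp_integrableZ 65 Di)) hp_integralZ.
Qed.

End Divergence.
End Cutoff.

(** * Energy, Hardy and flux identities *)

(* [a] is the even extension in [r] of an axis-compatible profile, with partial
   derivatives [a1], [a11] in [r] and [a2], [a22] in [z]. *)
Record even_C2 {R : realType} (a a1 a2 a11 a22 : R -> R -> R) : Prop := EvenC2 {
  ev_d1 : forall r z : R, is_derive r 1 (a ^~ z) (a1 r z);
  ev_d11 : forall r z : R, is_derive r 1 (a1 ^~ z) (a11 r z);
  ev_d2 : forall r z : R, is_derive z 1 (a r) (a2 r z);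
  ev_d22 : forall r z : R, is_derive z 1 (a2 r) (a22 r z);
  ev_c : forall r z : R, cont2 a r z;
  ev_c1 : forall r z : R, cont2 a1 r z;
  ev_c2 : forall r z : R, cont2 a2 r z;
  ev_c11 : forall r z : R, cont2 a11 r z;
  ev_c22 : forall r z : R, cont2 a22 r z;
  ev_even : forall r z : R, a (- r) z = a r z }.

Arguments ev_d1 {R a a1 a2 a11 a22} _ r z.
Arguments ev_d11 {R a a1 a2 a11 a22} _ r z.
Arguments ev_d2 {R a a1 a2 a11 a22} _ r z.
Arguments ev_d22 {R a a1 a2 a11 a22} _ r z.
Arguments ev_c {R a a1 a2 a11 a22} _ r z.
Arguments ev_c1 {R a a1 a2 a11 a22} _ r z.
Arguments ev_c2 {R a a1 a2 a11 a22} _ r z.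
Arguments ev_c11 {R a a1 a2 a11 a22} _ r z.
Arguments ev_c22 {R a a1 a2 a11 a22} _ r z.
Arguments ev_even {R a a1 a2 a11 a22} _ r z.

Section Energy.
Context {R : realType}.
Notation leb := (@lebesgue_measure R).
Notation leb2 := (leb \x leb)%E.
Notation hp := (@half_plane R).

Lemma powR_shift (r al : R) : 0 < r ->
  [/\ 0 < r `^ al, r `^ (al - 1) = r `^ al / r, r `^ (al - 2) = r `^ al / r ^+ 2
    & r `^ (al + 2) = r `^ al * r ^+ 2].
Proof.
move=> r0; have rn0 : r != 0 by rewrite gt_eqF.
split; first exact: powR_gt0.
- by rewrite powRB ?rn0 ?implybT // powRr1 // ltW.
- by rewrite powRB ?rn0 ?implybT // (powR_mulrn 2) // ltW.
- by rewrite powRD ?rn0 ?implybT // (powR_mulrn 2) // ltW.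
Qed.

Lemma sqpow_ge0 (x r p : R) : 0 <= x ^+ 2 * r `^ p.
Proof. by rewrite mulr_ge0 ?sqr_ge0 ?powR_ge0. Qed.

(** The condition that the squared flux over [r] is at most [G D], required by [hp_absorption], for
    the field [a grad a r^al]: here [x] stands for [a / r], [u] for one of the partial derivatives
    [y] and [w], [v] for [r k] and [p] for [r^al]. *)
Lemma absorb_bound (x u y w v c p : R) : 1 <= c -> u ^+ 2 <= y ^+ 2 + w ^+ 2 ->
  (x * u * p) ^+ 2 <= (y ^+ 2 + w ^+ 2) * p * (p * (c * x ^+ 2 + v ^+ 2)).
Proof.
move=> c1 uyw; have -> : (x * u * p) ^+ 2 = p ^+ 2 * (u ^+ 2 * x ^+ 2) by ring.
have -> : (y ^+ 2 + w ^+ 2) * p * (p * (c * x ^+ 2 + v ^+ 2)) =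
  p ^+ 2 * ((y ^+ 2 + w ^+ 2) * (c * x ^+ 2 + v ^+ 2)) by ring.
apply: ler_wpM2l; first exact: sqr_ge0.
apply: ler_pM; rewrite ?sqr_ge0 //.
have := sqr_ge0 v; have : x ^+ 2 <= c * x ^+ 2; last lra.
by rewrite ler_peMl ?sqr_ge0.
Qed.

Lemma cross_bound (x y p : R) : 0 <= p -> `|x * y * p| <= x ^+ 2 * p + y ^+ 2 * p.
Proof.
move=> p0; rewrite normrM (ger0_norm p0) -mulrDl ler_wpM2r // ler_norml.
by have := sqr_ge0 (x + y); have := sqr_ge0 (x - y); have := sqr_ge0 x;
  have := sqr_ge0 y; lra.
Qed.

Variables (a a1 a2 a11 a22 k : R -> R -> R).
Hypothesis Ha : even_C2 a a1 a2 a11 a22.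
Hypothesis ck : forall r z : R, 0 < r -> cont2 k r z.
Hypothesis Lap : forall r z : R, 0 < r -> a11 r z + 3 / r * a1 r z + a22 r z = - k r z.
Variable al : R.

(** [(P, Q)] is the field [a grad a r^al], the energy flux; [P1] and [Q2] are the two terms of its
    divergence. *)
Let P r z := a r z * a1 r z * r `^ al.
Let P1 r z := (a1 r z ^+ 2 + a r z * a11 r z) * r `^ al + al * a r z * a1 r z * r `^ (al - 1).
Let Q r z := a r z * a2 r z * r `^ al.
Let Q2 r z := (a2 r z ^+ 2 + a r z * a22 r z) * r `^ al.

Let dP (r z : R) : 0 < r -> is_derive r 1 (P ^~ z) (P1 r z).
Proof.
move=> r0; have d1 := ev_d1 Ha r z; have d11 := ev_d11 Ha r z.
rewrite /P; eapply derE; first by der.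
by rewrite /P1; ring.
Qed.

Let dQ (r z : R) : 0 < r -> is_derive z 1 (Q r) (Q2 r z).
Proof.
move=> r0; have d1 := ev_d2 Ha r z; have d11 := ev_d22 Ha r z.
rewrite /Q; eapply derE; first by der.
by rewrite /Q2; ring.
Qed.

Let cP (r z : R) : 0 < r -> cont2 P r z.
Proof. by move=> r0; have ? := ev_c Ha r z; have ? := ev_c1 Ha r z; rewrite /P; c2. Qed.
Let cQ (r z : R) : 0 < r -> cont2 Q r z.
Proof. by move=> r0; have ? := ev_c Ha r z; have ? := ev_c2 Ha r z; rewrite /Q; c2. Qed.
Let cP1 (r z : R) : 0 < r -> cont2 P1 r z.
Proof.
move=> r0; have ? := ev_c Ha r z; have ? := ev_c1 Ha r z; have ? := ev_c11 Ha r z.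
by rewrite /P1; c2.
Qed.
Let cQ2 (r z : R) : 0 < r -> cont2 Q2 r z.
Proof.
move=> r0; have ? := ev_c Ha r z; have ? := ev_c2 Ha r z; have ? := ev_c22 Ha r z.
by rewrite /Q2; c2.
Qed.

Hypothesis ai : hp_integrable (fun r z => a r z ^+ 2 * r `^ (al - 2)).

Section Identity.
Hypothesis Ei : hp_integrable (fun r z => (a1 r z ^+ 2 + a2 r z ^+ 2) * r `^ al).

Let i1 : hp_integrable (fun r z => a r z * a1 r z * r `^ (al - 1)).
Proof.
apply: hp_integrable_le (hp_integrableD ai Ei) _.
  by move=> r z r0; have ? := ev_c Ha r z; have ? := ev_c1 Ha r z; c2.
move=> r z r0; have rn0 : r != 0 by rewrite gt_eqF.
have [p0 -> -> _] := powR_shift al r0.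
have -> : a r z * a1 r z * (r `^ al / r) = a r z / r * a1 r z * r `^ al by field.
apply: le_trans (cross_bound _ _ (ltW p0)) _.
have := mulr_ge0 (sqr_ge0 (a2 r z)) (ltW p0).
have -> : (a r z / r) ^+ 2 * r `^ al = a r z ^+ 2 * (r `^ al / r ^+ 2) by field.
lra.
Qed.

Let i2 : hp_integrable (fun r z => a r z * a2 r z * r `^ (al - 1)).
Proof.
apply: hp_integrable_le (hp_integrableD ai Ei) _.
  by move=> r z r0; have ? := ev_c Ha r z; have ? := ev_c2 Ha r z; c2.
move=> r z r0; have rn0 : r != 0 by rewrite gt_eqF.
have [p0 -> -> _] := powR_shift al r0.
have -> : a r z * a2 r z * (r `^ al / r) = a r z / r * a2 r z * r `^ al by field.
apply: le_trans (cross_bound _ _ (ltW p0)) _.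
have := mulr_ge0 (sqr_ge0 (a1 r z)) (ltW p0).
have -> : (a r z / r) ^+ 2 * r `^ al = a r z ^+ 2 * (r `^ al / r ^+ 2) by field.
lra.
Qed.

Lemma hardy_integrable : hp_integrable (fun r z => a r z * a1 r z * r `^ (al - 1)).
Proof. exact: i1. Qed.

(** The divergence of [(a^2 r^(al - 1), 0)] integrates to 0. This flux divided by [r] is the density
    [a^2 r^(al - 2)], so the integrability of that density removes the contributions of both the
    axis and infinity. *)
Lemma hardy_identity :
  2 * hp_integral (fun r z => a r z * a1 r z * r `^ (al - 1)) =
  - (al - 1) * hp_integral (fun r z => a r z ^+ 2 * r `^ (al - 2)).
Proof.
pose S r z := a r z ^+ 2 * r `^ (al - 1).
pose S1 r z := 2 * (a r z * a1 r z * r `^ (al - 1)) + (al - 1) * (a r z ^+ 2 * r `^ (al - 2)).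
have i3 := hp_integrableZ 2 i1; have i4 := hp_integrableZ (al - 1) ai.
suff : hp_integral (fun r z => S1 r z + 0) = 0.
  rewrite (@hp_integral_eq _ _ S1); last by move=> r z _; rewrite addr0.
  rewrite /S1 (hp_integralD i3 i4) (hp_integralZ _ i1) (hp_integralZ _ ai).
  by move/eqP; rewrite addr_eq0 => /eqP ->; rewrite mulNr.
apply: (@hp_divergence R S S1 (fun _ _ => 0) (fun _ _ => 0)).
- move=> r z r0; have d1 := ev_d1 Ha r z; rewrite /S; eapply derE; first by der.
  have -> : al - 1 - 1 = al - 2 by ring.
  by rewrite /S1; ring.
- by move=> r z r0; have ? := ev_c Ha r z; rewrite /S; c2.
- by move=> r z r0; have ? := ev_c Ha r z; have ? := ev_c1 Ha r z; rewrite /S1; c2.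
- by move=> r z r0; c2.
- by move=> r z r0; c2.
- by apply: hp_integrable_eq (hp_integrableD i3 i4) => r z _; rewrite addr0.
- apply: hp_integrable_eq ai => r z r0; have rn0 : r != 0 by rewrite gt_eqF.
  by rewrite /S; have [p0 -> -> _] := powR_shift al r0; field.
- by apply: hp_integrable_eq (hp_integrableZ 0 ai) => r z _; rewrite !mul0r.
Qed.

Hypothesis ki : hp_integrable (fun r z => k r z ^+ 2 * r `^ (al + 2)).

Lemma source_integrable : hp_integrable (fun r z => k r z * a r z * r `^ al).
Proof.
apply: hp_integrable_le (hp_integrableD ai ki) _.
  by move=> r z r0; have ? := ev_c Ha r z; have ? := @ck r z r0; c2.
move=> r z r0; have rn0 : r != 0 by rewrite gt_eqF.
have [p0 _ -> ->] := powR_shift al r0.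
have -> : k r z * a r z * r `^ al = a r z / r * (k r z * r) * r `^ al by field.
apply: le_trans (cross_bound _ _ (ltW p0)) _.
have -> : (a r z / r) ^+ 2 * r `^ al = a r z ^+ 2 * (r `^ al / r ^+ 2) by field.
by have -> : (k r z * r) ^+ 2 * r `^ al = k r z ^+ 2 * (r `^ al * r ^+ 2) by ring.
Qed.

(** The operator is in divergence form for the weight [r^3]; testing it with [r^al] leaves the term
    [(al - 3) a a_r r^(al - 1)], which [hardy_identity] converts into the zero-order term with
    coefficient [(3 - al)(al - 1) / 2]. *)
Lemma energy_identity :
  hp_integral (fun r z => k r z * a r z * r `^ al) =
  hp_integral (fun r z => (a1 r z ^+ 2 + a2 r z ^+ 2) * r `^ al)
  + (3 - al) * (al - 1) / 2 * hp_integral (fun r z => a r z ^+ 2 * r `^ (al - 2)).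
Proof.
have fE r z : 0 < r -> P1 r z + Q2 r z = (a1 r z ^+ 2 + a2 r z ^+ 2) * r `^ al +
    ((al - 3) * (a r z * a1 r z * r `^ (al - 1)) + (-1) * (k r z * a r z * r `^ al)).
  move=> r0; have rn0 : r != 0 by rewrite gt_eqF.
  have := Lap z r0; rewrite /P1 /Q2; have [p0 -> _ _] := powR_shift al r0 => L.
  have -> : a22 r z = - k r z - a11 r z - 3 / r * a1 r z by lra.
  by field.
have i3 := hp_integrableZ (al - 3) i1; have i4 := hp_integrableZ (-1) source_integrable.
have i5 := hp_integrableD Ei (hp_integrableD i3 i4).
have : hp_integral (fun r z => P1 r z + Q2 r z) = 0.
  apply: (hp_divergence dP dQ cP cP1 cQ cQ2).
  - by apply: hp_integrable_eq i5 => r z r0; rewrite fE.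
  - apply: hp_integrable_eq i1 => r z r0; have rn0 : r != 0 by rewrite gt_eqF.
    by rewrite /P; have [p0 -> _ _] := powR_shift al r0; field.
  - apply: hp_integrable_eq i2 => r z r0; have rn0 : r != 0 by rewrite gt_eqF.
    by rewrite /Q; have [p0 -> _ _] := powR_shift al r0; field.
rewrite (hp_integral_eq fE) (hp_integralD Ei (hp_integrableD i3 i4)) (hp_integralD i3 i4).
rewrite (hp_integralZ _ i1) (hp_integralZ _ source_integrable).
have := hardy_identity; move: (hp_integral _) (hp_integral _) (hp_integral _) (hp_integral _).
move=> x y z t h e.
have -> : (3 - al) * (al - 1) / 2 * z = (3 - al) / 2 * - (- (al - 1) * z) by field.
rewrite -h.
have -> : y + (3 - al) / 2 * - (2 * t) = y + ((al - 3) * t + -1 * x) + x by field.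
by rewrite e add0r.
Qed.

End Identity.

Hypothesis ki : hp_integrable (fun r z => k r z ^+ 2 * r `^ (al + 2)).

(** A Caccioppoli estimate: weighted square integrability of the solution and of the source forces
    finite energy. In the constant [c], the summand [(al - 3)^2] pays for the term
    [(al - 3) a a_r / r] and the summand 1 for the product of source and solution. *)
Lemma energy_integrable : hp_integrable (fun r z => (a1 r z ^+ 2 + a2 r z ^+ 2) * r `^ al).
Proof.
pose c := 1 + (al - 3) ^+ 2.
have c0 : 0 <= c by rewrite /c addr_ge0 // sqr_ge0.
apply: (@hp_absorption R P P1 Q Q2 dP dQ cP cP1 cQ cQ2 _
  (fun r z => c * (a r z ^+ 2 * r `^ (al - 2)) + k r z ^+ 2 * r `^ (al + 2))).
- by move=> r z r0; have ? := ev_c1 Ha r z; have ? := ev_c2 Ha r z; c2.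
- by move=> r z r0; have ? := ev_c Ha r z; have ? := @ck r z r0; c2.
- by move=> r z r0; rewrite mulr_ge0 ?addr_ge0 ?sqr_ge0 ?powR_ge0.
- by move=> r z r0; apply: addr_ge0; [apply: mulr_ge0 => //|]; exact: sqpow_ge0.
- by apply: hp_integrableD => //; exact: hp_integrableZ.
all: move=> r z r0; have rn0 : r != 0 by rewrite gt_eqF.
all: have [p0 e1 e2 e3] := powR_shift al r0; rewrite /P /P1 /Q /Q2 e2 e3 ?e1.
all: move: (Lap z r0) p0; move: (r `^ al) => p L p0.
all: have -> : a r z = a r z / r * r by rewrite divfK.
all: move: (a r z / r) (a1 r z) (a2 r z) (a11 r z) (a22 r z) (k r z) L => x y w y1 w2 v L.
- have -> : w2 = - v - y1 - 3 / r * y by lra.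
  have -> : c * ((x * r) ^+ 2 * (p / r ^+ 2)) + v ^+ 2 * (p * r ^+ 2) =
    p * ((1 + (al - 3) ^+ 2) * x ^+ 2 + (v * r) ^+ 2) by rewrite /c; field.
  have -> : (y ^+ 2 + x * r * y1) * p + al * (x * r) * y * (p / r) +
    (w ^+ 2 + x * r * (- v - y1 - 3 / r * y)) * p =
    p * (y ^+ 2 + w ^+ 2 - (v * r) * x + (al - 3) * x * y) by field.
  have -> : (y ^+ 2 + w ^+ 2) * p / 2 = p * ((y ^+ 2 + w ^+ 2) / 2) by field.
  rewrite -mulrBr ler_pM2l //.
  have := sqr_ge0 (y + (al - 3) * x); have := sqr_ge0 (v * r - x); have := sqr_ge0 w.
  have := sqr_ge0 (v * r); have := sqr_ge0 x; have := sqr_ge0 ((al - 3) * x).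
  by move: (v * r) (al - 3) => u b; lra.
all: have -> : c * ((x * r) ^+ 2 * (p / r ^+ 2)) + v ^+ 2 * (p * r ^+ 2) =
    p * (c * x ^+ 2 + (v * r) ^+ 2) by field.
- have -> : x * r * y * p / r = x * y * p by field.
  by apply: absorb_bound; rewrite ?lerDl ?sqr_ge0.
- have -> : x * r * w * p / r = x * w * p by field.
  by apply: absorb_bound; rewrite ?lerDl ?lerDr ?sqr_ge0.
Qed.
End Energy.

(** * Transfer of the z-derivative from the source to the solution *)

Section Source.
Context {R : realType}.
Variables (a a1 a2 a11 a22 h k : R -> R -> R).
Hypothesis Ha : even_C2 a a1 a2 a11 a22.
Hypothesis ch : forall r z : R, 0 < r -> cont2 h r z.
Hypothesis ck : forall r z : R, 0 < r -> cont2 k r z.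
Hypothesis dh : forall r z : R, 0 < r -> is_derive z 1 (h r) (k r z).
Variable al : R.
Hypothesis Ei : hp_integrable (fun r z => (a1 r z ^+ 2 + a2 r z ^+ 2) * r `^ al).
Hypothesis hi : hp_integrable (fun r z => h r z ^+ 2 * r `^ al).

Lemma flux_integrable : hp_integrable (fun r z => a2 r z * h r z * r `^ al).
Proof.
apply: hp_integrable_le (hp_integrableD Ei hi) _.
  by move=> r z r0; have ? := ev_c2 Ha r z; have ? := @ch r z r0; c2.
move=> r z r0; have [p0 _ _ _] := powR_shift al r0.
apply: le_trans (cross_bound _ _ (ltW p0)) _.
have := mulr_ge0 (sqr_ge0 (a1 r z)) (ltW p0); lra.
Qed.

Lemma flux_density_integrable : hp_integrable (fun r z => a r z ^+ 2 * r `^ (al - 2)) ->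
  hp_integrable (fun r z => a r z * h r z * r `^ al / r).
Proof.
move=> ai; apply: hp_integrable_le (hp_integrableD ai hi) _.
  move=> r z r0; have rn0 : r != 0 by rewrite gt_eqF.
  by have ? := ev_c Ha r z; have ? := @ch r z r0; c2.
move=> r z r0; have rn0 : r != 0 by rewrite gt_eqF.
have [p0 _ -> _] := powR_shift al r0.
have -> : a r z * h r z * r `^ al / r = a r z / r * h r z * r `^ al by field.
apply: le_trans (cross_bound _ _ (ltW p0)) _.
by have -> : (a r z / r) ^+ 2 * r `^ al = a r z ^+ 2 * (r `^ al / r ^+ 2) by field.
Qed.

(** The divergence of [(0, a h r^al)] integrates to 0. In the application [h] is [F^2], [k] is its
    z-derivative and [a] is [phi], so the right-hand side is the response functional. *)
Lemma flux_identity : hp_integrable (fun r z => a r z * h r z * r `^ al / r) ->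
  hp_integrable (fun r z => k r z * a r z * r `^ al) ->
  hp_integral (fun r z => k r z * a r z * r `^ al) =
  - hp_integral (fun r z => a2 r z * h r z * r `^ al).
Proof.
move=> ai ki; have fi := flux_integrable.
pose S r z := a r z * h r z * r `^ al.
pose S2 r z := k r z * a r z * r `^ al + a2 r z * h r z * r `^ al.
suff : hp_integral (fun r z => 0 + S2 r z) = 0.
  rewrite (@hp_integral_eq _ _ S2); last by move=> r z _; rewrite add0r.
  by rewrite hp_integralD // => /eqP; rewrite addr_eq0 => /eqP.
apply: (@hp_divergence R (fun _ _ => 0) (fun _ _ => 0) S S2).
- by move=> r z _; exact: is_derive_cst.
- move=> r z r0; have d1 := ev_d2 Ha r z; have d2 := @dh r z r0.
  rewrite /S; eapply derE; first by der.
  by rewrite /S2; ring.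
- by move=> r z r0; c2.
- by move=> r z r0; c2.
- by move=> r z r0; have ? := ev_c Ha r z; have ? := @ch r z r0; rewrite /S; c2.
- move=> r z r0; have ? := ev_c Ha r z; have ? := ev_c2 Ha r z; have ? := @ch r z r0.
  by have ? := @ck r z r0; rewrite /S2; c2.
- by apply: hp_integrable_eq (hp_integrableD ki fi) => r z _; rewrite add0r.
- by apply: hp_integrable_eq (hp_integrableZ 0 ai) => r z _; rewrite !mul0r.
- exact: ai.
Qed.

End Source.

(** * The weight r *)

Section WeightOne.
Context {R : realType}.
Notation leb := (@lebesgue_measure R).
Notation leb2 := (leb \x leb)%E.
Notation hp := (@half_plane R).

(** The box reaches the axis, so that the flux through [r = 0] is seen, but the axis itself is
    removed to stay inside the open half-plane required by the exhaustion lemmas. The removed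
    segment is negligible. *)
Definition axis_box (n : nat) : set (measurableTypeR R * measurableTypeR R) :=
  box 0 (side n) (- side n) (side n) `\` ([set 0] `*` `[- side n, side n]%classic).

Lemma axis_boxP n r z : axis_box n (r, z) <-> (0 < r <= side n) /\ (- side n <= z <= side n).
Proof.
split.
  move=> [/boxP[/andP[r0 rN] zN] h]; split => //; rewrite rN andbT lt_neqAle r0 andbT.
  by apply/eqP => r1; apply: h; split; rewrite /= ?in_itv.
move=> [/andP[r0 rN] zN]; split; first by apply/boxP; rewrite (ltW r0).
by move=> [/= r1 _]; rewrite r1 ltxx in r0.
Qed.

Lemma measurable_axis_box n : measurable (axis_box n).
Proof.
apply: measurableD; first exact: measurable_box.
by apply: measurableX; [exact: measurable_set1|exact: measurable_itv].
Qed.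

Lemma axis_box_hp n : axis_box n `<=` hp.
Proof. by move=> -[r z] /axis_boxP[/andP[]]. Qed.

Lemma axis_box_exhaust p : hp p -> \forall n \near \oo, axis_box n p.
Proof.
case: p => r z /= r0; near=> n; apply/axis_boxP; split; apply/andP; split => //.
- by near: n; exact: near_side.
- by rewrite lerNl; near: n; exact: near_side.
- by near: n; exact: near_side.
Unshelve. all: by end_near. Qed.

Lemma axis_box_integral n (f : R -> R -> R) : (forall r z : R, cont2 f r z) ->
  (\int[leb2]_(p in axis_box n) (f p.1 p.2)%:E =
   \int[leb2]_(p in box 0 (side n) (- side n)%R (side n)) (f p.1 p.2)%:E)%E.
Proof.
move=> cf; apply/esym/negligible_integral.
- by apply: measurableX; [exact: measurable_set1|exact: measurable_itv].
- exact: measurable_box.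
- exact: box_integrable.
- rewrite [LHS]product_measure1E; [|exact: measurable_set1|exact: measurable_itv].
  by rewrite /= lebesgue_measure_set1 mul0e.
Qed.

Lemma eps_axis n (r z : R) : 0 < r <= side n -> - side n <= z <= side n ->
  [/\ 0 <= eps n * r ^+ 2 <= 1, 0 <= eps n * r <= 1 & 0 <= eps n * z ^+ 2 <= 1].
Proof.
move=> /andP[r0 rN] /eps_z hz; have s0 := @side_gt0 R n; have e0 := @eps_gt0 R n.
have s1 := @side_gt1 R n; split => //.
  rewrite mulr_ge0 ?(ltW e0) ?sqr_ge0 //= -(@epsE R n) ler_pM2l //.
  by rewrite ler_sqr ?nnegrE ?(ltW r0) ?(ltW s0).
rewrite mulr_ge0 ?(ltW e0) ?(ltW r0) //= -(@epsE R n) ler_pM2l //.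
by apply: le_trans rN _; rewrite expr2 ler_peMl // ?(ltW s0) // ltW.
Qed.

Variables (a a1 a2 a11 a22 k : R -> R -> R).
Hypothesis Ha : even_C2 a a1 a2 a11 a22.
Hypothesis ck : forall r z : R, 0 < r -> cont2 k r z.
Hypothesis Lap : forall r z : R, 0 < r -> a11 r z + 3 / r * a1 r z + a22 r z = - k r z.

(** Unlike [cut], this cutoff does not vanish on the axis, where it equals [1 - e z^2]. For the
    weight [r] the density [a^2 / r] is in general not integrable at the axis, so a cutoff vanishing
    there would be unusable. *)
Definition acut (e r z : R) : R := (1 - e * r ^+ 2) * (1 - e * z ^+ 2).

(** The divergence of [(a a_r r + a^2, a a_z r)]. The added [a^2] turns the coefficient of [a a_r]
    into 3, matching the term [3 / r] of the operator, and it is the whole flux on the axis: this is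
    where the trace originates. *)
Let f r z := (a1 r z ^+ 2 + a r z * a11 r z) * r + 3 * a r z * a1 r z
  + (a2 r z ^+ 2 + a r z * a22 r z) * r.

Let fE r z : 0 < r -> f r z = (a1 r z ^+ 2 + a2 r z ^+ 2) * r - k r z * a r z * r.
Proof.
move=> r0; have rn0 : r != 0 by rewrite gt_eqF.
have L := Lap z r0; rewrite /f.
have -> : a22 r z = - k r z - a11 r z - 3 / r * a1 r z by lra.
by field.
Qed.

Let Err e r z := 2 * acut e r z *
  ((a r z * a1 r z * r + a r z ^+ 2) * (- 2 * e * r * (1 - e * z ^+ 2))
   + a r z * a2 r z * r * (- 2 * e * z * (1 - e * r ^+ 2))).

Let D e r z := f r z * acut e r z ^+ 2 + Err e r z.

Let cD e r z : cont2 (D e) r z.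
Proof.
have ? := ev_c Ha r z; have ? := ev_c1 Ha r z; have ? := ev_c2 Ha r z.
have ? := ev_c11 Ha r z; have ? := ev_c22 Ha r z.
by rewrite /D /Err /f /acut; c2.
Qed.

(** Only the side [r = 0] survives. There the flux is [a(0, z)^2] and the squared cutoff is
    [(1 - e z^2)^2]; the minus sign comes from the lower endpoint. *)
Let D_integral n :
  (\int[leb2]_(p in axis_box n) (D (eps n) p.1 p.2)%:E =
   \int[leb]_(z in `[(- side n)%R, side n]) (- (a 0 z ^+ 2 * (1 - eps n * z ^+ 2) ^+ 2))%:E)%E.
Proof.
rewrite axis_box_integral; last exact: cD.
set e := eps n; have es := @epsE R n; rewrite -/e in es.
have s0 := @side_gt0 R n.
pose X r z := (a r z * a1 r z * r + a r z ^+ 2) * acut e r z ^+ 2.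
pose X1 r z := ((a1 r z ^+ 2 + a r z * a11 r z) * r + 3 * a r z * a1 r z) * acut e r z ^+ 2
  + 2 * acut e r z * ((a r z * a1 r z * r + a r z ^+ 2) * (- 2 * e * r * (1 - e * z ^+ 2))).
pose Y r z := a r z * a2 r z * r * acut e r z ^+ 2.
pose Y2 r z := (a2 r z ^+ 2 + a r z * a22 r z) * r * acut e r z ^+ 2 +
  2 * acut e r z * (a r z * a2 r z * r * (- 2 * e * z * (1 - e * r ^+ 2))).
have cX1 r z : cont2 X1 r z.
  have ? := ev_c Ha r z; have ? := ev_c1 Ha r z; have ? := ev_c11 Ha r z.
  by rewrite /X1 /acut; c2.
have cY2 r z : cont2 Y2 r z.
  have ? := ev_c Ha r z; have ? := ev_c2 Ha r z; have ? := ev_c22 Ha r z.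
  by rewrite /Y2 /acut; c2.
have -> : (fun p : R * R => (D e p.1 p.2)%:E) =
    (fun p => (X1 p.1 p.2)%:E + (Y2 p.1 p.2)%:E)%E.
  apply/funext => -[r z] /=; rewrite -EFinD; congr (_%:E).
  by rewrite /D /f /Err /X1 /Y2; ring.
rewrite integralD; last 3 first.
- exact: measurable_box.
- exact: box_integrable.
- exact: box_integrable.
have -> : (\int[leb2]_(p in box 0 (side n) (- side n)%R (side n)) (X1 p.1 p.2)%:E =
    \int[leb]_(z in `[(- side n)%R, side n]) (X (side n) z - X 0 z)%:E)%E.
  apply: box_dr => // r z _ _.
  have ? := ev_d1 Ha r z; have ? := ev_d11 Ha r z.
  rewrite /X /acut; eapply derE; first by der.
  by rewrite /X1 /acut /=; ring.
have -> : (\int[leb2]_(p in box 0 (side n) (- side n)%R (side n)) (Y2 p.1 p.2)%:E =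
    \int[leb]_(r in `[0%R, side n]) (Y r (side n) - Y r (- side n)%R)%:E)%E.
  apply: box_dz => //; first by rewrite gtrN.
  move=> r z _ _; have ? := ev_d2 Ha r z; have ? := ev_d22 Ha r z.
  rewrite /Y /acut; eapply derE; first by der.
  by rewrite /Y2 /acut /=; ring.
rewrite [X in (_ + X)%E]integral0_eq ?adde0 => [|x _].
  apply: eq_integral => z _; congr (_%:E).
  by rewrite /X /acut es subrr mul0r !expr0n /=; ring.
by rewrite /Y /acut sqrrN es subrr !mulr0 !expr0n /=; congr (_%:E); ring.
Qed.

Hypothesis ai : hp_integrable (fun r z => a r z ^+ 2).
Hypothesis ki : hp_integrable (fun r z => k r z ^+ 2 * r ^+ 2).

(** The derivatives of the cutoff come with a spare factor [r], which is affordable because [side n]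
    exceeds 1: [(e r)^2 r = (e r^2)(e r)] and [(e z)^2 r = (e z^2)(e r)] are products of quantities
    at most 1. *)
Let acut_bounds n r z : axis_box n (r, z) ->
  [/\ 0 <= acut (eps n) r z <= 1, 0 < r,
   (eps n * r * (1 - eps n * z ^+ 2)) ^+ 2 * r <= 1,
   0 <= eps n * r * (1 - eps n * z ^+ 2) <= 1
   & (eps n * z * (1 - eps n * r ^+ 2)) ^+ 2 * r <= 1].
Proof.
move=> /axis_boxP[hr hz].
have [/andP[u0 u1] /andP[v0 v1] /andP[w0 w1]] := eps_axis hr hz.
have /andP[r0 _] := hr; have e0 := @eps_gt0 R n; rewrite /acut.
set e := eps n in u0 u1 v0 v1 w0 w1 e0 *.
have sq1 (x : R) : 0 <= x <= 1 -> 0 <= (1 - x) ^+ 2 <= 1.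
  by move=> /andP[x0 x1]; rewrite sqr_ge0 expr_le1 //; lra.
have ez1 : 0 <= 1 - e * z ^+ 2 <= 1 by lra.
have er1 : 0 <= 1 - e * r ^+ 2 <= 1 by lra.
have /andP[a0 a1'] := ez1; have /andP[b0 b1] := er1.
split => //.
- by apply/andP; split; [exact: mulr_ge0|exact: mulr_ile1].
- have -> : (e * r * (1 - e * z ^+ 2)) ^+ 2 * r = (e * r ^+ 2) * (e * r) * (1 - e * z ^+ 2) ^+ 2 by ring.
  have /andP[q0 q1] := sq1 (e * z ^+ 2) ltac:(lra).
  by apply: mulr_ile1 => //; [exact: mulr_ge0|exact: mulr_ile1].
- by apply/andP; split; [exact: mulr_ge0|exact: mulr_ile1].
- have -> : (e * z * (1 - e * r ^+ 2)) ^+ 2 * r = (e * z ^+ 2) * (e * r) * (1 - e * r ^+ 2) ^+ 2 by ring.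
  have /andP[q0 q1] := sq1 (e * r ^+ 2) ltac:(lra).
  by apply: mulr_ile1 => //; [exact: mulr_ge0|exact: mulr_ile1].
Qed.

(** Each of the two gradient terms is split by Young's inequality into a quarter of its energy and
    [16 a^2]; the [a^2] component of the flux costs [4 a^2] more, whence 36. *)
Let Err_bound n r z : axis_box n (r, z) ->
  `|Err (eps n) r z| <= 36 * a r z ^+ 2
    + (a1 r z ^+ 2 + a2 r z ^+ 2) * r * acut (eps n) r z ^+ 2 / 4.
Proof.
move=> /acut_bounds[c01 r0 h1 h2 h3]; rewrite /Err.
move: (acut _ _ _) c01 => c /andP[c0 c1].
move: (a r z) (a1 r z) (a2 r z) => x y w.
have -> : 2 * c * ((x * y * r + x ^+ 2) * (- 2 * eps n * r * (1 - eps n * z ^+ 2)) +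
    x * w * r * (- 2 * eps n * z * (1 - eps n * r ^+ 2))) =
  - (4 * (c * y) * (x * (eps n * r * (1 - eps n * z ^+ 2))) * r)
  - (4 * (c * w) * (x * (eps n * z * (1 - eps n * r ^+ 2))) * r)
  - 4 * c * (x ^+ 2 * (eps n * r * (1 - eps n * z ^+ 2))) by ring.
move: h1 h2 h3; set s := eps n * r * _; set t := eps n * z * _.
move=> h1 /andP[s0 s1] h3.
have key (v b : R) : b ^+ 2 * r <= 1 ->
    `|4 * (c * v) * (x * b) * r| <= v ^+ 2 * r * c ^+ 2 / 4 + 16 * x ^+ 2.
  move=> b1; rewrite normrM (ger0_norm (ltW r0)).
  have : `|4 * (c * v) * (x * b)| <= (c * v) ^+ 2 / 4 + 16 * (x * b) ^+ 2.
    rewrite ler_norml; have := sqr_ge0 (c * v / 2 + 4 * (x * b));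
    have := sqr_ge0 (c * v / 2 - 4 * (x * b)); lra.
  move=> /(ler_wpM2r (ltW r0)) h; apply: (le_trans h).
  have : x ^+ 2 * (b ^+ 2 * r) <= x ^+ 2 by rewrite ler_piMr ?sqr_ge0.
  lra.
have k1 := key y s h1; have k2 := key w t h3.
have k3 : `|4 * c * (x ^+ 2 * s)| <= 4 * x ^+ 2.
  have -> : 4 * c * (x ^+ 2 * s) = 4 * (x ^+ 2 * (c * s)) by ring.
  have cs0 : 0 <= c * s by exact: mulr_ge0.
  have cs1 : c * s <= 1 by exact: mulr_ile1.
  have q0 : 0 <= x ^+ 2 * (c * s) by rewrite mulr_ge0 ?sqr_ge0.
  have q1 : x ^+ 2 * (c * s) <= x ^+ 2 by rewrite ler_piMr ?sqr_ge0.
  by rewrite ger0_norm; lra.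
apply: le_trans (ler_normB _ _) _; apply: le_trans (lerD (ler_normB _ _) (lexx _)) _.
rewrite normrN; lra.
Qed.

Lemma kar_bound r z : 0 < r -> `|k r z * a r z * r| <= a r z ^+ 2 + k r z ^+ 2 * r ^+ 2.
Proof.
move=> r0; have -> : k r z * a r z * r = a r z * (k r z * r) * 1 by ring.
by apply: le_trans (cross_bound _ _ ler01) _; rewrite !mulr1 exprMn.
Qed.

Lemma axis_source_integrable : hp_integrable (fun r z => k r z * a r z * r).
Proof.
apply: hp_integrable_le (hp_integrableD ai ki) _.
  by move=> r z r0; have ? := ev_c Ha r z; have ? := @ck r z r0; c2.
by move=> r z; exact: kar_bound.
Qed.

Lemma axis_energy_integrable : hp_integrable (fun r z => (a1 r z ^+ 2 + a2 r z ^+ 2) * r).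
Proof.
suff : hp_integrable (fun r z => 2^-1 * ((a1 r z ^+ 2 + a2 r z ^+ 2) * r)).
  move=> /(hp_integrableZ 2); apply: hp_integrable_eq => r z _; lra.
pose fn n r z := 2^-1 * ((a1 r z ^+ 2 + a2 r z ^+ 2) * r) * acut (eps n) r z ^+ 2.
have cfn n r z : cont2 (fn n) r z.
  by have ? := ev_c1 Ha r z; have ? := ev_c2 Ha r z; rewrite /fn /acut; c2.
pose H r z := 36 * a r z ^+ 2 + (a r z ^+ 2 + k r z ^+ 2 * r ^+ 2).
have Hi : hp_integrable H by apply: hp_integrableD; [exact: hp_integrableZ|exact: hp_integrableD].
have mh := measurable_half_plane (R := R).
apply: (@exhaust_fatou R fn _ axis_box _ axis_box_hp axis_box_exhaust _ _ (hp_integral H)).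
- exact: measurable_axis_box.
- by move=> n [r z] _; exact: cfn.
- move=> r z r0; pose h (e : R) := 2^-1 * ((a1 r z ^+ 2 + a2 r z ^+ 2) * r) * acut e r z ^+ 2.
  have -> : 2^-1 * ((a1 r z ^+ 2 + a2 r z ^+ 2) * r) = h 0 by rewrite /h /acut; ring.
  apply: (@cvg_comp _ _ _ _ h _ (nbhs (0 : R))); first exact: eps_cvg.
  have : exists b, is_derive (0 : R) 1 h b by eexists; rewrite /h /acut; der.
  by move=> [b /der_cont]; exact.
- move=> n [r z] /axis_box_hp r0 /=; apply: mulr_ge0; last exact: sqr_ge0.
  by rewrite mulr_ge0 // mulr_ge0 ?addr_ge0 ?sqr_ge0 // ltW.
move=> n; have mb := measurable_axis_box n.
have inb (F : R -> R -> R) : (forall r z : R, cont2 F r z) ->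
    leb2.-integrable (axis_box n) (fun p => (F p.1 p.2)%:E).
  move=> cF; apply: (integrableS (measurable_box 0 (side n) (- side n) (side n)) mb).
    exact: subDsetl.
  exact: box_integrable.
have iH : leb2.-integrable (axis_box n) (fun p => (H p.1 p.2)%:E).
  exact: (integrableS mh mb (@axis_box_hp n) Hi).
have iD : leb2.-integrable (axis_box n) (fun p => (D (eps n) p.1 p.2)%:E).
  by apply: inb.
apply: (@le_trans _ _ (\int[leb2]_(p in axis_box n)
    ((D (eps n) p.1 p.2)%:E + (H p.1 p.2)%:E))%E).
  apply: le_integral => //; [exact: inb|exact: integrableD|].
  move=> [r z] /set_mem hb; rewrite -EFinD lee_fin /=.
  have r0 := axis_box_hp hb.
  have [/andP[c0 c1] _ _ _ _] := acut_bounds hb.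
  have := Err_bound hb; have := kar_bound z r0.
  rewrite /fn /D fE // /H => kb eb.
  have kc : - (a r z ^+ 2 + k r z ^+ 2 * r ^+ 2) <= - (k r z * a r z * r * acut (eps n) r z ^+ 2).
    rewrite lerN2; apply: le_trans (ler_norm _) _; rewrite normrM.
    apply: le_trans kb; rewrite ler_piMr // ger0_norm ?sqr_ge0 // expr_le1 //.
  have : 0 <= (a1 r z ^+ 2 + a2 r z ^+ 2) * r * acut (eps n) r z ^+ 2.
    by apply: mulr_ge0; [rewrite mulr_ge0 ?addr_ge0 ?sqr_ge0 // ltW|exact: sqr_ge0].
  by move: eb; rewrite ler_norml => /andP[eb _]; lra.
rewrite integralD //= D_integral.
rewrite -[leRHS]add0e; apply: leeD.
  under eq_integral do rewrite EFinN.
  rewrite integral_ge0N ?oppe_le0 => [|z _]; last by rewrite lee_fin mulr_ge0 ?sqr_ge0.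
  by apply: integral_ge0 => z _; rewrite lee_fin mulr_ge0 ?sqr_ge0.
rewrite -hp_integralE //; apply: ge0_subset_integral => //.
- exact: (measurable_int _ Hi).
- move=> [r z] /= r0; rewrite lee_fin /H.
  by have := sqr_ge0 (a r z); have := sqr_ge0 (k r z * r); rewrite exprMn; lra.
- exact: axis_box_hp.
Qed.

Hypothesis ti : leb.-integrable setT (fun z => (a 0 z ^+ 2)%:E).

Lemma axis_energy_identity :
  hp_integral (fun r z => k r z * a r z * r) =
  hp_integral (fun r z => (a1 r z ^+ 2 + a2 r z ^+ 2) * r)
  + \int[leb]_(z in setT) (a 0 z ^+ 2).
Proof.
have Ei := axis_energy_integrable; have si := axis_source_integrable.
pose g r z := 37 * ((a1 r z ^+ 2 + a2 r z ^+ 2) * r) + (37 * a r z ^+ 2 + `|k r z * a r z * r|).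
have gi : hp_integrable g.
  by do ! apply: hp_integrableD; do ? apply: hp_integrableZ => //; exact: hp_integrable_norm.
have g0 r z : 0 < r -> 0 <= g r z.
  move=> r0; rewrite /g; have : 0 <= (a1 r z ^+ 2 + a2 r z ^+ 2) * r.
    by rewrite mulr_ge0 ?addr_ge0 ?sqr_ge0 // ltW.
  by have := sqr_ge0 (a r z); have := normr_ge0 (k r z * a r z * r); lra.
have D_cvg r z : 0 < r -> D (eps n) r z @[n --> \oo] --> f r z.
  move=> r0; pose h (e : R) := D e r z.
  have -> : f r z = h 0 by rewrite /h /D /Err /acut; move: (f r z) => F; ring.
  apply: (@cvg_comp _ _ _ _ h _ (nbhs (0 : R))); first exact: eps_cvg.
  have : exists b, is_derive (0 : R) 1 h b by eexists; rewrite /h /D /Err /acut; der.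
  by move=> [b /der_cont]; exact.
have [||||fi h] := @exhaust_dominated R (fun n => D (eps n)) f axis_box
  _ axis_box_hp axis_box_exhaust _ D_cvg g gi.
- exact: measurable_axis_box.
- by move=> n [r z] _; exact: cD.
- move=> n [r z] hb /=; have r0 := axis_box_hp hb.
  have [/andP[c0 c1] _ _ _ _] := acut_bounds hb.
  have := Err_bound hb; rewrite /D fE // /g => eb.
  have q1 : acut (eps n) r z ^+ 2 <= 1 by rewrite expr_le1.
  have E0 : 0 <= (a1 r z ^+ 2 + a2 r z ^+ 2) * r.
    by rewrite mulr_ge0 ?addr_ge0 ?sqr_ge0 // ltW.
  have eb2 : (a1 r z ^+ 2 + a2 r z ^+ 2) * r * acut (eps n) r z ^+ 2 <=
      (a1 r z ^+ 2 + a2 r z ^+ 2) * r by rewrite ler_piMr.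
  have : `|((a1 r z ^+ 2 + a2 r z ^+ 2) * r - k r z * a r z * r) * acut (eps n) r z ^+ 2| <=
      (a1 r z ^+ 2 + a2 r z ^+ 2) * r + `|k r z * a r z * r|.
    rewrite normrM (ger0_norm (sqr_ge0 (acut _ _ _))).
    apply: (@le_trans _ _ `|(a1 r z ^+ 2 + a2 r z ^+ 2) * r - k r z * a r z * r|).
      by rewrite ler_piMr.
    by apply: le_trans (ler_normB _ _) _; rewrite (ger0_norm E0).
  have := ler_normD (((a1 r z ^+ 2 + a2 r z ^+ 2) * r - k r z * a r z * r) *
    acut (eps n) r z ^+ 2) (Err (eps n) r z).
  by have := sqr_ge0 (a r z); lra.
- by move=> r z; exact: g0.
(* The limit is identified a second time from the boundary side: by [D_integral] the same sequence
   consists of line integrals, which converge to minus the trace by dominated convergence. *)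
have : hp_integral f = - \int[leb]_(z in setT) (a 0 z ^+ 2).
  move: h; under eq_fun do rewrite D_integral.
  pose tn n : measurableTypeR R -> \bar R :=
    (fun z : measurableTypeR R => (- (a 0 z ^+ 2 * (1 - eps n * z ^+ 2) ^+ 2))%:E)
    \_ (`[- side n, side n]%classic : set (measurableTypeR R)).
  have mt (F : R -> R) : (forall z : R, {for z, continuous F}) ->
      measurable_fun [set: measurableTypeR R] F.
    by move=> cF; apply: continuous_measurable_fun => z; exact: cF.
  have c0z (z : R) : {for z, continuous (a 0)} by apply: c2_slicez; exact: ev_c Ha 0 z.
  have mtn n : measurable_fun [set: measurableTypeR R] (tn n).
    apply/(measurable_restrictT _ (measurable_itv _)); apply/measurable_EFinP.
    apply: measurable_funTS; apply: mt => z.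
    have := ev_d2 Ha 0 z => d0.
    have : exists b, is_derive z 1 (fun z => - (a 0 z ^+ 2 * (1 - eps n * z ^+ 2) ^+ 2)) b.
      by eexists; der.
    by move=> [b /der_cont].
  have tn_cvg z : [set: measurableTypeR R] z -> tn n z @[n --> \oo] --> (- (a 0 z ^+ 2))%:E.
    move=> _; have hh : (- (a 0 z ^+ 2 * (1 - eps n * z ^+ 2) ^+ 2))%:E @[n --> \oo] --> (- (a 0 z ^+ 2))%:E.
      apply: cvg_EFin; first exact: nearW.
      pose q (e : R) := - (a 0 z ^+ 2 * (1 - e * z ^+ 2) ^+ 2).
      have -> : - (a 0 z ^+ 2) = q 0 by rewrite /q; ring.
      apply: (@cvg_comp _ _ _ _ q _ (nbhs (0 : R))); first exact: eps_cvg.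
      have : exists b, is_derive (0 : R) 1 q b by eexists; rewrite /q; der.
      by move=> [b /der_cont]; exact.
    apply: cvg_trans hh; apply: near_eq_cvg; near=> n; rewrite /tn patchE ifT //.
    apply/mem_set; rewrite /= in_itv /=; apply/andP; split.
      by rewrite lerNl; near: n; exact: near_side.
    by near: n; exact: near_side.
  have tn_le z n : [set: measurableTypeR R] z -> (`|tn n z| <= (a 0 z ^+ 2)%:E)%E.
    move=> _; rewrite /tn patchE; case: ifPn => [/set_mem /=|_]; last by rewrite /= lee_fin normr0 sqr_ge0.
    rewrite in_itv /= => /eps_z /andP[w0 w1].
    have q1 : (1 - eps n * z ^+ 2) ^+ 2 <= 1 by rewrite expr_le1 //; lra.
    have p0 : 0 <= a 0 z ^+ 2 * (1 - eps n * z ^+ 2) ^+ 2 by rewrite mulr_ge0 ?sqr_ge0.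
    have p1 : a 0 z ^+ 2 * (1 - eps n * z ^+ 2) ^+ 2 <= a 0 z ^+ 2 by rewrite ler_piMr ?sqr_ge0.
    by rewrite lee_fin normrN ger0_norm.
  have mlim : measurable_fun [set: measurableTypeR R] (fun z : measurableTypeR R => (- (a 0 z ^+ 2))%:E).
    by apply: (emeasurable_fun_cvg tn).
  have [_ _ ] := dominated_convergence measurableT mtn mlim (aeW _ tn_cvg) ti (aeW _ tn_le).
  move=> h2 h1.
  have {}h1 : (\int[leb]_(z in setT) tn n z @[n --> \oo] --> (hp_integral f)%:E)%E.
    apply: cvg_trans h1; apply: near_eq_cvg; near=> n.
    by rewrite /tn -integral_mkcond.
  have := cvg_unique (@ereal_hausdorff R) h1 h2.
  have -> : (\int[leb]_(z in setT) (- (a 0 z ^+ 2))%:E = (- (\int[leb]_(z in setT) (a 0 z ^+ 2))%R)%:E)%E.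
    under eq_integral do rewrite EFinN.
    rewrite integral_ge0N; last by move=> z _; rewrite lee_fin sqr_ge0.
    by rewrite EFinN /Rintegral fineK // integrable_fin_num.
  by move=> /(_ _) h3; apply: EFin_inj; apply: h3.
have fE' r z : 0 < r -> f r z = (a1 r z ^+ 2 + a2 r z ^+ 2) * r + (-1) * (k r z * a r z * r).
  by move=> r0; rewrite fE //; ring.
rewrite (hp_integral_eq fE') hp_integralD ?hp_integralZ //; last exact: hp_integrableZ.
by move=> /eqP; rewrite mulN1r subr_eq => /eqP ->; rewrite addrAC addNr add0r.
Unshelve. all: by end_near. Qed.

End WeightOne.

(** * Maximum principle and barriers *)

Section MaximumPrinciple.
Context {R : realType}.

Lemma is_derive_slope (f : R -> R) (c d : R) : is_derive c 1 f d ->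
  exists g : R -> R, [/\ forall x, f x - f c = g x * (x - c), {for c, continuous g} & g c = d].
Proof. by move=> /is_derive1_caratheodory. Qed.

(** If [d] were positive, the factorisation [f1 x = g x * (x - c)] with [g c = d] would make [f1]
    positive just to the right of [c], and the mean value theorem would give a value above [f c]. *)
Lemma second_derivative_test (f f1 : R -> R) (c d e : R) : 0 < e ->
  (forall x : R, is_derive x 1 f (f1 x)) -> is_derive c 1 f1 d ->
  (forall x, `|x - c| < e -> f x <= f c) -> f1 c = 0 /\ d <= 0.
Proof.
move=> e0 df df1 fmax.
have f1c : f1 c = 0.
  have [] : is_derive c 1 f 0.
    apply: (@derive1_at_max _ f (c - e) (c + e)); first lra.
    - by move=> t _; have [] := df t.
    - by rewrite in_itv /=; apply/andP; split; lra.
    - move=> t; rewrite in_itv /= => /andP[t1 t2]; apply: fmax.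
      by rewrite ltr_norml; apply/andP; split; lra.
  by have [_ ->] := df c.
split => //; rewrite leNgt; apply/negP => d0.
have [g [g1 gc gcd]] := is_derive_slope df1.
have : \forall x \near c, 0 < g x by apply: cvgr_gt gc _ _; rewrite gcd.
move=> /nbhs_ballP[h /= h0 hg].
pose x := c + Num.min e h / 2.
have m0 : 0 < Num.min e h by rewrite lt_min e0 h0.
have me : Num.min e h <= e by rewrite ge_min lexx.
have mh : Num.min e h <= h by rewrite ge_min lexx orbT.
have cx : c < x by rewrite /x; lra.
have [y yI fy] : exists2 y, y \in `]c, x[ & f x - f c = f1 y * (x - c).
  apply: (MVT cx).
  by apply: continuous_in_subspaceT => y _; exact: der_cont (df y).
move: yI; rewrite in_itv /= => /andP[cy yx].
have gy : 0 < g y by apply: hg; rewrite /ball /= ltr_norml; apply/andP; split; rewrite /x in yx; lra.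
have fyE : f1 y = g y * (y - c) by rewrite -g1 f1c subr0.
have : f x <= f c by apply: fmax; rewrite ltr_norml; apply/andP; split; rewrite /x; lra.
apply/negP; rewrite -ltNge -subr_gt0 fy fyE.
by rewrite !mulr_gt0 ?subr_gt0.
Qed.

Section Even.
Variables (a a1 a2 a11 a22 : R -> R -> R).
Hypothesis Ha : even_C2 a a1 a2 a11 a22.

Lemma even_d1_odd r z : a1 (- r) z = - a1 r z.
Proof.
have h : is_derive r 1 (a ^~ z) (a1 (- r) z * (-1)).
  have -> : (a ^~ z) = (fun s => a (- s) z) by apply/funext => s; rewrite -(ev_even Ha).
  exact: (der_comp (f := a ^~ z) (ev_d1 Ha (- r) z) (derN (der_id r))).
have [_ <-] := ev_d1 Ha r z; have [_ ->] := h; lra.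
Qed.

Lemma even_d1_axis z : a1 0 z = 0.
Proof. by have := even_d1_odd 0 z; rewrite oppr0; lra. Qed.

Lemma even_norm r z : a `|r| z = a r z.
Proof. by case: (ger0P r) => // _; rewrite (ev_even Ha). Qed.

(** The limit of the equation as [r] tends to 0 from the right: [a1] vanishes on the axis by
    evenness, so [a1 / r] tends to [a11] and the singular term becomes [3 a11]. *)
Lemma axis_equation (k : R -> R -> R) z : cont2 k 0 z ->
  (forall r : R, 0 < r -> a11 r z + 3 / r * a1 r z + a22 r z = - k r z) ->
  4 * a11 0 z + a22 0 z = - k 0 z.
Proof.
move=> ck Lap; have [g [g1 gc g0]] := is_derive_slope (ev_d11 Ha 0 z).
pose h r := a11 r z + 3 * g r + a22 r z + k r z.
have hc : {for 0, continuous h}.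
  apply: cvgD; last exact: c2_slicer ck.
  apply: cvgD; last exact: c2_slicer (ev_c22 Ha 0 z).
  apply: cvgD; first exact: c2_slicer (ev_c11 Ha 0 z).
  by apply: cvgM; [exact: cvg_cst|exact: gc].
suff : h 0 = 0 by rewrite /h g0; lra.
have h0 r : 0 < r -> h r = 0.
  move=> r0; have := g1 r; rewrite even_d1_axis !subr0 => e.
  have rn0 : r != 0 by rewrite gt_eqF.
  have := Lap r r0; rewrite e; have -> : 3 / r * (g r * r) = 3 * g r by field.
  by rewrite /h; lra.
have hr : h x @[x --> 0^'+] --> h 0 by apply: cvg_at_right_filter; exact: hc.
have h1 : h x @[x --> 0^'+] --> (0 : R).
  apply: cvg_near_cst; near=> x; apply: h0; near: x; exact: nbhs_right_gt.
exact: (cvg_unique _ hr h1).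
Unshelve. all: by end_near. Qed.

End Even.

(* [b] selects the region: the upper quarter [0 <= z], or the whole plane. *)
Lemma max_principle (b : bool) (v v1 v2 v11 v22 : R -> R -> R) (M : R) :
  even_C2 v v1 v2 v11 v22 ->
  (forall r z : R, (b -> 0 <= z) -> M <= r ^+ 2 + z ^+ 2 -> v r z <= 0) ->
  (b -> forall r : R, v r 0 <= 0) ->
  (forall r z : R, (b -> 0 < z) -> 0 < r -> 0 < v11 r z + 3 / r * v1 r z + v22 r z) ->
  (forall z : R, (b -> 0 < z) -> 0 < 4 * v11 0 z + v22 0 z) ->
  forall r z : R, (b -> 0 <= z) -> v r z <= 0.
Proof.
move=> Hv out bdry int axis r0 z0 bz0; rewrite leNgt; apply/negP => v0.
pose m := Num.max M 1.
have m1 : 1 <= m by rewrite le_max lexx orbT.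
have mM : M <= m by rewrite le_max lexx.
have msq x : m <= `|x| -> M <= x ^+ 2.
  move=> h; rewrite -(real_normK (num_real x)); nra.
have small r z : (b -> 0 <= z) -> 0 < v r z -> `|r| < m /\ `|z| < m.
  move=> bz vp; split; rewrite ltNge; apply/negP => /msq h;
    have : v r z <= 0 by (apply: out => //; have := sqr_ge0 r; have := sqr_ge0 z; lra).
    lra.
  lra.
pose c := if b then 0 else - m.
pose A : set (R * R) := `[- m, m]%classic `*` `[c, m]%classic.
have inA r z : A (r, z) <-> (- m <= r <= m) /\ (c <= z <= m).
  by rewrite /A /= !in_itv.
have cb z : c <= z -> b -> 0 <= z by rewrite /c; case: (b).
have Ain r z : (b -> 0 <= z) -> 0 < v r z -> A (r, z).
  move=> bz /(small r z bz)[]; rewrite !ltr_norml => /andP[h1 h2] /andP[h3 h4].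
  apply/inA; rewrite (ltW h1) (ltW h2) (ltW h4) !andbT; split => //; rewrite /c.
  by case: (boolP b) => [bt|_]; [exact: (bz bt)|exact: ltW].
have [[r1 z1] /set_mem /inA [/andP[r1a r1b] /andP[z1a z1b]] vmax] :
    exists2 p, p \in A & forall t, t \in A -> v t.1 t.2 <= v p.1 p.2.
  apply: compact_EVT_max.
  - by exists (r0, z0); exact: Ain.
  - by apply: compact_setX; exact: segment_compact.
  - by apply: continuous_in_subspaceT => -[r z] _; exact: ev_c Hv r z.
have v1p : 0 < v r1 z1.
  by apply: (lt_le_trans v0 (vmax (r0, z0) _)); exact: (mem_set (Ain _ _ bz0 v0)).
have bz1 : b -> 0 <= z1 by exact: cb.
have [r1m z1m] := small _ _ bz1 v1p.
have cz1 : c < z1.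
  rewrite lt_neqAle z1a andbT; apply/eqP => e; move: e; rewrite /c.
  case: (boolP b) => [bt e|_ e]; last by move: z1m; rewrite -e normrN ger0_norm ?ltxx //; lra.
  by move: (bdry bt r1) v1p; rewrite -e; lra.
have b0z1 : b -> 0 < z1 by move: cz1; rewrite /c; case: (b).
(* Evenness moves the positive maximum to a point with [0 <= rho], where the differential inequality
   is available. The point is interior to [A], as [v] is nonpositive far out and, on the quarter,
   along [z = 0]. So first derivatives vanish and second ones are nonpositive, against the strict
   inequality. *)
pose rho := `|r1|.
have vr : v rho z1 = v r1 z1 by rewrite /rho (even_norm Hv).
have glob r z : A (r, z) -> v r z <= v rho z1.
  by move=> h; rewrite vr; apply: (vmax (r, z)); apply/mem_set.
have rho_m : rho < m by [].
have rho0 : 0 <= rho by exact: normr_ge0.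
have zm : z1 < m by exact: le_lt_trans (ler_norm _) z1m.
have [e1 d11] : v1 rho z1 = 0 /\ v11 rho z1 <= 0.
  apply: (second_derivative_test (f := v ^~ z1) (e := m - rho) _
    (fun x => ev_d1 Hv x z1) (ev_d11 Hv rho z1)); first lra.
  - move=> x; rewrite ltr_norml => /andP[h1 h2]; apply: glob; apply/inA.
    by split; apply/andP; split; lra.
have [e2 d22] : v2 rho z1 = 0 /\ v22 rho z1 <= 0.
  apply: (second_derivative_test (e := Num.min (m - z1) (z1 - c)) _
    (ev_d2 Hv rho) (ev_d22 Hv rho z1)).
  - by rewrite lt_min !subr_gt0 zm cz1.
  - move=> x; rewrite lt_min !ltr_norml => /andP[/andP[h1 h2] /andP[h3 h4]].
    by apply: glob; apply/inA; split; apply/andP; split; lra.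
have [rho_gt0|] := ltP 0 rho.
  by have := int rho z1 b0z1 rho_gt0; rewrite e1 mulr0; lra.
move=> rho_le0; have rho_eq : rho = 0 by lra.
by have := axis z1 b0z1; rewrite -rho_eq; lra.
Qed.

End MaximumPrinciple.

Section EvenOps.
Context {R : realType}.

Lemma even_C2_lin (c : R) (a a1 a2 a11 a22 b b1 b2 b11 b22 : R -> R -> R) :
  even_C2 a a1 a2 a11 a22 -> even_C2 b b1 b2 b11 b22 ->
  even_C2 (fun r z => a r z + c * b r z) (fun r z => a1 r z + c * b1 r z)
    (fun r z => a2 r z + c * b2 r z) (fun r z => a11 r z + c * b11 r z)
    (fun r z => a22 r z + c * b22 r z).
Proof.
move=> Ha Hb; split.
1-4: move=> r z; have h1 := ev_d1 Ha r z; have h2 := ev_d1 Hb r z;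
  have h3 := ev_d2 Ha r z; have h4 := ev_d2 Hb r z;
  have h5 := ev_d11 Ha r z; have h6 := ev_d11 Hb r z;
  have h7 := ev_d22 Ha r z; have h8 := ev_d22 Hb r z;
  by eapply derE; [der|ring].
1-5: move=> r z; have h1 := ev_c Ha r z; have h2 := ev_c Hb r z;
  have h3 := ev_c1 Ha r z; have h4 := ev_c1 Hb r z;
  have h5 := ev_c2 Ha r z; have h6 := ev_c2 Hb r z;
  have h7 := ev_c11 Ha r z; have h8 := ev_c11 Hb r z;
  have h9 := ev_c22 Ha r z; have h10 := ev_c22 Hb r z; by c2.
by move=> r z; rewrite (ev_even Ha) (ev_even Hb).
Qed.

Lemma even_C2_refl (a a1 a2 a11 a22 : R -> R -> R) : even_C2 a a1 a2 a11 a22 ->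
  even_C2 (fun r z => a r (- z)) (fun r z => a1 r (- z)) (fun r z => - a2 r (- z))
    (fun r z => a11 r (- z)) (fun r z => a22 r (- z)).
Proof.
have c2r (f : R -> R -> R) (r z : R) : cont2 f r (- z) -> cont2 (fun r z => f r (- z)) r z.
  by move=> cf; apply: (c2_comp (f := f) (g := fun s _ => s) (h := fun _ t => - t)) => //; c2.
have drN (f : R -> R) (z d : R) : is_derive (- z) 1 f d ->
    is_derive z 1 (fun t => f (- t)) (- d).
  move=> h; apply: (derE (der_comp h (derN (der_id z)))); ring.
move=> Ha; split.
- by move=> r z; exact: (ev_d1 Ha r (- z)).
- by move=> r z; exact: (ev_d11 Ha r (- z)).
- by move=> r z; apply: drN; exact: (ev_d2 Ha r (- z)).
- move=> r z; rewrite -[a22 r (- z)]opprK; apply: derN; apply: drN; exact: (ev_d22 Ha r (- z)).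
- by move=> r z; apply: c2r; exact: ev_c Ha r (- z).
- by move=> r z; apply: c2r; exact: ev_c1 Ha r (- z).
- by move=> r z; apply: c2N; apply: c2r; exact: ev_c2 Ha r (- z).
- by move=> r z; apply: c2r; exact: ev_c11 Ha r (- z).
- by move=> r z; apply: c2r; exact: ev_c22 Ha r (- z).
- by move=> r z; rewrite (ev_even Ha).
Qed.

End EvenOps.

Section Barrier.
Context {R : realType}.

(* [J] is 0 or 1: the barrier is [q^(-3/2)] on the whole plane, and
   [z q^(-5/2)] on the upper quarter. *)
Variable j : bool.
Let J : R := j%:R.
Let s : R := 3 / 2 + J.

Definition qf (r z : R) : R := 1 + r ^+ 2 + z ^+ 2.

Lemma qf_ge1 r z : 1 <= qf r z.
Proof. by rewrite /qf; have := sqr_ge0 r; have := sqr_ge0 z; lra. Qed.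

Lemma qf_gt0 r z : 0 < qf r z.
Proof. by have := qf_ge1 r z; lra. Qed.

Definition sigma (z : R) : R := if j then z else 1.

Let sigmaE z : sigma z = (1 - J) + J * z.
Proof. by rewrite /sigma /J; case: j => /=; ring. Qed.

Definition barrier (r z : R) : R := sigma z * qf r z `^ (- s).

Let w (r z : R) : R := qf r z `^ (- s - 1).
Let w2 (r z : R) : R := qf r z `^ (- s - 1 - 1).

(** The factor [sigma z] is written as [(1 - J) + J * z], so that one polynomial expression covers
    both barriers and is accessible to [ring]. *)
Lemma barrier_even_C2 : even_C2 (fun r z => ((1 - J) + J * z) * qf r z `^ (- s))
  (fun r z => ((1 - J) + J * z) * (- 2 * s * r * w r z))
  (fun r z => J * qf r z `^ (- s) + ((1 - J) + J * z) * (- 2 * s * z * w r z))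
  (fun r z => ((1 - J) + J * z) * (- 2 * s * w r z + 4 * s * (s + 1) * r ^+ 2 * w2 r z))
  (fun r z => - 4 * J * s * z * w r z +
    ((1 - J) + J * z) * (- 2 * s * w r z + 4 * s * (s + 1) * z ^+ 2 * w2 r z)).
Proof.
rewrite /w /w2 /qf; split.
1-9: move=> r z; have q0 := qf_gt0 r z; rewrite /qf in q0.
1-4: by eapply derE; [der|rewrite /=; ring].
1-5: by c2.
by move=> r z; rewrite sqrrN.
Qed.

Lemma qf_pow (r z : R) : w r z = w2 r z * qf r z.
Proof.
have q0 := qf_gt0 r z.
have -> : w2 r z * qf r z = w2 r z * qf r z `^ 1 by rewrite powRr1 // ltW.
rewrite /w /w2 -powRD ?(gt_eqF q0) ?implybT //; congr (_ `^ _); ring.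
Qed.

Let JJ : J * J = J. Proof. by rewrite /J; case: j => /=; ring. Qed.
Let J0 : 0 <= J <= 1. Proof. by rewrite /J; case: j => /=; rewrite ?lexx ?ler01. Qed.

(** The exponent is the one for which [z^J |x|^(-2 s)] is harmonic in R^5. After the shift
    [q = 1 + |x|^2], the terms of order [q^(-s - 1)] cancel and a strictly negative multiple of
    [sigma q^(-s - 2)] remains. The parameter [t] stands for the radial derivative of [q^(-s)]
    divided by [r], so the identity also serves on the axis. *)
Let barrier_Delta5 (r z t : R) : t = - 2 * s * w r z ->
  ((1 - J) + J * z) * (- 2 * s * w r z + 4 * s * (s + 1) * r ^+ 2 * w2 r z)
  + 3 * (((1 - J) + J * z) * t)
  + (- 4 * J * s * z * w r z +
    ((1 - J) + J * z) * (- 2 * s * w r z + 4 * s * (s + 1) * z ^+ 2 * w2 r z))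
  = - (4 * s * (s + 1)) * (sigma z * w2 r z).
Proof.
move=> ->; rewrite sigmaE qf_pow.
have -> : - 4 * J * s * z * (w2 r z * qf r z) =
    - 4 * J * s * ((1 - J) + J * z) * (w2 r z * qf r z).
  have -> : - 4 * J * s * ((1 - J) + J * z) * (w2 r z * qf r z) =
    - 4 * s * (J - J * J + J * J * z) * (w2 r z * qf r z) by ring.
  by rewrite JJ; ring.
have -> : J = s - 3 / 2 by rewrite /s; ring.
by rewrite /qf; field.
Qed.

(** The maximum principle is applied to [- a - (K + 1) * barrier - e * (1 + sigma)], with [e]
    adapted to the point and then sent to 0. As [1 + sigma] is affine in [z], hence harmonic, growth
    [o(1 + sigma)] is all that is asked at infinity. Since [4 s (s + 1) >= 15], the factor [K + 1]
    in place of [K] makes the differential inequality strict, even when [K = 0]. *)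
Lemma barrier_comparison (a a1 a2 a11 a22 k : R -> R -> R) (K : R) : 0 <= K ->
  even_C2 a a1 a2 a11 a22 -> (forall r z : R, cont2 k r z) ->
  (forall r z : R, 0 < r -> a11 r z + 3 / r * a1 r z + a22 r z = - k r z) ->
  (forall r z : R, (j -> 0 <= z) -> 0 <= r -> - k r z <= K * (sigma z * qf r z `^ (- s - 1 - 1))) ->
  (forall e : R, 0 < e -> exists M : R, forall r z : R, (j -> 0 <= z) ->
    M <= r ^+ 2 + z ^+ 2 -> - a r z <= e * (1 + sigma z)) ->
  (j -> forall r : R, a r 0 = 0) ->
  forall r z : R, (j -> 0 <= z) -> - a r z <= (K + 1) * barrier r z.
Proof.
move=> K0 Ha ck Lap kK growth bdry r z jz.
have s0 : 3 / 2 <= s by rewrite /s; have /andP[] := J0; lra.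
have sg0 x : (j -> 0 <= x) -> 0 <= sigma x by rewrite /sigma; case: (j) => // ->.
apply/ler_addgt0Pr => e0 e0gt.
have s1 : 0 < 1 + sigma z by have := sg0 z jz; lra.
pose e := e0 / (1 + sigma z).
have egt : 0 < e by rewrite divr_gt0.
have -> : e0 = e * (1 + sigma z) by rewrite /e divfK // gt_eqF.
have [M hM] := growth e egt.
have one_even : even_C2 (fun _ z => 1 + ((1 - J) + J * z)) (fun _ _ => 0) (fun _ _ => J)
    (fun _ _ => 0) (fun _ _ => 0).
  split.
  1-4: by move=> x y; eapply derE; [der|ring].
  1-5: by move=> x y; c2.
  by [].
have zero_even : even_C2 (fun _ _ => 0) (fun _ _ => 0) (fun _ _ => 0)
    (fun _ _ => 0) (fun _ _ => 0 : R).
  split.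
  1-4: by move=> x y; eapply derE; [der|ring].
  1-5: by move=> x y; c2.
  by [].
have Hv := even_C2_lin (-1) (even_C2_lin (- (K + 1))
  (even_C2_lin (- e) zero_even one_even) barrier_even_C2) Ha.
suff : 0 + - e * (1 + ((1 - J) + J * z)) +
    - (K + 1) * (((1 - J) + J * z) * qf r z `^ (- s)) + -1 * a r z <= 0.
  by rewrite /barrier sigmaE; lra.
have spos x : (j -> 0 < x) -> 0 < sigma x by rewrite /sigma; case: (j) => // ->.
have main x y t : (j -> 0 < y) -> 0 <= x -> - k x y = t ->
  0 < - (K + 1) * (- (4 * s * (s + 1)) * (sigma y * w2 x y)) - t.
  move=> jy x0 <-; have sy := spos y jy.
  have w20 : 0 < w2 x y by apply: powR_gt0; exact: qf_gt0.
  have := kK x y (fun jj => ltW (jy jj)) x0; rewrite -/(w2 x y).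
  have p0 : 0 < sigma y * w2 x y by rewrite mulr_gt0.
  move: p0; move: (sigma y * w2 x y) => p p0 h.
  have q15 : 15 <= 4 * s * (s + 1) by nra.
  have : (K + 1) * p * 15 <= (K + 1) * p * (4 * s * (s + 1)).
    by rewrite ler_wpM2l // mulr_ge0 // ?ltW //; lra.
  have : 0 <= K * p by rewrite mulr_ge0 // ltW.
  lra.
apply: (max_principle Hv (b := j) (M := M)) => //.
- move=> x y jy xyM; have := hM x y jy xyM.
  have B0 : 0 <= (1 - J + J * y) * qf x y `^ (- s).
    by rewrite -sigmaE mulr_ge0 ?powR_ge0 ?sg0.
  have : 0 <= K * ((1 - J + J * y) * qf x y `^ (- s)) by rewrite mulr_ge0.
  by rewrite -sigmaE in B0 *; lra.
- move=> jt x; rewrite -sigmaE /sigma jt (bdry jt); lra.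
- move=> x y jy x0; have xn0 : x != 0 by rewrite gt_eqF.
  have H := main x y _ jy (ltW x0) (esym (Lap x y x0)).
  rewrite -(barrier_Delta5 (t := - 2 * s * w x y)) // in H.
  by apply: (lt_le_trans H); rewrite le_eqVlt; apply/orP; left; apply/eqP; field.
- move=> y jy.
  have axeq := axis_equation Ha (ck 0 y) (Lap ^~ y).
  have H := main 0 y _ jy (lexx 0) (esym axeq).
  rewrite -(barrier_Delta5 (t := - 2 * s * w 0 y)) // in H.
  by apply: (lt_le_trans H); rewrite le_eqVlt; apply/orP; left; apply/eqP; ring.
Qed.

End Barrier.

(** * Traces of axisymmetric functions *)

Section Bridge.
Context {R : realType}.

Definition e1 : R * R * R := ((1, 0), 0).
Definition e3 : R * R * R := ((0, 0), 1).

(* The trace on the half-plane [y = 0] of the derivative of the axisymmetric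
   function in the directions [vs]. *)
Definition trace (f : R -> R -> R) (vs : seq (R * R * R)) (r z : R) : R :=
  iter_derive vs (axisym f) ((r, 0), z).

Lemma trace_cont2 f vs r z : axis_compatible f -> cont2 (trace f vs) r z.
Proof.
move=> sf; have /differentiable_continuous cG := sf vs ((r, 0), z).
have h : ((q.1, 0), q.2) @[q --> (r, z)] --> ((r, 0 : R), z).
  apply: (@cvg_pair _ _ _ _ (nbhs (r, 0 : R)) (nbhs z)); last exact: cvg_snd.
  apply: (@cvg_pair _ _ _ _ (nbhs r) (nbhs (0 : R))); first exact: cvg_fst.
  exact: cvg_cst.
exact: (@cvg_comp _ _ _ _ (iter_derive vs (axisym f)) _ _ _ h cG).
Qed.

(** The difference quotient of the slice is equal, as a function of the step, to that of the
    three-dimensional function in the direction [e1]; derivability and value transfer together,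
    without a chain rule. *)
Lemma trace_dr f vs (r z : R) : axis_compatible f ->
  is_derive r 1 (trace f vs ^~ z) (trace f (e1 :: vs) r z).
Proof.
move=> sf; have dG : derivable (iter_derive vs (axisym f)) ((r, 0), z) e1 := diff_derivable (sf vs _).
have E : (fun h : R => h^-1 *: ((trace f vs ^~ z \o shift r) (h *: 1) - trace f vs r z)) =
  (fun h : R => h^-1 *: ((iter_derive vs (axisym f) \o shift ((r, 0), z)) (h *: e1)
     - iter_derive vs (axisym f) ((r, 0), z))).
  apply/funext => h /=; rewrite /trace; congr (_ *: (iter_derive _ _ _ - _)).
  congr (_, _); last by rewrite /= scaler0 add0r.
  by congr (_, _); rewrite /= ?scaler0 ?add0r.
split; first exact: (eq_ind_r (fun g => cvg (g @ 0^')) dG E).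
exact: (congr1 (fun g => lim (g @ 0^')) E).
Qed.

Lemma trace_dz f vs (r z : R) : axis_compatible f ->
  is_derive z 1 (trace f vs r) (trace f (e3 :: vs) r z).
Proof.
move=> sf; have dG : derivable (iter_derive vs (axisym f)) ((r, 0), z) e3 := diff_derivable (sf vs _).
have E : (fun h : R => h^-1 *: ((trace f vs r \o shift z) (h *: 1) - trace f vs r z)) =
  (fun h : R => h^-1 *: ((iter_derive vs (axisym f) \o shift ((r, 0), z)) (h *: e3)
     - iter_derive vs (axisym f) ((r, 0), z))).
  apply/funext => h /=; rewrite /trace; congr (_ *: (iter_derive _ _ _ - _)).
  congr (_, _).
  by congr (_, _); rewrite /= ?scaler0 ?add0r.
split; first exact: (eq_ind_r (fun g => cvg (g @ 0^')) dG E).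
exact: (congr1 (fun g => lim (g @ 0^')) E).
Qed.

Lemma trace_nil f r z : trace f [::] r z = f `|r| z.
Proof. by rewrite /trace /= /axisym /= expr0n addr0 sqrtr_sqr. Qed.

Lemma trace_even_C2 f : axis_compatible f ->
  even_C2 (trace f [::]) (trace f [:: e1]) (trace f [:: e3])
    (trace f [:: e1; e1]) (trace f [:: e3; e3]).
Proof.
move=> sf; split.
1,2: by move=> r z; exact: trace_dr.
1,2: by move=> r z; exact: trace_dz.
1-5: by move=> r z; exact: trace_cont2.
by move=> r z; rewrite !trace_nil normrN.
Qed.

Lemma trace_f f r z : 0 <= r -> trace f [::] r z = f r z.
Proof. by move=> r0; rewrite trace_nil ger0_norm. Qed.

(** [dr] looks at both sides of [r], while [f] agrees with its even extension only for nonnegative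
    radii; hence [0 < r]. For [dz] the radius is fixed and the axis is allowed. *)
Lemma dr_trace f r z : axis_compatible f -> 0 < r -> dr f r z = trace f [:: e1] r z.
Proof.
move=> sf r0; apply: der_derive1; apply: der_near (trace_dr [::] r z sf).
near=> s; rewrite trace_f // ltW //; near: s; exact: lt_nbhsr.
Unshelve. all: by end_near. Qed.

Lemma dz_trace f r z : axis_compatible f -> 0 <= r -> dz f r z = trace f [:: e3] r z.
Proof.
move=> sf r0; apply: der_derive1; apply: der_near (trace_dz [::] r z sf).
by near=> s; rewrite trace_f.
Unshelve. all: by end_near. Qed.

Lemma drr_trace f r z : axis_compatible f -> 0 < r ->
  dr (dr f) r z = trace f [:: e1; e1] r z.
Proof.
move=> sf r0; apply: der_derive1; apply: der_near (trace_dr [:: e1] r z sf).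
near=> s; rewrite dr_trace //; near: s; exact: lt_nbhsr.
Unshelve. all: by end_near. Qed.

Lemma dzz_trace f r z : axis_compatible f -> 0 <= r ->
  dz (dz f) r z = trace f [:: e3; e3] r z.
Proof.
move=> sf r0; apply: der_derive1; apply: der_near (trace_dz [:: e3] r z sf).
by near=> s; rewrite dz_trace.
Unshelve. all: by end_near. Qed.

Lemma grad_sq_trace f r z : axis_compatible f -> 0 < r ->
  grad_sq f r z = trace f [:: e1] r z ^+ 2 + trace f [:: e3] r z ^+ 2.
Proof. by move=> sf r0; rewrite /grad_sq (dr_trace z sf r0) (dz_trace z sf (ltW r0)). Qed.

Lemma Delta5_trace f r z : axis_compatible f -> 0 < r ->
  Delta5 f r z = trace f [:: e1; e1] r z + 3 / r * trace f [:: e1] r z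
    + trace f [:: e3; e3] r z.
Proof. by move=> sf r0; rewrite /Delta5 (drr_trace z sf r0) (dr_trace z sf r0) (dzz_trace z sf (ltW r0)). Qed.

Lemma trace_decay f vs n : rapidly_decaying f ->
  exists2 C : R, 0 <= C & forall r z, `|trace f vs r z| <= C / qf r z ^+ n.
Proof.
move=> [_ /(_ vs (2 * n)%N)[C hC]].
exists (2 ^+ n * `|C|); first by rewrite mulr_ge0 ?exprn_ge0.
move=> r z; rewrite ler_pdivlMr ?exprn_gt0 ?qf_gt0 //.
have := hC ((r, 0), z); rewrite -/(trace f vs r z); set m := `|_| => hm.
have m0 : 0 <= m by exact: normr_ge0.
have mr : `|r| <= m by rewrite /m /Num.norm /= !le_max lexx.
have mz : `|z| <= m by rewrite /m /Num.norm /= !le_max lexx orbT.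
(* Here [m] is the maximum norm of the point, hence the factor 2; [qf] is quadratic in it, which is
   why decay of order [2 * n] was invoked. *)
have qm : qf r z <= 2 * (1 + m) ^+ 2.
  rewrite /qf -(real_normK (num_real r)) -(real_normK (num_real z)).
  have h1 : `|r| ^+ 2 <= m ^+ 2 by rewrite ler_sqr ?nnegrE.
  have h2 : `|z| ^+ 2 <= m ^+ 2 by rewrite ler_sqr ?nnegrE.
  nra.
have : qf r z ^+ n <= (2 * (1 + m) ^+ 2) ^+ n.
  by rewrite lerXn2r ?nnegrE ?(ltW (qf_gt0 r z)) // mulr_ge0 ?sqr_ge0.
rewrite exprMn -exprM => h.
apply: (@le_trans _ _ (`|trace f vs r z| * (2 ^+ n * (1 + m) ^+ (2 * n)))).
  by rewrite ler_wpM2l.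
rewrite mulrCA ler_wpM2l ?exprn_ge0 // mulrC; apply: le_trans hm _; exact: ler_norm.
Qed.

End Bridge.

(** * Integrable weights *)

Section Products.
Context {R : realType}.
Notation leb := (@lebesgue_measure R).
Notation leb2 := (leb \x leb)%E.
Notation hp := (@half_plane R).

Definition ray : set (measurableTypeR R) := `]0, +oo[%classic.

Lemma ray_measurable (u : R -> R) : (forall r : R, 0 < r -> {for r, continuous u}) ->
  measurable_fun ray u.
Proof.
move=> cu; apply: open_continuous_measurable_fun; first exact: interval_open.
by move=> r; rewrite inE /ray /= in_itv /= andbT => r0; exact: cu.
Qed.

(** An improper integral is bounded by exhibiting an antiderivative with values between 0 and [M];
    its limits at 0 and at infinity need not be computed. *)
Lemma ray_integral_le (u H : R -> R) (M : R) :
  (forall r : R, 0 < r -> is_derive r 1 H (u r)) ->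
  (forall r : R, 0 < r -> {for r, continuous u}) ->
  (forall r : R, 0 < r -> 0 <= u r) -> (forall r : R, 0 < r -> 0 <= H r <= M) ->
  (\int[leb]_(r in ray) (u r)%:E <= M%:E)%E.
Proof.
move=> dH cu u0 HM.
have mray : measurable ray by exact: measurable_itv.
have mu : measurable_fun ray (fun r => (u r)%:E).
  by apply/measurable_EFinP; exact: ray_measurable.
pose I n : set (measurableTypeR R) := `[(side n)^-1, side n]%classic.
pose un n := (fun r : measurableTypeR R => (u r)%:E) \_ (I n).
have Iray n : I n `<=` ray.
  move=> r; rewrite /I /ray /= !in_itv /= andbT => /andP[h _].
  by apply: lt_le_trans h; rewrite invr_gt0 side_gt0.
have mI n : measurable (I n) by exact: measurable_itv.
have mun n : measurable_fun ray (un n).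
  apply/(measurable_restrict _ (mI n) mray).
  have -> : ray `&` I n = I n by apply/setIidPr.
  exact: measurable_funS mray (Iray n) mu.
have un_cvg r : ray r -> un n r @[n --> \oo] --> (u r)%:E.
  rewrite /ray /= in_itv /= andbT => r0.
  apply: cvg_near_cst; near=> n; rewrite /un patchE ifT //; apply/mem_set.
  rewrite /I /= in_itv /=; apply/andP; split; last by near: n; exact: near_side.
  by rewrite invf_ple ?posrE ?side_gt0 //; near: n; exact: near_side.
have un0 n r : ray r -> (0 <= un n r)%E.
  move=> rr; rewrite /un patchE; case: ifPn => // _; rewrite lee_fin u0 //.
  by move: rr; rewrite /ray /= in_itv /= andbT.
have -> : (\int[leb]_(r in ray) (u r)%:E = \int[leb]_(r in ray) limn_einf (un ^~ r))%E.
  by apply: eq_integral => r /set_mem rr; rewrite (cvg_limn_einf_sup (un_cvg _ rr)).1.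
apply: (le_trans (fatou _ mray mun un0)).
rewrite limn_einf_lim; apply: lime_le; first exact: is_cvg_einfs.
apply: nearW => n; apply: (@le_trans _ _ (\int[leb]_(r in ray) un n r)%E).
  by apply: ereal_inf_lbound; exists n => /=.
rewrite /un -integral_mkcondr; have -> : ray `&` I n = I n by apply/setIidPr.
have pos r : (side n)^-1 <= r <= side n -> 0 < r.
  by move=> /andP[h _]; apply: lt_le_trans h; rewrite invr_gt0 side_gt0.
have dH' r : (side n)^-1 <= r <= side n -> is_derive r 1 H (u r) by move=> /pos /dH.
have cu' r : (side n)^-1 <= r <= side n -> {for r, continuous u} by move=> /pos /cu.
rewrite [leLHS](FTC_segment (sideV_lt n) dH' cu') lee_fin.
have /andP[_ h1] := HM _ (side_gt0 n).
have s0 : 0 < (side n : R)^-1 by rewrite invr_gt0 side_gt0.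
have /andP[h2 _] := HM _ s0.
lra.
Unshelve. all: by end_near. Qed.

Lemma ray_integrable (u : R -> R) (M : R) :
  (forall r : R, 0 < r -> {for r, continuous u}) -> (forall r : R, 0 < r -> 0 <= u r) ->
  (\int[leb]_(r in ray) (u r)%:E <= M%:E)%E -> leb.-integrable ray (fun r => (u r)%:E).
Proof.
move=> cu u0 uM; apply/integrableP; split.
  by apply/measurable_EFinP; exact: ray_measurable.
apply: (@le_lt_trans _ _ M%:E); last exact: ltry.
apply: le_trans uM; rewrite le_eqVlt; apply/orP; left; apply/eqP.
apply: eq_integral => r /set_mem; rewrite /ray /= in_itv /= andbT => r0.
by rewrite /= ger0_norm // u0.
Qed.

Section Product.
Variables (u v : R -> R).
Hypothesis cu : forall r : R, 0 < r -> {for r, continuous u}.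
Hypothesis cv : forall z : R, {for z, continuous v}.
Hypothesis u0 : forall r : R, 0 < r -> 0 <= u r.
Hypothesis v0 : forall z : R, 0 <= v z.
Hypothesis iu : leb.-integrable ray (fun r => (u r)%:E).
Hypothesis iv : leb.-integrable setT (fun z => (v z)%:E).

Let pr := (fun p : measurableTypeR R * measurableTypeR R => (u p.1 * v p.2)%:E) \_ hp.

Let prE r z : pr (r, z) = (((fun r => (u r)%:E) \_ ray) r * (v z)%:E)%E.
Proof.
rewrite /pr !patchE; have -> : ((r, z) \in hp) = (r \in ray).
  by apply/idP/idP => /set_mem h; apply/mem_set; move: h; rewrite /ray /= in_itv /= andbT.
by case: ifP; rewrite ?mul0e ?EFinM.
Qed.

Let c2uv r z : 0 < r -> cont2 (fun r z => u r * v z) r z.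
Proof.
move=> r0; apply: c2M; first by apply: (c2_comp1 (h := u)); [exact: cu|exact: c2_r].
by apply: (c2_comp1 (h := v)); [exact: cv|exact: c2_z].
Qed.

Let mpr : measurable_fun setT pr.
Proof.
apply/(measurable_restrictT _ (@measurable_half_plane R)); apply/measurable_EFinP.
by apply: (hp_measurable (f := fun r z => u r * v z)) => r z; exact: c2uv.
Qed.

Let pr0 p : (0 <= pr p)%E.
Proof.
case: p => r z; rewrite /pr patchE; case: ifPn => // /set_mem r0.
by rewrite lee_fin mulr_ge0 // u0.
Qed.

Let Iv : R := \int[leb]_(z in setT) v z.
Let Iu : R := \int[leb]_(r in ray) u r.

Let IvE : (\int[leb]_z (v z)%:E = Iv%:E)%E.
Proof. by rewrite /Iv /Rintegral fineK // integrable_fin_num. Qed.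

Let IuE : (\int[leb]_(r in ray) (u r)%:E = Iu%:E)%E.
Proof. by rewrite /Iu /Rintegral fineK // integrable_fin_num //; exact: measurable_itv. Qed.

Let prI : (\int[leb2]_p pr p = (Iu * Iv)%:E)%E.
Proof.
rewrite (fubini_tonelli1 _ mpr pr0) /fubini_F.
transitivity (\int[leb]_r (((fun r => (u r)%:E) \_ ray) r * Iv%:E))%E.
  apply: eq_integral => r _; under eq_integral do rewrite prE.
  rewrite ge0_integralZl ?IvE //.
  - by apply/measurable_EFinP; apply: continuous_measurable_fun => z; exact: cv.
  - by move=> z _; rewrite lee_fin.
  - rewrite patchE; case: ifPn => // /set_mem; rewrite /ray /= in_itv /= andbT => r0.
    by rewrite lee_fin u0.
rewrite ge0_integralZr //.
- by rewrite -integral_mkcond IuE EFinM.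
- apply/(measurable_restrictT _ (measurable_itv _)); apply/measurable_EFinP.
  exact: ray_measurable.
- move=> r _; rewrite patchE; case: ifPn => // /set_mem; rewrite /ray /= in_itv /= andbT => r0.
  by rewrite lee_fin u0.
- by rewrite lee_fin; apply: Rintegral_ge0.
Qed.

Lemma product_integrable : hp_integrable (fun r z => u r * v z).
Proof.
rewrite /hp_integrable integrable_mkcond; last exact: measurable_half_plane.
apply/integrableP; split; first exact: mpr.
under eq_integral do rewrite gee0_abs // -/pr.
by rewrite [X in (X < _)%E]prI ltry.
Qed.

Lemma product_integral : hp_integral (fun r z => u r * v z) = Iu * Iv.
Proof.
by rewrite /hp_integral /Rintegral integral_mkcond [X in fine X]prI.
Qed.

End Product.
End Products.

Section Weights.
Context {R : realType}.
Notation leb := (@lebesgue_measure R).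

Lemma powR_le1 (x s : R) : 1 <= x -> 0 <= s -> x `^ (- s) <= 1.
Proof. by move=> x1 s0; rewrite -[leRHS](powRr0 x) ler_powR // oppr_le0. Qed.

Lemma measurable_ray : measurable (@ray R).
Proof. exact: measurable_itv. Qed.

(** Up to constants the weight is compared with the derivative of [(1 + r^(-m))^(-s)], which is
    bounded by 1. With [s m = p + 1] and [m = 2 q - p - 1] this derivative behaves like [r^p] at 0
    and like [r^(p - 2 q)] at infinity, as the weight does. *)
Lemma ray_weight_integrable (p q : R) : -1 < p -> p + 1 < 2 * q ->
  leb.-integrable ray (fun r => (r `^ p * (1 + r ^+ 2) `^ (- q))%:E).
Proof.
move=> p1 pq; pose m := 2 * q - p - 1; pose s := (p + 1) / m.
have m0 : 0 < m by rewrite /m; lra.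
have ms : s * m = p + 1 by rewrite /s divfK // gt_eqF.
have s0 : 0 < s by rewrite divr_gt0 //; lra.
pose H (r : R) := (1 + r `^ (- m)) `^ (- s).
pose u (r : R) := (p + 1) * ((1 + r `^ (- m)) `^ (- s - 1) * r `^ (- m - 1)).
have base (r : R) : 0 < r -> 0 < 1 + r `^ (- m) by move=> r0; have := powR_ge0 r (- m); lra.
have dH (r : R) : 0 < r -> is_derive r 1 H (u r).
  move=> r0; have b0 := base r r0; rewrite /H; eapply derE; first by der.
  by rewrite /u -ms; ring.
have cu (r : R) : 0 < r -> {for r, continuous u}.
  move=> r0; have b0 := base r r0.
  have : exists b, is_derive r 1 u b by eexists; rewrite /u; der.
  by move=> [b /der_cont].
have u0 (r : R) : 0 < r -> 0 <= u r.
  by move=> r0; rewrite /u !mulr_ge0 ?powR_ge0 //; lra.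
have HM (r : R) : 0 < r -> 0 <= H r <= 1.
  move=> r0; rewrite powR_ge0 /= /H powR_le1 ?(ltW s0) //.
  by have := powR_ge0 r (- m); lra.
have iu := ray_integrable cu u0 (ray_integral_le dH cu u0 HM).
have iC := integrableZl measurable_ray (2 `^ (s + 1) / (p + 1)) iu.
apply: (le_integrable measurable_ray _ _ iC).
  apply/measurable_EFinP; apply: ray_measurable => r r0.
  have h : 0 < 1 + r ^+ 2 by have := sqr_ge0 r; lra.
  have : exists b, is_derive r 1 (fun r => r `^ p * (1 + r ^+ 2) `^ (- q)) b.
    by eexists; der.
  by move=> [b /der_cont].
move=> r; rewrite /ray /= in_itv /= andbT => r0.
rewrite lee_fin !ger0_norm; last 2 first.
- by rewrite mulr_ge0 ?u0 // divr_ge0 ?powR_ge0 //; lra.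
- by rewrite mulr_ge0 ?powR_ge0.
have -> : 2 `^ (s + 1) / (p + 1) * u r =
    2 `^ (s + 1) * ((1 + r `^ (- m)) `^ (- s - 1) * r `^ (- m - 1)).
  by rewrite /u mulrA divfK // gt_eqF; lra.
have h2 : 0 < 1 + r ^+ 2 by have := sqr_ge0 r; lra.
have b0 := base r r0.
(* The parameters satisfy [m (s + 1) = 2 q], and each of 1 and [r^m] is at most
   [(1 + r^2)^(m / 2)]. *)
have key : (1 + r `^ m) `^ (s + 1) <= 2 `^ (s + 1) * (1 + r ^+ 2) `^ q.
  have -> : q = (m / 2) * (s + 1) by rewrite mulrDr mulr1 mulrAC (mulrC m) ms /m; field.
  rewrite powRrM -(powRM (s + 1) (ler0n R 2) (powR_ge0 _ _)).
  apply: ge0_ler_powR; rewrite ?nnegrE; [lra| | |].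
  - by have := powR_ge0 r m; lra.
  - by rewrite mulr_ge0 ?powR_ge0.
  have h1 : r `^ m <= (1 + r ^+ 2) `^ (m / 2).
    have {1}-> : m = 2%:R * (m / 2) by field.
    rewrite powRrM powR_mulrn ?(ltW r0) //.
    by apply: ge0_ler_powR; rewrite ?nnegrE; have := sqr_ge0 r; lra.
  have h3 : 1 <= (1 + r ^+ 2) `^ (m / 2).
    rewrite -[leLHS](powRr0 (1 + r ^+ 2)) ler_powR; [by []| |lra].
    by have := sqr_ge0 r; lra.
  lra.
have E1 : 1 + r `^ m = (1 + r `^ (- m)) * r `^ m.
  by rewrite powRN mulrDl mul1r mulVf ?gt_eqF ?powR_gt0 // addrC.
rewrite E1 powRM ?(ltW b0) ?powR_ge0 // -powRrM in key.
have rn0 : r != 0 by rewrite gt_eqF.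
have -> : r `^ (- m - 1) = r `^ p / r `^ (m * (s + 1)).
  rewrite -powRN -powRD ?rn0 ?implybT //; congr (_ `^ _).
  by rewrite mulrDr mulr1 (mulrC m) ms; ring.
have -> : (1 + r `^ (- m)) `^ (- s - 1) = ((1 + r `^ (- m)) `^ (s + 1))^-1.
  by rewrite -powRN; congr (_ `^ _); ring.
rewrite powRN.
have w0 : 0 < (1 + r `^ (- m)) `^ (s + 1) by exact: powR_gt0.
have x0 : 0 < r `^ (m * (s + 1)) by exact: powR_gt0.
have y0 : 0 < (1 + r ^+ 2) `^ q by exact: powR_gt0.
have z0 : 0 < r `^ p by exact: powR_gt0.
move: w0 x0 y0 z0 key.
move: (_ `^ (s + 1)) (r `^ (m * (s + 1))) (_ `^ q) (r `^ p) (2 `^ (s + 1)) => w x y z t w0 x0 y0 z0 key.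
have -> : t * (w^-1 * (z / x)) = z * (t / (w * x)).
  by rewrite invfM; ring.
rewrite ler_pM2l // -[leLHS]div1r ler_pdivrMr // mulrAC ler_pdivlMr ?mulr_gt0 //.
by rewrite mul1r.
Qed.

Lemma line_weight_integrable (b : R) : 1 < 2 * b ->
  leb.-integrable setT (fun z => ((1 + z ^+ 2) `^ (- b))%:E).
Proof.
move=> b1; have pos (z : R) : 0 < 1 + z ^+ 2 by have := sqr_ge0 z; lra.
have cv : continuous (fun z : R => (1 + z ^+ 2) `^ (- b)).
  move=> z; have p := pos z.
  have : exists c, is_derive z 1 (fun z => (1 + z ^+ 2) `^ (- b)) c by eexists; der.
  by move=> [c /der_cont].
apply/integrableP; split.
  by apply/measurable_EFinP; exact: continuous_measurable_fun.
under eq_integral do rewrite /= ger0_norm ?powR_ge0 //.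
rewrite ge0_symfun_integralT //; last 2 first.
- by move=> z; exact: powR_ge0.
- by move=> z /=; rewrite sqrrN.
have -> : [set x : R | 0 <= x] = `[0, +oo[%classic.
  by apply/seteqP; split=> x /=; rewrite in_itv /= andbT.
rewrite -integral_itv_obnd_cbnd; last first.
  by apply/measurable_EFinP; apply: measurable_funTS; exact: continuous_measurable_fun.
have /integrableP[_] := @ray_weight_integrable 0 b ltac:(lra) ltac:(lra).
have -> : (\int[leb]_(x in ray) `|(x `^ 0 * (1 + x ^+ 2) `^ (- b))%:E|)%E =
    (\int[leb]_(x in `]0%R, +oo[) ((1 + x ^+ 2) `^ (- b))%:E)%E.
  by apply: eq_integral => x _; rewrite powRr0 mul1r /= ger0_norm ?powR_ge0.
by move=> h; rewrite lte_mul_pinfty // ge0_fin_numE.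
Qed.

Lemma product_weight_integrable (p q b : R) : -1 < p -> p + 1 < 2 * q -> 1 < 2 * b ->
  hp_integrable (fun r z : R => r `^ p * (1 + r ^+ 2) `^ (- q) * (1 + z ^+ 2) `^ (- b)).
Proof.
move=> p1 pq b1; have pos (z : R) : 0 < 1 + z ^+ 2 by have := sqr_ge0 z; lra.
apply: (product_integrable (u := fun r => r `^ p * (1 + r ^+ 2) `^ (- q))
  (v := fun z => (1 + z ^+ 2) `^ (- b))).
- move=> r r0; have h := pos r.
  have : exists b, is_derive r 1 (fun r => r `^ p * (1 + r ^+ 2) `^ (- q)) b.
    by eexists; der.
  by move=> [c /der_cont].
- move=> z; have h := pos z.
  have : exists c, is_derive z 1 (fun z => (1 + z ^+ 2) `^ (- b)) c by eexists; der.
  by move=> [c /der_cont].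
- by move=> r r0; rewrite mulr_ge0 ?powR_ge0.
- by move=> z; exact: powR_ge0.
- exact: ray_weight_integrable.
- exact: line_weight_integrable.
Qed.

Lemma qf_weight_integrable (p k : R) : -1 < p -> p + 2 < 2 * k ->
  hp_integrable (fun r z : R => qf r z `^ (- k) * r `^ p).
Proof.
(* [qf^(-k)] is dominated by a product with exponents [k - b] in [r] and [b] in [z]. The two
   integrability conditions confine [b] between [1/2] and [k - (p + 1) / 2]; its midpoint is
   taken. *)
move=> p1 pk; pose b := (2^-1 + (k - (p + 1) / 2)) / 2.
have b1 : 1 < 2 * b by rewrite /b; lra.
have b2 : p + 1 < 2 * (k - b) by rewrite /b; lra.
apply: hp_integrable_le (product_weight_integrable p1 b2 b1) _.
  move=> r z r0; have q0 := qf_gt0 r z; rewrite /qf in q0 *; c2.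
move=> r z r0; rewrite ger0_norm ?mulr_ge0 ?powR_ge0 // -mulrA mulrC.
rewrite ler_wpM2l ?powR_ge0 //.
have q0 := qf_gt0 r z.
have -> : - k = - (k - b) + - b by ring.
rewrite powRD ?(gt_eqF q0) ?implybT //.
have q1 : 0 < 1 + r ^+ 2 by have := sqr_ge0 r; lra.
have q2 : 0 < 1 + z ^+ 2 by have := sqr_ge0 z; lra.
rewrite !powRN; apply: ler_pM; rewrite ?invr_ge0 ?powR_ge0 //.
- rewrite lef_pV2 ?posrE ?powR_gt0 //; apply: ge0_ler_powR; rewrite ?nnegrE ?(ltW q1) ?(ltW q0) //; first lra.
  by rewrite /qf; have := sqr_ge0 z; lra.
- rewrite lef_pV2 ?posrE ?powR_gt0 //; apply: ge0_ler_powR; rewrite ?nnegrE ?(ltW q2) ?(ltW q0) //; first lra.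
  by rewrite /qf; have := sqr_ge0 r; lra.
Qed.

End Weights.

(** * The primitive in z of an even function *)

Section Average.
Context {R : realType}.
Notation leb := (@lebesgue_measure R).
Implicit Types f : R -> R -> R.

(** [z * avg f r z] is the primitive of [f r] vanishing at [z = 0]. Rescaling to the fixed segment
    handles both signs of [z] and puts the parameter inside the integrand, ready for differentiation
    under the integral. *)
Definition avg f (r z : R) : R := \int[leb]_(t in `[0, 1]) f r (z * t).

Let cont_seg (u : R -> R) : (forall t : R, {for t, continuous u}) ->
  leb.-integrable `[0, 1] (EFin \o u).
Proof.
move=> cu; apply: continuous_compact_integrable; first exact: segment_compact.
by apply: continuous_in_subspaceT => t _; exact: cu.
Qed.

Let slice f (r z : R) : (forall r z : R, cont2 f r z) ->
  forall t : R, {for t, continuous (fun t => f r (z * t))}.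
Proof.
move=> cf t; apply: (@cvg_comp _ _ _ (fun t => z * t) (f r) _ (nbhs (z * t))).
  by apply: cvgM; [exact: cvg_cst|exact: cvg_id].
exact: c2_slicez (cf r (z * t)).
Qed.

Lemma avg_integrable f (r z : R) : (forall r z : R, cont2 f r z) ->
  leb.-integrable `[0, 1] (EFin \o (fun t => f r (z * t))).
Proof. by move=> cf; apply: cont_seg; exact: slice. Qed.

Lemma FTC_Rintegral (a b : R) (u U : R -> R) : a < b ->
  (forall x : R, is_derive x 1 U (u x)) -> (forall x : R, {for x, continuous u}) ->
  \int[leb]_(x in `[a, b]) u x = U b - U a.
Proof. by move=> ab dU cu; rewrite /Rintegral (FTC_segment ab (F := U)). Qed.

Lemma avg_FTC f f2 (r z : R) : (forall r z : R, is_derive z 1 (f r) (f2 r z)) ->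
  (forall r z : R, cont2 f2 r z) -> z * avg f2 r z = f r z - f r 0.
Proof.
move=> df cf2; rewrite /avg -RintegralZl //; last exact: avg_integrable.
have -> : f r z - f r 0 = f r (z * 1) - f r (z * 0) by rewrite mulr1 mulr0.
have dU (x : R) : is_derive x 1 (fun t => f r (z * t)) (z * f2 r (z * x)).
  apply: (derE (der_comp (df r (z * x)) (derM (der_cst z x) (der_id x)))); ring.
apply: (FTC_Rintegral ltr01 dU) => x.
by apply: cvgM; [exact: cvg_cst|exact: (@slice f2 r z cf2)].
Qed.

Lemma avgD f g (r z : R) : (forall r z : R, cont2 f r z) -> (forall r z : R, cont2 g r z) ->
  avg (fun r z => f r z + g r z) r z = avg f r z + avg g r z.
Proof. by move=> cf cg; rewrite /avg RintegralD //; exact: avg_integrable. Qed.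

Lemma avg_norm_le f (r z M : R) : (forall r z : R, cont2 f r z) ->
  (forall t : R, 0 <= t <= 1 -> `|f r (z * t)| <= M) -> `|avg f r z| <= M.
Proof.
move=> cf fM; have i := avg_integrable r z cf.
have mI : measurable (`[0, 1]%classic : set (measurableTypeR R)) by exact: measurable_itv.
apply: le_trans (le_normr_Rintegral mI i) _.
have -> : M = \int[leb]_(t in `[0, 1]) M.
  rewrite Rintegral_cst //= lebesgue_measure_itv /= lte_fin ltr01 oppr0 adde0 /=; ring.
apply: le_Rintegral => //.
- exact: integrable_norm.
- by apply: cont_seg => t; exact: cvg_cst.
Qed.

(** Compactness of the segment makes the neighbourhood of [(r, z)] on which the integrands are close
    independent of [t]. *)
Lemma avg_cont2 f (r z : R) : (forall r z : R, cont2 f r z) -> cont2 (avg f) r z.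
Proof.
move=> cf; apply/cvgrPdist_lt => e e0 /=.
have h : \forall p \near (r, z), `[0, 1]%classic `<=`
    [set t : R | `|f r (z * t) - f p.1 (p.2 * t)| < e / 2].
  have /compact_near_coveringP cov := @segment_compact R 0 1.
  apply: (cov _ (nbhs (r, z)) (fun p t => `|f r (z * t) - f p.1 (p.2 * t)| < e / 2)) => t _.
  have c1 : {for (t, (r, z)), continuous
      (fun q : R * (R * R) => f r (z * q.1) - f q.2.1 (q.2.2 * q.1))}.
    apply: cvgB.
      apply: (@cvg_comp _ _ _ (fun q : R * (R * R) => q.1) (fun t => f r (z * t)) _ (nbhs t)).
        exact: cvg_fst.
      exact: slice.
    have g : (q.2.1, q.2.2 * q.1) @[q --> (t, (r, z))] --> (r, z * t).
      have l2 : q.2 @[q --> (t, (r, z))] --> (r, z) by exact: cvg_snd.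
      have l1 : q.1 @[q --> (t, (r, z))] --> t by exact: cvg_fst.
      have l21 : q.2.1 @[q --> (t, (r, z))] --> r by apply: (cvg_comp _ _ l2); exact: cvg_fst.
      have l22 : q.2.2 @[q --> (t, (r, z))] --> z by apply: (cvg_comp _ _ l2); exact: cvg_snd.
      exact: (cvg_pair l21 (cvgM l22 l1)).
    exact: (@cvg_comp _ _ _ _ (fun q : R * R => f q.1 q.2) _ _ _ g (cf r (z * t))).
  have e20 : 0 < e / 2 by rewrite divr_gt0.
  have H := @cvgr_dist_lt _ _ _ _ _ _ _ c1 _ e20; rewrite /= subrr in H.
  apply: (@filterS _ (nbhs (t, (r, z))) _ _ _ _ (H _)) => q /=.
  by rewrite sub0r normrN.
near=> p; have hp : `[0, 1]%classic `<=` [set t : R | `|f r (z * t) - f p.1 (p.2 * t)| < e / 2].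
  by near: p; exact: h.
apply: (@le_lt_trans _ _ (e / 2)); last by rewrite ltr_pdivrMr // mulrDr mulr1 ltrDl.
rewrite /avg -RintegralB //; [|exact: avg_integrable|exact: avg_integrable].
have mI : measurable (`[0, 1]%classic : set (measurableTypeR R)) by exact: measurable_itv.
have i : leb.-integrable `[0, 1] (EFin \o (fun t => f r (z * t) - f p.1 (p.2 * t))).
  by apply: cont_seg => t; apply: cvgB; exact: slice.
apply: le_trans (le_normr_Rintegral mI i) _.
have -> : e / 2 = \int[leb]_(t in `[0, 1]) (e / 2).
  rewrite Rintegral_cst //= lebesgue_measure_itv /= lte_fin ltr01 oppr0 adde0 /=; ring.
apply: le_Rintegral => //.
- exact: integrable_norm.
- by apply: cont_seg => t; exact: cvg_cst.
- by move=> t /hp /ltW.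
Unshelve. all: by end_near. Qed.

Lemma derive_under_segment (g g1 : R -> R -> R) (s : R) :
  (forall s t : R, is_derive s 1 (g ^~ t) (g1 s t)) ->
  (forall s t : R, {for t, continuous (g s)}) -> (forall s t : R, cont2 g1 s t) ->
  is_derive s 1 (fun s => \int[leb]_(t in `[0, 1]) g s t)
    (\int[leb]_(t in `[0, 1]) g1 s t).
Proof.
move=> dg cg cg1.
have mI : measurable (`[0, 1]%classic : set (measurableTypeR R)) by exact: measurable_itv.
have [M M0 hM] : exists2 M : R, 0 < M & forall x t, s - 1 <= x <= s + 1 -> 0 <= t <= 1 -> `|g1 x t| <= M.
  by apply: box_bounded => x t _ _; exact: cg1.
have d1E x t : partial1of2 g x t = g1 x t by rewrite /partial1of2; apply: der_derive1; exact: dg.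
have Is : `]s - 1, s + 1[%classic s by rewrite /= in_itv /=; apply/andP; split; lra.
have ig x : `]s - 1, s + 1[%classic x -> leb.-integrable `[0, 1] (EFin \o g x).
  by move=> _; apply: cont_seg => t; exact: cg.
have dg' x t : `]s - 1, s + 1[%classic x -> `[0, 1]%classic t -> derivable (g ^~ t) x 1.
  by move=> _ _; have [] := dg x t.
have iM : leb.-integrable `[0, 1] (EFin \o (fun _ : measurableTypeR R => M)).
  by apply: cont_seg => t; exact: cvg_cst.
have bM x t : `]s - 1, s + 1[%classic x -> `[0, 1]%classic t -> `|partial1of2 g x t| <= M.
  rewrite d1E /= !in_itv /= => /andP[h1 h2] h3; apply: hM => //.
  by rewrite !ltW.
apply: DeriveDef.
  exact: (derivable_under_integral mI Is ig dg' (fun _ => ltW M0) iM bM).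
rewrite -derive1E (differentiation_under_integral mI Is ig dg' (fun _ => ltW M0) iM bM).
by apply: eq_Rintegral => t _; rewrite d1E.
Qed.

Lemma avg_dr f f1 (r z : R) : (forall r z : R, is_derive r 1 (f ^~ z) (f1 r z)) ->
  (forall r z : R, cont2 f r z) -> (forall r z : R, cont2 f1 r z) ->
  is_derive r 1 (avg f ^~ z) (avg f1 r z).
Proof.
move=> df cf cf1; have dfs (s t : R) : is_derive s 1 (fun s => f s (z * t)) (f1 s (z * t)) by exact: df.
apply: (derive_under_segment (g := fun s t => f s (z * t)) r dfs).
- by move=> s t; exact: slice.
- move=> s t; apply: (c2_comp (g := fun s _ => s) (h := fun _ t => z * t)) => //; c2.
Qed.

(** The product rule and differentiation under the integral give the integrand
    [f(r, z t) + z t f2(r, z t)], which is the t-derivative of [t f(r, z t)]. *)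
Lemma avg_dz f f2 (r z : R) : (forall r z : R, is_derive z 1 (f r) (f2 r z)) ->
  (forall r z : R, cont2 f r z) -> (forall r z : R, cont2 f2 r z) ->
  is_derive z 1 (fun z => z * avg f r z) (f r z).
Proof.
move=> df cf cf2.
have d : is_derive z 1 (avg f r) (\int[leb]_(t in `[0, 1]) (t * f2 r (z * t))).
  have dfs (s t : R) : is_derive s 1 (fun s => f r (s * t)) (t * f2 r (s * t)).
    apply: (derE (der_comp (g := fun s => s * t) (df r (s * t)) (derM (der_id s) (der_cst t s)))); ring.
  apply: (derive_under_segment z dfs).
  - by move=> s t; exact: slice.
  - move=> s t; apply: c2M; first by c2.
    apply: (c2_comp (g := fun _ _ => r) (h := fun s t => s * t)) => //; c2.
apply: (derE (derM (der_id z) d)).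
have i2 : leb.-integrable `[0, 1] (EFin \o (fun t => t * f2 r (z * t))).
  by apply: cont_seg => t; apply: cvgM; [exact: cvg_id|exact: (@slice f2 r z cf2)].
have i3 : leb.-integrable `[0, 1] (EFin \o (fun t => z * (t * f2 r (z * t)))).
  apply: cont_seg => t; apply: cvgM; first exact: cvg_cst.
  by apply: cvgM; [exact: cvg_id|exact: (@slice f2 r z cf2)].
rewrite mul1r /avg -RintegralZl // -RintegralD //; last exact: avg_integrable.
have dU (t : R) : is_derive t 1 (fun t => t * f r (z * t)) (f r (z * t) + z * (t * f2 r (z * t))).
  apply: (derE (derM (der_id t) (der_comp (df r (z * t)) (derM (der_cst z t) (der_id t))))); ring.
rewrite (FTC_Rintegral ltr01 dU); first by rewrite mulr1; ring.
move=> t; apply: cvgD; first exact: (@slice f r z cf).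
apply: cvgM; first exact: cvg_cst.
by apply: cvgM; [exact: cvg_id|exact: (@slice f2 r z cf2)].
Qed.

End Average.

(** * Decay of the solution *)

Section TwoSided.
Context {R : realType}.

Lemma even_C2_opp (a a1 a2 a11 a22 : R -> R -> R) : even_C2 a a1 a2 a11 a22 ->
  even_C2 (fun r z => - a r z) (fun r z => - a1 r z) (fun r z => - a2 r z)
    (fun r z => - a11 r z) (fun r z => - a22 r z).
Proof.
move=> Ha; split.
1-4: move=> r z; apply: derN.
- exact: (ev_d1 Ha r z).
- exact: (ev_d11 Ha r z).
- exact: (ev_d2 Ha r z).
- exact: (ev_d22 Ha r z).
1-5: move=> r z; apply: c2N.
- exact: (ev_c Ha r z).
- exact: (ev_c1 Ha r z).
- exact: (ev_c2 Ha r z).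
- exact: (ev_c11 Ha r z).
- exact: (ev_c22 Ha r z).
by move=> r z; rewrite (ev_even Ha).
Qed.

Lemma barrier_bound (j : bool) (a a1 a2 a11 a22 k : R -> R -> R) (K : R) : 0 <= K ->
  even_C2 a a1 a2 a11 a22 -> (forall r z : R, cont2 k r z) ->
  (forall r z : R, 0 < r -> a11 r z + 3 / r * a1 r z + a22 r z = - k r z) ->
  (forall r z : R, (j -> 0 <= z) -> 0 <= r ->
     `|k r z| <= K * (sigma j z * qf r z `^ (- (3 / 2 + j%:R) - 1 - 1))) ->
  (forall e : R, 0 < e -> exists M : R, forall r z : R, (j -> 0 <= z) ->
    M <= r ^+ 2 + z ^+ 2 -> `|a r z| <= e * (1 + sigma j z)) ->
  (j -> forall r : R, a r 0 = 0) ->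
  forall r z : R, (j -> 0 <= z) -> `|a r z| <= (K + 1) * barrier j r z.
Proof.
move=> K0 Ha ck Lap kK growth bdry r z jz; rewrite ler_norml; apply/andP; split.
  rewrite lerNl; apply: (barrier_comparison K0 Ha ck Lap) => //.
  - move=> x y jy x0; apply: le_trans (kK x y jy x0); rewrite -normrN; exact: ler_norm.
  - move=> e e0; have [M hM] := growth e e0; exists M => x y jy xyM.
    by apply: le_trans (hM x y jy xyM); rewrite -normrN; exact: ler_norm.
rewrite -[a r z]opprK; apply: (barrier_comparison K0 (even_C2_opp Ha) (k := fun r z => - k r z)) => //.
- by move=> x y; apply: c2N.
- by move=> x y x0; rewrite opprK -[k x y]opprK -(Lap x y x0); ring.
- move=> x y jy x0; rewrite opprK; apply: le_trans (kK x y jy x0); exact: ler_norm.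
- move=> e e0; have [M hM] := growth e e0; exists M => x y jy xyM.
  by rewrite opprK; apply: le_trans (hM x y jy xyM); exact: ler_norm.
- by move=> jt x; rewrite bdry // oppr0.
Qed.

Lemma qf_powN (r z x : R) (n : nat) : x <= n%:R -> (qf r z ^+ n)^-1 <= qf r z `^ (- x).
Proof.
move=> xn; rewrite -powR_mulrn ?(ltW (qf_gt0 r z)) // -powRN.
by rewrite ler_powR ?qf_ge1 // lerN2.
Qed.

(** The dipole barrier vanishes on [z = 0], so the source must be bounded with a factor [z]. For
    [z < 1] the mean value theorem supplies it; moving from [y] to [z] at most doubles [qf], whence
    [32 = 2^5]. For [z >= 1] the factor is harmless. The power 5 is an integer above the required
    [9/2]. *)
Lemma odd_source_bound (f f2 : R -> R -> R) (C : R) : 0 <= C ->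
  (forall r z : R, is_derive z 1 (f r) (f2 r z)) -> (forall r, f r 0 = 0) ->
  (forall r z, `|f r z| <= C / qf r z ^+ 5) -> (forall r z, `|f2 r z| <= C / qf r z ^+ 5) ->
  forall r z, 0 <= z -> `|f r z| <= 32 * C * (z * qf r z `^ (- (3 / 2 + 1) - 1 - 1)).
Proof.
move=> C0 df f0 fC f2C r z z0.
have q0 := qf_gt0 r z; have q5 : 0 < qf r z ^+ 5 by rewrite exprn_gt0.
have p0 := powR_ge0 (qf r z) (- (3 / 2 + 1) - 1 - 1).
have qp : (qf r z ^+ 5)^-1 <= qf r z `^ (- (3 / 2 + 1) - 1 - 1).
  have -> : - (3 / 2 + 1) - 1 - 1 = - (9 / 2) :> R by field.
  by apply: qf_powN; lra.
have qi0 : 0 <= (qf r z ^+ 5)^-1 by rewrite invr_ge0 ltW.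
have [z1|z1] := leP 1 z.
  apply: le_trans (fC r z) _.
  have h1 : C * (qf r z ^+ 5)^-1 <= C * qf r z `^ (- (3 / 2 + 1) - 1 - 1) by rewrite ler_wpM2l.
  have h2 : C * qf r z `^ (- (3 / 2 + 1) - 1 - 1) <= 32 * C * z * qf r z `^ (- (3 / 2 + 1) - 1 - 1).
    by rewrite ler_wpM2r //; nra.
  by rewrite mulrA; exact: le_trans h1 h2.
move: z0; rewrite le_eqVlt => /orP[/eqP <-|z0]; first by rewrite f0 normr0 mul0r mulr0.
have [y yI fy] : exists2 y, y \in `]0, z[ & f r z - f r 0 = f2 r y * (z - 0).
  apply: (@MVT _ (f r) (f2 r)) => //.
  by apply: continuous_in_subspaceT => y _; exact: der_cont (df r y).
move: yI; rewrite in_itv /= => /andP[y0 yz].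
rewrite f0 !subr0 in fy; rewrite fy normrM (gtr0_norm z0).
have qy0 := qf_gt0 r y.
have qq : qf r z <= 2 * qf r y by rewrite /qf; have := sqr_ge0 r; have := sqr_ge0 y; nra.
have q5le : qf r z ^+ 5 <= 32 * qf r y ^+ 5.
  have -> : 32 * qf r y ^+ 5 = (2 * qf r y) ^+ 5 by rewrite exprMn; congr (_ * _); ring.
  by rewrite lerXn2r ?nnegrE ?(ltW q0) // mulr_ge0 // ltW.
have h1 : C / qf r y ^+ 5 <= 32 * C / qf r z ^+ 5.
  rewrite ler_pdivrMr ?exprn_gt0 // mulrAC ler_pdivlMr //.
  by rewrite (mulrC 32) -mulrA ler_wpM2l.
have h2 : 32 * C / qf r z ^+ 5 <= 32 * C * qf r z `^ (- (3 / 2 + 1) - 1 - 1).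
  by rewrite ler_wpM2l // mulr_ge0.
rewrite mulrA mulrAC ler_wpM2r ?(ltW z0) //.
exact: le_trans (f2C r y) (le_trans h1 h2).
Qed.

End TwoSided.

Local Opaque trace.

(** * Rapidly decaying sources and pointwise decay of the solution *)

Section Fast.
Context {R : realType}.
Implicit Types f g : R -> R -> R.

(** Quantifying over every power makes the class stable under sums, products and reflection, and
    leaves the exponent free to suit each barrier or weight. *)
Definition fast f := (forall r z : R, cont2 f r z) /\
  forall n, exists2 C : R, 0 <= C & forall r z, `|f r z| <= C / qf r z ^+ n.

Lemma qfn_gt0 (r z : R) n : 0 < qf r z ^+ n.
Proof. by rewrite exprn_gt0 ?qf_gt0. Qed.

Lemma fastD f g : fast f -> fast g -> fast (fun r z => f r z + g r z).
Proof.
move=> [cf hf] [cg hg]; split; first by move=> r z; apply: c2D.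
move=> n; have [C C0 hC] := hf n; have [D D0 hD] := hg n.
exists (C + D); first exact: addr_ge0.
by move=> r z; rewrite mulrDl; apply: le_trans (ler_normD _ _) (lerD _ _).
Qed.

Lemma fastM f g : fast f -> fast g -> fast (fun r z => f r z * g r z).
Proof.
move=> [cf hf] [cg hg]; split; first by move=> r z; apply: c2M.
move=> n; have [C C0 hC] := hf n; have [D D0 hD] := hg 0%N.
exists (C * D); first exact: mulr_ge0.
move=> r z; rewrite normrM mulrAC; apply: ler_pM => //.
by have := hD r z; rewrite expr0 divr1.
Qed.

Lemma fastZ c f : fast f -> fast (fun r z => c * f r z).
Proof.
move=> [cf hf]; split; first by move=> r z; apply: c2M => //; exact: c2_cst.
move=> n; have [C C0 hC] := hf n; exists (`|c| * C); first exact: mulr_ge0.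
by move=> r z; rewrite normrM -mulrA ler_wpM2l.
Qed.

Lemma fast_refl f : fast f -> fast (fun r z => f r (- z)).
Proof.
move=> [cf hf]; split.
  move=> r z; apply: (c2_comp (f := f) (g := fun s _ => s) (h := fun _ t => - t)) => //; c2.
move=> n; have [C C0 hC] := hf n; exists C => // r z.
by have := hC r (- z); rewrite /qf sqrrN.
Qed.

Lemma fast_integrable f (p : R) : -1 < p -> fast f ->
  hp_integrable (fun r z => f r z ^+ 2 * r `^ p).
Proof.
move=> p1 [cf hf]; have [N hN] : exists N : nat, `|p| + 2 <= N%:R.
  exists (Num.bound (`|p| + 2)); apply/ltW/archi_boundP.
  by have := normr_ge0 p; lra.
have pN : p + 2 < 2 * (2 * N%:R) by have := ler_norm p; have := normr_ge0 p; lra.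
have [C C0 hC] := hf N.
apply: hp_integrable_le (hp_integrableZ (C ^+ 2) (qf_weight_integrable p1 pN)) _.
  by move=> r z r0; have := cf r z => ?; c2.
move=> r z r0; rewrite ger0_norm ?sqpow_ge0 // mulrA ler_wpM2r ?powR_ge0 //.
have -> : qf r z `^ (- (2 * N%:R)) = (qf r z ^+ N)^-1 ^+ 2.
  by rewrite powRN -natrM powR_mulrn ?(ltW (qf_gt0 r z)) // mulnC exprM exprVn.
rewrite -exprMn -(real_normK (num_real (f r z))) ler_sqr ?nnegrE //.
by rewrite divr_ge0 // ltW // qfn_gt0.
Qed.

End Fast.

Section SourceTerm.
Context {R : realType}.
Variable F : R -> R -> R.
Hypothesis hF : rapidly_decaying F.

Let sF : axis_compatible F := proj1 hF.

(** [F^2] and its first two z-derivatives, extended evenly in [r]. The second derivative is there to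
    give the factor [z] in [odd_source_bound]. *)
Definition src_h (r z : R) := trace F [::] r z ^+ 2.
Definition src_k (r z : R) := 2 * (trace F [::] r z * trace F [:: e3] r z).
Definition src_k2 (r z : R) :=
  2 * (trace F [:: e3] r z * trace F [:: e3] r z + trace F [::] r z * trace F [:: e3; e3] r z).

Let fast_trace vs : fast (trace F vs).
Proof. by split=> [r z|n]; [exact: trace_cont2|exact: trace_decay]. Qed.

Lemma fast_src_h : fast src_h.
Proof. exact: (fastM (fast_trace _) (fast_trace _)). Qed.

Lemma fast_src_k : fast src_k.
Proof. exact: (fastZ 2 (fastM (fast_trace _) (fast_trace _))). Qed.

Lemma fast_src_k2 : fast src_k2.
Proof.
exact: (fastZ 2 (fastD (fastM (fast_trace _) (fast_trace _)) (fastM (fast_trace _) (fast_trace _)))).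
Qed.

Lemma src_dh (r z : R) : is_derive z 1 (src_h r) (src_k r z).
Proof.
have d := trace_dz [::] r z sF; rewrite /src_h; eapply derE; first by der.
by rewrite /src_k /=; ring.
Qed.

Lemma src_dk (r z : R) : is_derive z 1 (src_k r) (src_k2 r z).
Proof.
have d := trace_dz [::] r z sF; have d2 := trace_dz [:: e3] r z sF.
by rewrite /src_k; eapply derE; [der|rewrite /src_k2; ring].
Qed.

Lemma Gdot_srcE (r z : R) : 0 <= r -> Gdot_src F r z = src_k r z.
Proof.
move=> r0; apply: der_derive1; apply: der_near (src_dh r z).
by near=> s; rewrite /src_h trace_f.
Unshelve. all: by end_near. Qed.

Lemma src_h_eq (r z : R) : 0 <= r -> F r z ^+ 2 = src_h r z.
Proof. by move=> r0; rewrite /src_h trace_f. Qed.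

Variable phi : R -> R -> R.
Hypothesis hphi : is_phi_src F phi.

Lemma phi_axis : axis_compatible phi.
Proof. by case: hphi. Qed.

Notation A := (trace phi [::]).
Notation A1 := (trace phi [:: e1]).
Notation A2 := (trace phi [:: e3]).
Notation A11 := (trace phi [:: e1; e1]).
Notation A22 := (trace phi [:: e3; e3]).

Let HA := trace_even_C2 phi_axis.

Lemma phi_equation (r z : R) : 0 < r ->
  A11 r z + 3 / r * A1 r z + A22 r z = - src_k r z.
Proof.
move=> r0; case: hphi => sphi heq _; rewrite -(Delta5_trace z sphi r0).
by rewrite -(Gdot_srcE z (ltW r0)) -(heq r z r0) opprK.
Qed.

Lemma phi_vanishes (e : R) : 0 < e -> exists M : R, forall r z : R,
  M <= r ^+ 2 + z ^+ 2 -> `|A r z| <= e.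
Proof.
move=> e0; case: hphi => _ _ /(_ e e0)[M hM]; exists M => r z h.
rewrite trace_nil; apply/ltW/hM => //.
by rewrite real_normK ?num_real.
Qed.

(** The order [|x|^(-3)] of the fundamental solution in R^5. The decay power 4 of the source exceeds
    the [7/2] left by applying the operator to the barrier. *)
Lemma phi_decay3 : exists2 C : R, 0 <= C &
  forall r z, `|A r z| <= C * qf r z `^ (- (3 / 2)).
Proof.
have [ck /(_ 4%N)[C C0 hC]] := fast_src_k.
exists (C + 1); first exact: addr_ge0.
move=> r z; have := barrier_bound (j := false) C0 HA ck phi_equation _ _ _ r (z := z).
rewrite /barrier /sigma /= mul1r addr0; apply => //.
- move=> x y _ _; rewrite /sigma mul1r; apply: le_trans (hC x y) _.
  rewrite ler_wpM2l //.
  have -> : - (3 / 2) - 1 - 1 = - (7 / 2) :> R by field.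
  by apply: qf_powN; lra.
- move=> e e0; have [M hM] := phi_vanishes e0; exists M => x y _ h.
  by apply: le_trans (hM x y h) _; rewrite mulrDr mulr1 lerDl ltW.
Qed.

Lemma phi_bounded : exists2 C : R, 0 <= C & forall r z, `|A r z| <= C.
Proof.
have [C C0 hC] := phi_decay3; exists C => // r z; apply: le_trans (hC r z) _.
by rewrite ler_piMr // powR_le1 ?qf_ge1.
Qed.

Let o r z := A r z + -1 * A r (- z).
Let Ho := even_C2_lin (-1) HA (even_C2_refl HA).

Let sum_eq (c t p1 p2 p3 k q1 q2 q3 l : R) :
  p1 + t * p2 + p3 = - k -> q1 + t * q2 + q3 = - l ->
  p1 + c * q1 + t * (p2 + c * q2) + (p3 + c * q3) = - (k + c * l).
Proof.
move=> e1 e2; have -> : k = - (p1 + t * p2 + p3) by rewrite e1 opprK.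
by have -> : l = - (q1 + t * q2 + q3); [rewrite e2 opprK|ring].
Qed.

Lemma zqf_bound (r z x : R) : 0 <= z -> z * qf r z `^ (- (x + 2^-1)) <= qf r z `^ (- x).
Proof.
move=> z0; have q0 := qf_gt0 r z.
have -> : - x = - (x + 2^-1) + 2^-1 by ring.
rewrite powRD ?(gt_eqF q0) ?implybT // mulrC ler_wpM2l ?powR_ge0 //.
rewrite powR12_sqrt ?(ltW q0) //.
by rewrite -{1}(ger0_norm z0) -sqrtr_sqr ler_wsqrtr // /qf; have := sqr_ge0 r; lra.
Qed.

(** The difference vanishes on [z = 0], so the dipole barrier applies on the upper quarter. As
    [z <= qf^(1/2)], it is at most [qf^(-2)], one power of [|x|] better than [phi_decay3]; oddness
    transports the bound to [z < 0]. *)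
Lemma odd_part_decay : exists2 C : R, 0 <= C &
  forall r z, `|A r z - A r (- z)| <= C * qf r z `^ (- 2).
Proof.
pose ko r z := src_k r z + -1 * src_k r (- z).
have fko : fast ko := fastD fast_src_k (fastZ (-1) (fast_refl fast_src_k)).
have fko2 : fast (fun r z => src_k2 r z + src_k2 r (- z)) :=
  fastD fast_src_k2 (fast_refl fast_src_k2).
have [C C0 hC] := fko.2 5%N; have [D D0 hD] := fko2.2 5%N.
have dko (r z : R) : is_derive z 1 (ko r) (src_k2 r z + src_k2 r (- z)).
  have d1 := src_dk r z.
  have d2 : is_derive z 1 (fun t => src_k r (- t)) (- src_k2 r (- z)).
    apply: (derE (der_comp (src_dk r (- z)) (derN (der_id z)))); ring.
  apply: (derE (derD d1 (derM (der_cst (-1) z) d2))).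
  by rewrite mul0r add0r mulN1r opprK.
have CD0 : 0 <= C + D by exact: addr_ge0.
have K0 : 0 <= 32 * (C + D) by rewrite mulr_ge0.
have oddb : forall r z, 0 <= z -> `|ko r z| <= 32 * (C + D) * (z * qf r z `^ (- (3 / 2 + 1) - 1 - 1)).
  apply: (odd_source_bound CD0 dko).
  - by move=> r; rewrite /ko oppr0; ring.
  - move=> r z; apply: le_trans (hC r z) _.
    by apply: ler_wpM2r; [by rewrite invr_ge0 ltW ?qfn_gt0|by rewrite lerDl].
  - move=> r z; apply: le_trans (hD r z) _.
    by apply: ler_wpM2r; [by rewrite invr_ge0 ltW ?qfn_gt0|by rewrite lerDr].
have half r z : 0 <= z -> `|A r z - A r (- z)| <= (32 * (C + D) + 1) * qf r z `^ (- 2).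
  move=> z0; have := barrier_bound (j := true) K0 Ho fko.1 _ _ _ _ r (z := z) (fun _ => z0).
  rewrite /barrier /sigma /= mulN1r => bb.
  apply: le_trans (bb _ _ _ _) _.
  - by move=> x y x0; exact: (sum_eq (-1) (phi_equation y x0) (phi_equation (- y) x0)).
  - by move=> x y /(_ isT) y0 x0; exact: oddb.
  - move=> e e0; have e20 : 0 < e / 2 by rewrite divr_gt0.
    have [M hM] := phi_vanishes e20; exists M => x y /(_ isT) y0 h.
    have h1 := hM x y h; have h2 : `|A x (- y)| <= e / 2 by apply: hM; rewrite sqrrN.
    rewrite mulN1r; apply: le_trans (ler_normB _ _) _.
    have : 0 <= e * y by rewrite mulr_ge0 // ltW.
    lra.
  - by move=> _ x; rewrite oppr0; ring.
  rewrite ler_wpM2l ?addr_ge0 //.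
  have -> : 3 / 2 + 1 = 2 + 2^-1 :> R by field.
  exact: zqf_bound.
exists (32 * (C + D) + 1); first by rewrite addr_ge0.
move=> r z; have [z0|z0] := leP 0 z; first exact: half.
have := half r (- z); rewrite opprK distrC /qf sqrrN; apply; lra.
Qed.

End SourceTerm.

(** * The primitive in z of an even solution: equation and growth *)

Section EvenPart.
Context {R : realType}.

Lemma primitive_even_C2 (e e1 e2 e11 e22 : R -> R -> R) : even_C2 e e1 e2 e11 e22 ->
  even_C2 (fun r z => z * avg e r z) (fun r z => z * avg e1 r z) e
    (fun r z => z * avg e11 r z) e2.
Proof.
move=> He; have c0 := ev_c He; have c1 := ev_c1 He; have c2 := ev_c2 He.
have c11 := ev_c11 He.
have mulz (f f1 : R -> R -> R) (r z : R) : is_derive r 1 (avg f ^~ z) (avg f1 r z) ->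
    is_derive r 1 (fun r => z * avg f r z) (z * avg f1 r z).
  by move=> d; apply: (derE (derM (der_cst z r) d)); rewrite mul0r add0r.
have mulc (f : R -> R -> R) (r z : R) : (forall r z : R, cont2 f r z) ->
    cont2 (fun r z => z * avg f r z) r z.
  by move=> cf; apply: c2M; [exact: c2_z|exact: avg_cont2].
split.
- by move=> r z; exact: (mulz _ _ r z (avg_dr r z (ev_d1 He) c0 c1)).
- by move=> r z; exact: (mulz _ _ r z (avg_dr r z (ev_d11 He) c1 c11)).
- by move=> r z; exact: (avg_dz r z (ev_d2 He) c0 c2).
- by move=> r z; exact: (ev_d2 He r z).
- by move=> r z; exact: mulc.
- by move=> r z; exact: mulc.
- exact: c0.
- by move=> r z; exact: mulc.
- exact: c2.
- move=> r z; congr (_ * _); apply: eq_Rintegral => t _.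
  by rewrite (ev_even He).
Qed.

Variables (e e1 e2 e11 e22 k h : R -> R -> R).
Hypothesis He : even_C2 e e1 e2 e11 e22.
Hypothesis Lap : forall r z : R, 0 < r -> e11 r z + 3 / r * e1 r z + e22 r z = - k r z.
Hypothesis ck : forall r z : R, cont2 k r z.
Hypothesis dh : forall r z : R, is_derive z 1 (h r) (k r z).
Hypothesis h0 : forall r : R, h r 0 = 0.
Hypothesis ez : forall r z : R, e r (- z) = e r z.

Let e20 (r : R) : e2 r 0 = 0.
Proof.
have d := ev_d2 He r 0.
have d1 : is_derive (0 : R) 1 (e r) (- e2 r 0).
  have -> : e r = (fun z => e r (- z)) by apply/funext => z; rewrite ez.
  have d0 : is_derive (- (0 : R)) 1 (e r) (e2 r 0) by rewrite oppr0.
  by apply: (derE (der_comp d0 (derN (der_id 0)))); rewrite mulrN1.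
have [_ h1] := d; have [_ h2] := d1; move: h2; rewrite h1; lra.
Qed.

(** The equation is integrated in [z] from 0. Both boundary terms at [z = 0] vanish: [e2] because
    [e] is even in [z], and [h] by assumption. *)
Lemma primitive_equation (r z : R) : 0 < r ->
  z * avg e11 r z + 3 / r * (z * avg e1 r z) + e2 r z = - h r z.
Proof.
move=> r0.
have ci (x y : R) : cont2 (fun x y => 3 / r * e1 x y) x y.
  by have ? := ev_c1 He x y; c2.
have -> : z * avg e11 r z + 3 / r * (z * avg e1 r z) =
    z * avg (fun x y => e11 x y + 3 / r * e1 x y) r z.
  rewrite (avgD _ _ (ev_c11 He) ci) mulrDr; congr (_ + _); rewrite mulrCA; congr (_ * _).
  by rewrite /avg RintegralZl //; exact: (avg_integrable r z (ev_c1 He)).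
have -> : avg (fun x y => e11 x y + 3 / r * e1 x y) r z =
    avg (fun x y => - (k x y + e22 x y)) r z.
  by apply: eq_Rintegral => t _; have := Lap (z * t) r0; lra.
have dG (x y : R) : is_derive y 1 (fun y => - (h x y + e2 x y)) (- (k x y + e22 x y)).
  exact: (derN (derD (dh x y) (ev_d22 He x y))).
rewrite (avg_FTC (f := fun x y => - (h x y + e2 x y)) _ _ dG); first by rewrite h0 e20; ring.
by move=> x y; have ? := ev_c22 He x y; have ? := @ck x y; c2.
Qed.

(* Only boundedness of [e] and its decay at infinity are used: they make the
   primitive [o(z)], which is all that the maximum principle requires. *)
Lemma primitive_growth (C : R) : 0 <= C -> (forall r z, `|e r z| <= C) ->
  (forall d : R, 0 < d -> exists M : R, forall r z : R, M <= r ^+ 2 + z ^+ 2 -> `|e r z| <= d) ->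
  forall d : R, 0 < d -> exists M : R, forall r z : R, 0 <= z ->
    M <= r ^+ 2 + z ^+ 2 -> `|z * avg e r z| <= d * (1 + z).
Proof.
move=> C0 eC van d d0; have d20 : 0 < d / 2 by rewrite divr_gt0.
have [M hM] := van _ d20.
(* Beyond height [z1] the function [e] is at most [d / 2], and [z2] is chosen so that the
   contribution [z1 * C] of the heights below [z1] is at most [d * z / 2] once [z > Z]. The
   threshold in the next [exists] ensures that either [z > Z] or [r^2] alone exceeds [M]. *)
pose z1 := `|M| + 1; pose z2 := 2 * z1 * C / d; pose Z := z1 + z2.
have z1p : 1 <= z1 by rewrite /z1 lerDr.
have z2p : 0 <= z2 by rewrite /z2 divr_ge0 ?mulr_ge0 ?(ltW d0) //; lra.
exists (`|M| + Z ^+ 2) => r z z0 hz.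
have [zZ|Zz] := leP z Z.
  have rM : M <= r ^+ 2.
    apply: (le_trans (ler_norm M)); have : z ^+ 2 <= Z ^+ 2; last lra.
    by rewrite ler_sqr ?nnegrE // (le_trans z0 zZ).
  have : `|avg e r z| <= d / 2.
    apply: avg_norm_le; first exact: ev_c He.
    by move=> t _; apply: hM; have := sqr_ge0 (z * t); lra.
  move=> av; rewrite normrM (ger0_norm z0).
  have : z * `|avg e r z| <= z * (d / 2) by rewrite ler_wpM2l.
  have : 0 <= z * d by rewrite mulr_ge0 // ltW.
  lra.
have z1z : z1 < z by rewrite /Z in Zz; lra.
have [y yI fy] : exists2 y, y \in `]z1, z[ & z * avg e r z - z1 * avg e r z1 = e r y * (z - z1).
  have dI (y : R) := ev_d2 (primitive_even_C2 He) r y.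
  apply: (@MVT _ (fun z => z * avg e r z) (e r)) => //.
  by apply: continuous_in_subspaceT => y _; exact: der_cont (dI y).
move: yI; rewrite in_itv /= => /andP[y1 y2].
have ey : `|e r y| <= d / 2.
  apply: hM; apply: (le_trans (ler_norm M)).
  have := sqr_ge0 r; have : z1 <= y ^+ 2 by nra.
  by rewrite /z1; lra.
have a1 : `|avg e r z1| <= C by apply: avg_norm_le => //; exact: ev_c He.
have -> : z * avg e r z = z1 * avg e r z1 + e r y * (z - z1) by rewrite -fy; ring.
apply: le_trans (ler_normD _ _) _; rewrite !normrM (@ger0_norm _ z1); last lra.
rewrite (@ger0_norm _ (z - z1)); last lra.
have h1 : z1 * `|avg e r z1| <= z1 * C by rewrite ler_wpM2l //; lra.
have h2 : `|e r y| * (z - z1) <= d / 2 * (z - z1) by rewrite ler_wpM2r //; lra.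
have h3 : 2 * (z1 * C) <= d * z.
  have -> : 2 * (z1 * C) = d * z2 by rewrite /z2; field; rewrite gt_eqF.
  by rewrite ler_pM2l // /Z in Zz *; lra.
have : 0 <= d * z1 by rewrite mulr_ge0 ?(ltW d0) //; lra.
lra.
Qed.

End EvenPart.

(** * Convergence of the integrals of the solution, and the pairing identity *)

Section Decay.
Context {R : realType}.
Variables F phi : R -> R -> R.
Hypothesis hF : rapidly_decaying F.
Hypothesis hphi : is_phi_src F phi.

Notation A := (trace phi [::]).
Notation A1 := (trace phi [:: e1]).
Notation A2 := (trace phi [:: e3]).
Notation A11 := (trace phi [:: e1; e1]).
Notation A22 := (trace phi [:: e3; e3]).

Let HA := trace_even_C2 (phi_axis hphi).
Let He := even_C2_lin 1 HA (even_C2_refl HA).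
(** Twice the even part in [z], to avoid fractions; the factor [1 *] matches the shape produced by
    [even_C2_lin]. *)
Let E r z := A r z + 1 * A r (- z).
Let ke r z := src_k F r z + src_k F r (- z).
Let ho r z := src_h F r z + -1 * src_h F r (- z).

Let dho (r z : R) : is_derive z 1 (ho r) (ke r z).
Proof.
have d2 : is_derive z 1 (fun t => src_h F r (- t)) (- src_k F r (- z)).
  by apply: (derE (der_comp (src_dh hF r (- z)) (derN (der_id z)))); rewrite mulrN1.
apply: (derE (derD (src_dh hF r z) (derM (der_cst (-1) z) d2))).
by rewrite mul0r add0r mulN1r opprK.
Qed.

Let fho : fast ho := fastD (fast_src_h hF) (fastZ (-1) (fast_refl (fast_src_h hF))).
Let fke : fast ke := fastD (fast_src_k hF) (fast_refl (fast_src_k hF)).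

Let Eeq (r z : R) : 0 < r ->
  (A11 r z + 1 * A11 r (- z)) + 3 / r * (A1 r z + 1 * A1 r (- z))
  + (A22 r z + 1 * A22 r (- z)) = - ke r z.
Proof.
move=> r0; have := phi_equation hF hphi z r0; have := phi_equation hF hphi (- z) r0.
rewrite /ke; move: (A11 r z) (A11 r (- z)) (A1 r z) (A1 r (- z)) (A22 r z) (A22 r (- z)).
move: (src_k F r z) (src_k F r (- z)) (3 / r) => k1 k2 t p1 p2 q1 q2 s1 s2 h1 h2.
have -> : k1 = - (p1 + t * q1 + s1) by rewrite h2 opprK.
by have -> : k2 = - (p2 + t * q2 + s2); [rewrite h1 opprK|ring].
Qed.

Let Ez (r z : R) : E r (- z) = E r z.
Proof. by rewrite /E opprK !mul1r addrC. Qed.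

Let ho0 (r : R) : ho r 0 = 0.
Proof. by rewrite /ho oppr0 mulN1r subrr. Qed.

Let psi r z := z * avg E r z.
Let Hpsi := primitive_even_C2 He.

Let psi_eq := primitive_equation He Eeq fke.1 dho ho0 Ez.

Let E_bounded : exists2 C : R, 0 <= C & forall r z, `|E r z| <= C.
Proof.
have [C C0 hC] := phi_bounded hF hphi; exists (C + C); first exact: addr_ge0.
by move=> r z; rewrite /E mul1r; apply: le_trans (ler_normD _ _) (lerD _ _).
Qed.

Let E_vanishes (d : R) : 0 < d -> exists M : R, forall r z : R,
  M <= r ^+ 2 + z ^+ 2 -> `|E r z| <= d.
Proof.
move=> d0; have d20 : 0 < d / 2 by rewrite divr_gt0.
have [M hM] := phi_vanishes hphi d20; exists M => r z h.
have h1 := hM r z h; have h2 : `|A r (- z)| <= d / 2 by apply: hM; rewrite sqrrN.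
rewrite /E mul1r; apply: le_trans (ler_normD _ _) _; apply: le_trans (lerD h1 h2) _.
by rewrite -splitr.
Qed.

(** The primitive of an even function is odd, so the dipole barrier is available for it, with source
    [ho]. The missing information at infinity is the sublinear growth from [primitive_growth]. *)
Let psi_decay : exists2 C : R, 0 <= C & forall r z, `|psi r z| <= C * qf r z `^ (- 2).
Proof.
have [C C0 hC] := fho.2 5%N; have [D D0 hD] := fke.2 5%N.
have CD0 : 0 <= C + D by exact: addr_ge0.
have K0 : 0 <= 32 * (C + D) by rewrite mulr_ge0.
have qi0 (r z : R) : 0 <= (qf r z ^+ 5)^-1 by rewrite invr_ge0 ltW ?qfn_gt0.
have oddb : forall r z, 0 <= z -> `|ho r z| <= 32 * (C + D) * (z * qf r z `^ (- (3 / 2 + 1) - 1 - 1)).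
  apply: (odd_source_bound CD0 dho ho0).
  - by move=> r z; apply: le_trans (hC r z) _; apply: ler_wpM2r; rewrite ?lerDl.
  - by move=> r z; apply: le_trans (hD r z) _; apply: ler_wpM2r; rewrite ?lerDr.
have [B B0 hB] := E_bounded.
have half r z : 0 <= z -> `|psi r z| <= (32 * (C + D) + 1) * qf r z `^ (- 2).
  move=> z0; have := barrier_bound (j := true) K0 Hpsi fho.1 psi_eq _ _ _ r (z := z) (fun _ => z0).
  rewrite /barrier /sigma /= => bb.
  apply: le_trans (bb _ _ _) _.
  - by move=> x y /(_ isT) y0 x0; exact: oddb.
  - move=> d d0; have [M hM] := primitive_growth He B0 hB E_vanishes d0.
    by exists M => x y /(_ isT); exact: hM.
  - by move=> _ x; rewrite mul0r.
  rewrite ler_wpM2l ?addr_ge0 //.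
  have -> : 3 / 2 + 1 = 2 + 2^-1 :> R by field.
  exact: zqf_bound.
exists (32 * (C + D) + 1); first by rewrite addr_ge0.
move=> r z; have [z0|z0] := leP 0 z; first exact: half.
have := half r (- z); rewrite /qf sqrrN.
have -> : psi r (- z) = - psi r z.
  rewrite /psi mulNr; congr (- (_ * _)); apply: eq_Rintegral => t _.
  by rewrite mulNr Ez.
by rewrite normrN; apply; lra.
Qed.

(** [E] is the z-derivative of [psi], hence part of its gradient, and the energy estimate at
    exponent [al - 2] controls exactly [E^2 r^(al - 2)]. That estimate calls for [psi^2 r^(al - 4)],
    integrable at the axis for [al > 3]. *)
Lemma even_part_integrable (al : R) : 3 < al < 8 ->
  hp_integrable (fun r z => E r z ^+ 2 * r `^ (al - 2)).
Proof.
move=> /andP[a3 a8].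
have cE : forall r z : R, cont2 E r z by exact: (ev_c He).
have cpsi := ev_c Hpsi.
have psi_i : hp_integrable (fun r z => psi r z ^+ 2 * r `^ (al - 2 - 2)).
  have [C C0 hC] := psi_decay.
  apply: hp_integrable_le (hp_integrableZ (C ^+ 2) (qf_weight_integrable (p := al - 2 - 2) (k := 4) _ _)) _.
  - by move=> r z r0; have ? := cpsi r z; c2.
  - lra.
  - lra.
  move=> r z r0; rewrite ger0_norm ?sqpow_ge0 // mulrA ler_wpM2r ?powR_ge0 //.
  have -> : qf r z `^ (- 4) = (qf r z `^ (- 2)) ^+ 2.
    rewrite -(powR_mulrn 2 (powR_ge0 _ _)) -powRrM; congr (_ `^ _); ring.
  by rewrite -exprMn -(real_normK (num_real (psi r z))) ler_sqr ?nnegrE // mulr_ge0 ?powR_ge0.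
have ho_i : hp_integrable (fun r z => ho r z ^+ 2 * r `^ (al - 2 + 2)).
  by apply: fast_integrable => //; lra.
have ei := energy_integrable Hpsi (fun r z _ => fho.1 r z) psi_eq psi_i ho_i.
apply: hp_integrable_le ei _.
  by move=> r z r0; have ? := cE r z; c2.
move=> r z r0; rewrite ger0_norm ?sqpow_ge0 // ler_wpM2r ?powR_ge0 //.
by rewrite lerDr sqr_ge0.
Qed.

(** Up to [al = 3] the bound [|x|^(-3)] suffices. Above it, [phi^2] is at most the sum of the
    squares of [E] and of the odd difference; the latter, of order [|x|^(-4)], sets the limit 8. *)
Lemma phi_weight_integrable (al : R) : 1 < al < 8 ->
  hp_integrable (fun r z => A r z ^+ 2 * r `^ (al - 2)).
Proof.
move=> /andP[a1 a8]; have cA := ev_c HA.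
have cc (r z : R) : 0 < r -> cont2 (fun r z => A r z ^+ 2 * r `^ (al - 2)) r z.
  by move=> r0; have ? := cA r z; c2.
have [a3|a3] := leP al 3.
  have [C C0 hC] := phi_decay3 hF hphi.
  apply: hp_integrable_le (hp_integrableZ (C ^+ 2) (qf_weight_integrable (p := al - 2) (k := 3) _ _)) _.
  - exact: cc.
  - lra.
  - lra.
  move=> r z r0; rewrite ger0_norm ?sqpow_ge0 // mulrA ler_wpM2r ?powR_ge0 //.
  have -> : qf r z `^ (- 3) = (qf r z `^ (- (3 / 2))) ^+ 2.
    rewrite -(powR_mulrn 2 (powR_ge0 _ _)) -powRrM; congr (_ `^ _); by field.
  by rewrite -exprMn -(real_normK (num_real (A r z))) ler_sqr ?nnegrE // mulr_ge0 ?powR_ge0.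
have hal : 3 < al < 8 by apply/andP.
have ei := even_part_integrable hal.
have [C C0 hC] := odd_part_decay hF hphi.
have oi := hp_integrableZ (C ^+ 2) (qf_weight_integrable (p := al - 2) (k := 4) ltac:(lra) ltac:(lra)).
apply: hp_integrable_le (hp_integrableD ei oi) _; first exact: cc.
move=> r z r0; rewrite ger0_norm ?sqpow_ge0 // mulrA -mulrDl ler_wpM2r ?powR_ge0 //.
have -> : qf r z `^ (- 4) = (qf r z `^ (- 2)) ^+ 2.
  rewrite -(powR_mulrn 2 (powR_ge0 _ _)) -powRrM; congr (_ `^ _); ring.
have : (A r z - A r (- z)) ^+ 2 <= C ^+ 2 * (qf r z `^ (- 2)) ^+ 2.
  rewrite -exprMn -(real_normK (num_real (A r z - A r (- z)))) ler_sqr ?nnegrE //.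
  by rewrite mulr_ge0 ?powR_ge0.
rewrite /E mul1r; move: (A r z) (A r (- z)) (C ^+ 2 * _) => x y B hB.
have := sqr_ge0 y; have := sqr_ge0 (x + y); have := sqr_ge0 (x - y); lra.
Qed.

Lemma phi_sq_integrable : hp_integrable (fun r z => A r z ^+ 2).
Proof.
have h2 : 1 < (2 : R) < 8 by apply/andP; split; lra.
have := phi_weight_integrable h2.
by apply: hp_integrable_eq => r z r0; rewrite subrr powRr0 mulr1.
Qed.

Lemma phi_trace_integrable :
  (@lebesgue_measure R).-integrable setT (fun z => (A 0 z ^+ 2)%:E).
Proof.
have [C C0 hC] := phi_decay3 hF hphi.
have iC := integrableZl measurableT (C ^+ 2) (line_weight_integrable (R := R) (b := 3) ltac:(lra)).
apply: (le_integrable measurableT _ _ iC).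
  apply/measurable_EFinP; apply: continuous_measurable_fun => z.
  by apply: (@cvg_comp _ _ _ (A 0) (fun x => x ^+ 2) _ (nbhs (A 0 z)));
    [exact: c2_slicez (ev_c HA 0 z)|exact: exprn_continuous].
move=> z _; rewrite /= lee_fin ger0_norm ?sqr_ge0 // ger0_norm; last first.
  by rewrite mulr_ge0 ?sqr_ge0 ?powR_ge0.
have := hC 0 z; rewrite /qf expr0n /= addr0 => h.
have -> : (1 + z ^+ 2) `^ (- 3) = ((1 + z ^+ 2) `^ (- (3 / 2))) ^+ 2.
  rewrite -(powR_mulrn 2 (powR_ge0 _ _)) -powRrM; congr (_ `^ _); by field.
by rewrite -exprMn -(real_normK (num_real (A 0 z))) ler_sqr ?nnegrE // mulr_ge0 ?powR_ge0.
Qed.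

Let k_i (p : R) : -1 < p -> hp_integrable (fun r z => src_k F r z ^+ 2 * r `^ p).
Proof. by move=> p1; apply: fast_integrable => //; exact: fast_src_k. Qed.

Let k2_i : hp_integrable (fun r z => src_k F r z ^+ 2 * r ^+ 2).
Proof.
have := k_i (p := 2) ltac:(lra); apply: hp_integrable_eq => r z r0.
by rewrite (powR_mulrn 2) // ltW.
Qed.

Lemma phi_Q_domain (al : R) : 1 <= al -> al < 8 -> Q_domain al phi.
Proof.
move=> a1 a8; have sphi := phi_axis hphi; split => //.
  have [al1|al1] := eqVneq al 1.
    have := axis_energy_integrable (k := src_k F) HA
      (phi_equation hF hphi) phi_sq_integrable k2_i.
    apply: hp_integrable_eq => r z r0; rewrite al1 (powRr1 (ltW r0)).
    by rewrite (grad_sq_trace z sphi r0).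
  have al1' : 1 < al by rewrite lt_neqAle eq_sym al1.
  have := energy_integrable (k := src_k F) HA (fun r z _ => (fast_src_k hF).1 r z)
      (phi_equation hF hphi) (phi_weight_integrable (al := al) _) (k_i _).
  move=> h; apply: hp_integrable_eq (h _ _) => [r z r0| |].
  - by rewrite (grad_sq_trace z sphi r0).
  - by rewrite al1'.
  - lra.
case: ifPn => al1.
  have := phi_trace_integrable; apply: eq_integrable => // z _.
  by rewrite trace_f // real_normK ?num_real.
have al1' : 1 < al by rewrite lt_neqAle eq_sym al1.
have := phi_weight_integrable (al := al) ltac:(by rewrite al1').
by apply: hp_integrable_eq => r z r0; rewrite (trace_f phi z (ltW r0)).
Qed.

(** Since [Udot_src] is minus the z-derivative of [phi], [flux_identity] rewrites the response as
    the pairing of [phi] with its source, and the energy identity evaluates it. The case [al = 1]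
    needs the version with a trace, and bounds [phi F^2] by squares because [phi^2 / r] is not at
    its disposal. *)
Lemma source_pairing (al : R) : 1 <= al -> Q_domain al phi ->
  hp_integrable (fun r z => Udot_src phi r z * F r z ^+ 2 * r `^ al) /\
  hp_integral (fun r z => Udot_src phi r z * F r z ^+ 2 * r `^ al) = Q al phi.
Proof.
move=> a1 [sphi gi ti].
have Ei : hp_integrable (fun r z => (A1 r z ^+ 2 + A2 r z ^+ 2) * r `^ al).
  by apply: hp_integrable_eq gi => r z r0; rewrite (grad_sq_trace z sphi r0).
have h_i (p : R) : -1 < p -> hp_integrable (fun r z => src_h F r z ^+ 2 * r `^ p).
  by move=> p1; apply: fast_integrable => //; exact: fast_src_h.
have ch := (fast_src_h hF).1; have ck := (fast_src_k hF).1.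
have a1' : -1 < al by lra.
have fi := flux_integrable (h := src_h F) HA (fun r z _ => ch r z) Ei (h_i al a1').
have UE r z : 0 < r -> (-1) * (A2 r z * src_h F r z * r `^ al) =
    Udot_src phi r z * F r z ^+ 2 * r `^ al.
  move=> r0; rewrite /Udot_src (dz_trace z sphi (ltW r0)) (src_h_eq F z (ltW r0)).
  by rewrite !mulNr mul1r.
have ui := hp_integrableZ (-1) fi; split; first exact: hp_integrable_eq UE ui.
rewrite -(hp_integral_eq UE) hp_integralZ // mulN1r.
have grE : hp_integral (fun r z => (A1 r z ^+ 2 + A2 r z ^+ 2) * r `^ al) = energy al phi.
  by apply: hp_integral_eq => r z r0; rewrite (grad_sq_trace z sphi r0).
have dk (r z : R) : 0 < r -> is_derive z 1 (src_h F r) (src_k F r z) by move=> _; exact: src_dh.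
have [al1|al1] := eqVneq al 1.
  have qi : hp_integrable (fun r z => A r z * src_h F r z * r `^ al / r).
    have h0 := h_i 0 ltac:(lra).
    apply: hp_integrable_le (hp_integrableD phi_sq_integrable h0) _.
      move=> r z r0; have rn0 : r != 0 by rewrite gt_eqF.
      by have ? := ev_c HA r z; have ? := ch r z; c2.
    move=> r z r0; have rn0 : r != 0 by rewrite gt_eqF.
    rewrite al1 (powRr1 (ltW r0)) powRr0; move: (A r z) (src_h F r z) => x y.
    by rewrite (mulfK rn0) mulr1; have := cross_bound x y ler01; rewrite !mulr1.
  have si := axis_source_integrable (k := src_k F) HA (fun r z _ => ck r z) phi_sq_integrable k2_i.
  have sE r z : 0 < r -> src_k F r z * A r z * r = src_k F r z * A r z * r `^ al.
    by move=> r0; rewrite al1 (powRr1 (ltW r0)).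
  have si' : hp_integrable (fun r z => src_k F r z * A r z * r `^ al).
    by apply: hp_integrable_eq si.
  have fl := @flux_identity R A A1 A2 A11 A22 (src_h F) (src_k F) HA
    (fun r z _ => ch r z) (fun r z _ => ck r z) dk al Ei (h_i al a1') qi si'.
  rewrite -fl -(hp_integral_eq sE).
  rewrite (axis_energy_identity (k := src_k F) HA (fun r z _ => ck r z) (phi_equation hF hphi)
    phi_sq_integrable k2_i phi_trace_integrable).
  have E1 : hp_integral (fun r z => (A1 r z ^+ 2 + A2 r z ^+ 2) * r) = energy 1 phi.
    have -> : energy 1 phi = energy al phi by rewrite al1.
    rewrite -grE; apply: hp_integral_eq => r z r0.
    by rewrite al1 (powRr1 (ltW r0)).
  have E2 : \int[lebesgue_measure]_(z in setT) (A 0 z ^+ 2) =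
      \int[lebesgue_measure]_(z in setT) (`|phi 0 z| ^+ 2).
    by apply: eq_Rintegral => z _; rewrite (trace_f phi z (lexx 0)) (real_normK (num_real _)).
  by rewrite E1 E2 /Q al1 eqxx.
have al1' : 1 < al by rewrite lt_neqAle eq_sym al1.
rewrite (negbTE al1) in ti.
have ai : hp_integrable (fun r z => A r z ^+ 2 * r `^ (al - 2)).
  by apply: hp_integrable_eq ti => r z r0; rewrite (trace_f phi z (ltW r0)).
have ki : hp_integrable (fun r z => src_k F r z ^+ 2 * r `^ (al + 2)) by apply: k_i; lra.
have si := source_integrable (k := src_k F) HA (fun r z _ => ck r z) ai ki.
have qi := flux_density_integrable (h := src_h F) HA (fun r z _ => ch r z) (h_i al a1') ai.
have fl := @flux_identity R A A1 A2 A11 A22 (src_h F) (src_k F) HA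
  (fun r z _ => ch r z) (fun r z _ => ck r z) dk al Ei (h_i al a1') qi si.
have AE : hp_integral (fun r z => A r z ^+ 2 * r `^ (al - 2)) =
    hp_integral (fun r z => phi r z ^+ 2 * r `^ (al - 2)).
  by apply: hp_integral_eq => r z r0; rewrite (trace_f phi z (ltW r0)).
rewrite -fl (energy_identity (k := src_k F) HA (fun r z _ => ck r z)
  (phi_equation hF hphi) ai Ei ki).
by rewrite AE grE /Q (negbTE al1).
Qed.

End Decay.

(** * The quadratic forms *)

Section Forms.
Context {R : realType}.
Variables (al : R) (phi : R -> R -> R).
Hypothesis al1 : 1 < al.
Hypothesis dom : Q_domain al phi.

Notation A := (trace phi [::]).
Notation A1 := (trace phi [:: e1]).
Notation A2 := (trace phi [:: e3]).

Let W := hp_integral (fun r z => phi r z ^+ 2 * r `^ (al - 2)).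

Lemma dom_smooth : axis_compatible phi.
Proof. by case: dom. Qed.

Lemma dom_even_C2 : even_C2 A A1 A2 (trace phi [:: e1; e1]) (trace phi [:: e3; e3]).
Proof. exact: (trace_even_C2 dom_smooth). Qed.

Lemma dom_energy_integrable : hp_integrable (fun r z => (A1 r z ^+ 2 + A2 r z ^+ 2) * r `^ al).
Proof.
case: dom => _ gi _; apply: hp_integrable_eq gi => r z r0.
by rewrite (grad_sq_trace z dom_smooth r0).
Qed.

Lemma dom_weight_integrable : hp_integrable (fun r z => A r z ^+ 2 * r `^ (al - 2)).
Proof.
case: dom => _ _; rewrite gt_eqF // => ti; apply: hp_integrable_eq ti => r z r0.
by rewrite (trace_f phi z (ltW r0)).
Qed.

Lemma dom_weightE : hp_integral (fun r z => A r z ^+ 2 * r `^ (al - 2)) = W.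
Proof. by apply: hp_integral_eq => r z r0; rewrite (trace_f phi z (ltW r0)). Qed.

Lemma dom_energyE : hp_integral (fun r z => (A1 r z ^+ 2 + A2 r z ^+ 2) * r `^ al) = energy al phi.
Proof. by apply: hp_integral_eq => r z r0; rewrite (grad_sq_trace z dom_smooth r0). Qed.

Lemma Q_gt1 : Q al phi = energy al phi + (3 - al) * (al - 1) / 2 * W.
Proof. by rewrite /Q gt_eqF. Qed.

Lemma weight_ge0 : 0 <= W.
Proof. by apply: hp_integral_ge0 => r z _; exact: sqpow_ge0. Qed.

(** The cross term of the square is [2 c phi phi_r r^(al - 1)], evaluated by [hardy_identity]. The
    choice [c = (al - 1) / 2] minimises the coefficient of [W] and gives the Hardy inequality;
    [c = 2] at [al = 5] is used for the concentrating profiles. *)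
Lemma completed_square (c : R) :
  let sq r z := ((r * dr phi r z + c * phi r z) ^+ 2 + (r * dz phi r z) ^+ 2) *
    r `^ (al - 2) in
  hp_integrable sq /\
  hp_integral sq = energy al phi + (c ^+ 2 - c * (al - 1)) * W.
Proof.
have Ei := dom_energy_integrable; have ai := dom_weight_integrable.
have hi := hardy_integrable dom_even_C2 ai Ei; have hE := hardy_identity dom_even_C2 ai Ei.
rewrite dom_weightE in hE.
have hi' := hp_integrableZ (2 * c) hi; have ai' := hp_integrableZ (c ^+ 2) ai.
have sqE r z : 0 < r -> (A1 r z ^+ 2 + A2 r z ^+ 2) * r `^ al +
    ((2 * c) * (A r z * A1 r z * r `^ (al - 1)) + c ^+ 2 * (A r z ^+ 2 * r `^ (al - 2))) =
    ((r * dr phi r z + c * phi r z) ^+ 2 + (r * dz phi r z) ^+ 2) * r `^ (al - 2).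
  move=> r0; rewrite (dr_trace z dom_smooth r0) (dz_trace z dom_smooth (ltW r0)).
  rewrite -(trace_f phi z (ltW r0)).
  have [_ -> -> _] := powR_shift al r0; have rn0 : r != 0 by rewrite gt_eqF.
  by move: (A r z) (A1 r z) (A2 r z) (r `^ al) => x y w p; field.
split; first by apply: hp_integrable_eq sqE _; do 2?[apply: hp_integrableD].
rewrite -(hp_integral_eq sqE).
rewrite (hp_integralD Ei (hp_integrableD hi' ai')) (hp_integralD hi' ai').
rewrite (hp_integralZ _ hi) (hp_integralZ _ ai) dom_weightE dom_energyE.
move: hE; move: (hp_integral _) (energy _ _) W => H E w hE.
have -> : 2 * c * H = c * (2 * H) by ring.
by rewrite hE; ring.
Qed.

Lemma hardy_inequality : (al - 1) ^+ 2 / 4 * W <= energy al phi.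
Proof.
have [_] := completed_square ((al - 1) / 2); set I := hp_integral _ => IE.
have I0 : 0 <= I.
  apply: hp_integral_ge0 => r z r0.
  by rewrite mulr_ge0 ?powR_ge0 // addr_ge0 ?sqr_ge0.
rewrite IE in I0; move: I0; move: (energy al phi) W => E w I0.
have e : ((al - 1) / 2) ^+ 2 - (al - 1) / 2 * (al - 1) = - ((al - 1) ^+ 2 / 4) by field.
by rewrite e in I0; lra.
Qed.

Lemma energy_ge0 : 0 <= energy al phi.
Proof.
rewrite -dom_energyE; apply: hp_integral_ge0 => r z _.
by rewrite mulr_ge0 ?addr_ge0 ?sqr_ge0 ?powR_ge0.
Qed.

Lemma Q_ge_energy : al <= 3 -> energy al phi <= Q al phi.
Proof.
move=> a3; rewrite Q_gt1 lerDl; apply: mulr_ge0 weight_ge0.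
by rewrite divr_ge0 ?mulr_ge0 ?subr_ge0 ?(ltW al1).
Qed.

(** For [al > 3] the zero-order coefficient is negative, so [W] is replaced by its Hardy bound: [1 -
    2 (al - 3) / (al - 1) = (5 - al) / (al - 1)]. The difference of the two sides is
    [2 (al - 3) / (al - 1)] times the Hardy deficit. *)
Lemma Q_ge_gap : 3 < al -> (5 - al) / (al - 1) * energy al phi <= Q al phi.
Proof.
move=> a3; rewrite Q_gt1; have := hardy_inequality; have := weight_ge0.
move: (energy al phi) W => E w w0 hE.
have a10 : 0 < al - 1 by lra.
rewrite -subr_ge0.
have -> : E + (3 - al) * (al - 1) / 2 * w - (5 - al) / (al - 1) * E =
   2 * (al - 3) / (al - 1) * (E - (al - 1) ^+ 2 / 4 * w) by field; rewrite gt_eqF.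
rewrite mulr_ge0 ?subr_ge0 // divr_ge0 ?(ltW a10) // mulr_ge0 //; lra.
Qed.

Lemma Q_ge0_gt1 : al <= 5 -> 0 <= Q al phi.
Proof.
move=> a5; have [a3|a3] := leP al 3.
  exact: le_trans energy_ge0 (Q_ge_energy a3).
apply: le_trans (Q_ge_gap a3); rewrite mulr_ge0 ?energy_ge0 // divr_ge0; lra.
Qed.

End Forms.

Section FormsAll.
Context {R : realType}.

Lemma Q_ge0 (al : R) (phi : R -> R -> R) : 1 <= al <= 5 -> Q_domain al phi -> 0 <= Q al phi.
Proof.
move=> /andP[a1 a5] dom; have [al1|al1] := eqVneq al 1; last first.
  by apply: Q_ge0_gt1 => //; rewrite lt_neqAle eq_sym al1.
rewrite /Q al1 eqxx addr_ge0 //.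
  by apply: hp_integral_ge0 => r z _; rewrite mulr_ge0 ?powR_ge0 // /grad_sq addr_ge0 ?sqr_ge0.
by apply: Rintegral_ge0 => z _; exact: sqr_ge0.
Qed.

End FormsAll.

(** * Failure of the gradient gap at the exponent 5 *)

Section RationalFunctions.
Context {R : realType} {V : normedModType R}.

(** [smooth] quantifies over all lists of directions. A class of differentiable functions closed
    under every ['D_v] consists of smooth functions by induction on the list; sums, products and
    inverses of nowhere vanishing functions suffice for the test profiles. *)
Inductive rational : (V -> R) -> Prop :=
| rational_cst c : rational (fun _ => c)
| rational_lin (l : {linear V -> R}) : continuous l -> rational l
| rational_add f g : rational f -> rational g -> rational (fun x => f x + g x)
| rational_mul f g : rational f -> rational g -> rational (fun x => f x * g x)
| rational_inv f : rational f -> (forall x, f x != 0) -> rational (fun x => (f x)^-1).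

Lemma rational_differentiable f : rational f -> forall x, differentiable f x.
Proof.
elim=> {f} [c|l cl|f g _ df _ dg|f g _ df _ dg|f _ df f0] x.
- exact: differentiable_cst.
- exact: linear_differentiable.
- exact: differentiableD (df x) (dg x).
- exact: differentiableM (df x) (dg x).
- exact: (differentiableV (df x) (f0 x)).
Qed.

Lemma rational_derive f : rational f -> forall v, rational ('D_v f).
Proof.
elim=> {f} [c|l cl|f g rf df rg dg|f g rf df rg dg|f rf df f0] v.
- have -> : 'D_v (fun _ : V => c) = fun _ => 0 by apply/funext => x; exact: derive_cst.
  exact: rational_cst.
- have -> : 'D_v l = fun _ => l v.
    apply/funext => x; rewrite deriveE; last exact: linear_differentiable.
    by rewrite diff_lin.
  exact: rational_cst.
- have -> : 'D_v (fun x => f x + g x) = fun x => 'D_v f x + 'D_v g x.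
    apply/funext => x; apply: deriveD; exact/diff_derivable/rational_differentiable.
  by apply: rational_add.
- have -> : 'D_v (fun x => f x * g x) = fun x => f x * 'D_v g x + g x * 'D_v f x.
    apply/funext => x; apply: deriveM; exact/diff_derivable/rational_differentiable.
  by apply: rational_add; apply: rational_mul.
- have -> : 'D_v (fun x => (f x)^-1) = fun x => (-1 * ((f x)^-1 * (f x)^-1)) * 'D_v f x.
    apply/funext => x; rewrite (deriveV (f0 x)); last exact/diff_derivable/rational_differentiable.
    by rewrite /GRing.scale /= mulN1r expr2 invfM.
  apply: rational_mul => //; apply: rational_mul; first exact: rational_cst.
  by apply: rational_mul; exact: rational_inv.
Qed.

Lemma rational_smooth f : rational f -> smooth f.
Proof.
move=> rf vs x; apply: rational_differentiable.
by elim: vs => //= v vs ih; exact: rational_derive.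
Qed.

End RationalFunctions.

Section RationalCoordinates.
Context {R : realType}.
Local Notation V := (R * R * R)%type.

Lemma rational_x : rational (fun p : V => p.1.1).
Proof.
apply: (@rational_lin _ _ ((fst : {linear (R * R)%type -> R}) \o
  (fst : {linear V -> (R * R)%type}) : {linear V -> R})).
by move=> p; apply: (cvg_comp _ _ cvg_fst); exact: cvg_fst.
Qed.

Lemma rational_y : rational (fun p : V => p.1.2).
Proof.
apply: (@rational_lin _ _ ((snd : {linear (R * R)%type -> R}) \o
  (fst : {linear V -> (R * R)%type}) : {linear V -> R})).
by move=> p; apply: (cvg_comp _ _ cvg_fst); exact: cvg_snd.
Qed.

Lemma rational_z : rational (fun p : V => p.2).
Proof.
apply: (@rational_lin _ _ (snd : {linear V -> R})).
by move=> p; exact: cvg_snd.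
Qed.

(* [fprof] is the extremal [r^-2] of the Hardy inequality at the exponent 5,
   truncated at the radii 1 and [sqrt N]. *)
Definition fprof (N r : R) := (1 + r ^+ 2)^-1 - (N + r ^+ 2)^-1.
Definition gprof (d z : R) := (1 + d ^+ 2 * z ^+ 2)^-1.
Definition profile (N d r z : R) := fprof N r * gprof d z.

Lemma profile_axis_compatible N d : 1 <= N -> axis_compatible (profile N d).
Proof.
move=> N1; rewrite /axis_compatible.
suff -> : axisym (profile N d) = fun p : V =>
    ((1 + (p.1.1 * p.1.1 + p.1.2 * p.1.2))^-1 +
     -1 * (N + (p.1.1 * p.1.1 + p.1.2 * p.1.2))^-1) * (1 + (d * d) * (p.2 * p.2))^-1.
  have rx := rational_x; have ry := rational_y; have rz := rational_z.
  have rho : rational (fun p : V => p.1.1 * p.1.1 + p.1.2 * p.1.2).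
    by apply: rational_add; exact: rational_mul.
  have rho0 (p : V) : 0 <= p.1.1 * p.1.1 + p.1.2 * p.1.2.
    by rewrite addr_ge0 // -expr2 sqr_ge0.
  apply: rational_smooth; apply: rational_mul.
    apply: rational_add; last (apply: rational_mul; first exact: rational_cst).
      apply: rational_inv; first by apply: rational_add => //; exact: rational_cst.
      by move=> p; rewrite gt_eqF // ltr_pwDl.
    apply: rational_inv; first by apply: rational_add => //; exact: rational_cst.
    by move=> p; rewrite gt_eqF // ltr_pwDl // (lt_le_trans ltr01).
  apply: rational_inv.
    apply: rational_add; first exact: rational_cst.
    by apply: rational_mul; [exact: rational_cst|exact: rational_mul].
  by move=> p; rewrite gt_eqF // ltr_pwDl // -!expr2 mulr_ge0 ?sqr_ge0.
apply/funext => p; rewrite /axisym /profile /fprof /gprof sqr_sqrtr ?addr_ge0 ?sqr_ge0 //.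
by rewrite !expr2 mulN1r.
Qed.

End RationalCoordinates.

(** * Estimates on the truncated and stretched extremal *)

Section Concentration.
Context {R : realType}.
Notation leb := (@lebesgue_measure R).
Implicit Types r z : R.

(** A bump at radius of order [sqrt a], scaled so that its integral is at most [1/4] whatever [a]
    is: its antiderivative is [(r^2 / (a + r^2))^2 / 4]. The cases [a = 1] and [a = N] measure the
    cost of the two truncations. *)
Definition bump (a r : R) := a * r ^+ 3 / (a + r ^+ 2) ^+ 3.

Lemma bump_continuous (a r : R) : 0 < a -> {for r, continuous (bump a)}.
Proof.
move=> a0; have p : 0 < a + r ^+ 2 by have := sqr_ge0 r; lra.
have p3 : (a + r ^+ 2) ^+ 3 != 0 by rewrite expf_neq0 // gt_eqF.
have : exists c, is_derive r 1 (bump a) c by rewrite /bump; eexists; der.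
by move=> [c /der_cont].
Qed.

Lemma bump_ge0 (a r : R) : 0 < a -> 0 < r -> 0 <= bump a r.
Proof.
move=> a0 r0; have p : 0 <= a + r ^+ 2 by have := sqr_ge0 r; lra.
by rewrite /bump divr_ge0 // ?exprn_ge0 // mulr_ge0 ?exprn_ge0 // ltW.
Qed.

Lemma bump_integral_le (a : R) : 0 < a -> (\int[leb]_(r in ray) (bump a r)%:E <= (4^-1)%:E)%E.
Proof.
move=> a0; apply: (ray_integral_le (H := fun r => (r ^+ 2 / (a + r ^+ 2)) ^+ 2 / 4)) => r r0.
- have p : a + r ^+ 2 != 0 by rewrite gt_eqF //; have := sqr_ge0 r; lra.
  by eapply derE; [der|rewrite /bump; field].
- exact: bump_continuous.
- exact: bump_ge0.
- have p : 0 < a + r ^+ 2 by have := sqr_ge0 r; lra.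
  have q0 : 0 <= r ^+ 2 / (a + r ^+ 2) by rewrite divr_ge0 ?sqr_ge0 // ltW.
  have q1 : r ^+ 2 / (a + r ^+ 2) <= 1 by rewrite ler_pdivrMr //; lra.
  by apply/andP; split; nra.
Qed.

Lemma bump_integrable (a : R) : 0 < a -> leb.-integrable ray (fun r => (bump a r)%:E).
Proof.
move=> a0; apply: ray_integrable (bump_integral_le a0) => r r0.
- exact: bump_continuous.
- exact: bump_ge0.
Qed.

Lemma bump_Rintegral_le (a : R) : 0 < a -> \int[leb]_(r in ray) bump a r <= 4^-1.
Proof.
move=> a0; rewrite /Rintegral -lee_fin fineK; first exact: bump_integral_le.
by apply: (integrable_fin_num _ (bump_integrable a0)); exact: measurable_ray.
Qed.

Variable s : R.
Hypothesis s2 : 2 <= s.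
(** The outer truncation radius [sqrt N] is [s] itself. The stretching rate [d = 1 / N] gives
    [d^2 N^2 = 1], which makes the contribution of the z-derivative bounded independently of [s]. *)
Let N : R := s ^+ 2.
Let d : R := N^-1.

Let N4 : 4 <= N. Proof.
rewrite /N -subr_ge0; have -> : s ^+ 2 - 4 = (s - 2) * (s + 2) by ring.
by rewrite mulr_ge0 //; move: s2; lra.
Qed.
Let N0 : 0 < N. Proof. exact: lt_le_trans N4. Qed.
Let d0 : 0 < d. Proof. by rewrite invr_gt0. Qed.
Let dN : d * N = 1. Proof. by rewrite mulVf // gt_eqF. Qed.

Let w (z : R) := gprof d z ^+ 2.

Let gpos z : 0 < 1 + d ^+ 2 * z ^+ 2.
Proof. by rewrite ltr_pwDl // mulr_ge0 ?sqr_ge0. Qed.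

Let g0 z : 0 < gprof d z. Proof. by rewrite invr_gt0. Qed.
Let w0 z : 0 <= w z. Proof. exact: sqr_ge0. Qed.

Let wcont z : {for z, continuous w}.
Proof.
have p := gpos z; have p0 : 1 + d ^+ 2 * z ^+ 2 != 0 by rewrite gt_eqF.
have : exists c, is_derive z 1 w c by rewrite /w /gprof; eexists; der.
by move=> [c /der_cont].
Qed.

Let wi : leb.-integrable setT (fun z => (w z)%:E).
Proof.
have h := integrableZl measurableT (N ^+ 2) (@line_weight_integrable R 1 ltac:(lra)).
apply: le_integrable h => //.
  by apply/measurable_EFinP; apply: continuous_measurable_fun => z; exact: wcont.
move=> z _ /=; rewrite lee_fin (ger0_norm (w0 z)) ger0_norm; last first.
  by apply: mulr_ge0; [exact: sqr_ge0|exact: powR_ge0].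
have p := gpos z; have q : 0 < 1 + z ^+ 2 by have := sqr_ge0 z; lra.
rewrite powR_inv1 ?(ltW q) //.
have g1 : gprof d z <= 1.
  by rewrite invf_le1 // lerDl mulr_ge0 ?sqr_ge0.
apply: (@le_trans _ _ (gprof d z)); first by rewrite /w; have := g0 z; nra.
rewrite /gprof -[leLHS]mul1r ler_pdivrMr // mulrAC ler_pdivlMr // mul1r.
have -> : N ^+ 2 * (1 + d ^+ 2 * z ^+ 2) = N ^+ 2 + (d * N) ^+ 2 * z ^+ 2 by ring.
rewrite dN expr1n mul1r lerD2r exprn_ege1 //; by move: N4; lra.
Qed.

Let Iv : R := \int[leb]_(z in setT) w z.

Let Iv0 : 0 < Iv.
Proof.
rewrite /Iv /Rintegral fine_gt0 //; apply/andP; split; last first.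
  have := integrable_fin_num measurableT wi; rewrite ge0_fin_numE //.
  by apply: integral_ge0 => z _; rewrite lee_fin.
apply: (@lt_le_trans _ _ (\int[leb]_(z in `[0%R, 1%R]) (4^-1)%:E)%E).
  by rewrite integral_cst //= lebesgue_measure_itv /= lte_fin ltr01 oppr0 adde0 mule1 lte_fin.
apply: (@le_trans _ _ (\int[leb]_(z in `[0%R, 1%R]) (w z)%:E)%E).
  apply: ge0_le_integral => //.
  - by apply/measurable_EFinP; apply: measurable_funTS; apply: continuous_measurable_fun => z; exact: wcont.
  - move=> z; rewrite /= in_itv /= => /andP[z0 z1]; rewrite lee_fin /w /gprof exprVn.
    rewrite lef_pV2 ?posrE ?exprn_gt0 //.
    have d1 : d <= 1 by rewrite invf_le1 //; move: N4; lra.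
    have h : (d * z) ^+ 2 <= 1.
      by rewrite expr_le1 // ?mulr_ge0 ?(ltW d0) // mulr_ile1 ?(ltW d0).
    move: h; rewrite exprMn; have : 0 <= d ^+ 2 * z ^+ 2 by rewrite mulr_ge0 ?sqr_ge0.
    by move: (d ^+ 2 * _) => x x0 x1; nra.
apply: ge0_subset_integral => //.
by apply/measurable_EFinP; apply: continuous_measurable_fun => z; exact: wcont.
by move=> z _; rewrite lee_fin.
Qed.

Let f := fprof N.

Let pos (a r : R) : 0 < a -> 0 < a + r ^+ 2.
Proof. by move=> a0; rewrite ltr_pwDl ?sqr_ge0. Qed.

Let fE r : f r = (N - 1) / ((1 + r ^+ 2) * (N + r ^+ 2)).
Proof. by rewrite /f /fprof; field; rewrite !gt_eqF ?pos. Qed.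

Let f_ge0 r : 0 <= f r.
Proof. by rewrite fE divr_ge0 ?subr_ge0 ?mulr_ge0 ?(ltW (pos _ _)) //; move: N4; lra. Qed.

Let f_cont2 r z : cont2 (fun r _ : R => f r) r z.
Proof.
have p1 : 1 + r ^+ 2 != 0 by rewrite gt_eqF ?pos.
have pN : N + r ^+ 2 != 0 by rewrite gt_eqF ?pos.
by rewrite /f /fprof; c2.
Qed.

Let inv1 r : [/\ 0 < (1 + r ^+ 2)^-1, (1 + r ^+ 2)^-1 <= 1 & r ^+ 2 * (1 + r ^+ 2)^-1 <= 1].
Proof.
have p := pos r (@ltr01 R); split; first by rewrite invr_gt0.
  by rewrite invf_le1 // lerDl sqr_ge0.
by rewrite ler_pdivrMr // mul1r lerDr.
Qed.

Let f_sq_le r : f r ^+ 2 <= N ^+ 2 * (1 + r ^+ 2)^-1 ^+ 4.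
Proof.
have -> : N ^+ 2 * (1 + r ^+ 2)^-1 ^+ 4 = (N * ((1 + r ^+ 2)^-1 * (1 + r ^+ 2)^-1)) ^+ 2 by ring.
have [a0 _ _] := inv1 r; have ba : (N + r ^+ 2)^-1 <= (1 + r ^+ 2)^-1.
  by rewrite lef_pV2 ?posrE ?pos // lerD2r; move: N4; lra.
rewrite ler_pXn2r ?nnegrE ?f_ge0 //; last first.
  by apply: mulr_ge0; [exact: ltW|apply: mulr_ge0; exact: ltW].
rewrite fE invfM; apply: ler_pM.
- by move: N4; lra.
- by rewrite mulr_ge0 ?(ltW a0) // invr_ge0 ltW ?pos.
- by rewrite gerBl.
- by rewrite ler_pM2l.
Qed.

Let fr_le r : 0 < r -> f r ^+ 2 * r ^+ 3 <= N ^+ 2 * bump 1 r.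
Proof.
move=> r0; have r3 : 0 <= r ^+ 3 by rewrite exprn_ge0 // ltW.
apply: le_trans (ler_wpM2r r3 (f_sq_le r)) _; rewrite /bump -exprVn mul1r -mulrA.
have [] := inv1 r; move: (_^-1) => a a0 a1 ra; apply: ler_wpM2l; first exact: sqr_ge0.
rewrite mulrC ler_wpM2l // -[leRHS]mul1r exprS ler_wpM2r // exprn_ge0 // ltW //.
Qed.

Let fr5_le r : 0 < r -> f r ^+ 2 * r ^+ 5 <= N ^+ 2 * bump 1 r.
Proof.
move=> r0; have r5 : 0 <= r ^+ 5 by rewrite exprn_ge0 // ltW.
apply: le_trans (ler_wpM2r r5 (f_sq_le r)) _; rewrite /bump -exprVn mul1r -mulrA.
have [] := inv1 r; move: (_^-1) => a a0 a1 ra; apply: ler_wpM2l; first exact: sqr_ge0.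
have -> : a ^+ 4 * r ^+ 5 = (r ^+ 2 * a) * (r ^+ 3 * a ^+ 3) by ring.
by rewrite -[leRHS]mul1r ler_wpM2r // mulr_ge0 // exprn_ge0 // ltW.
Qed.

Let u3 r := f r ^+ 2 * r ^+ 3.

Let u3_ge0 r : 0 < r -> 0 <= u3 r.
Proof. by move=> r0; rewrite mulr_ge0 ?sqr_ge0 // exprn_ge0 // ltW. Qed.

Let u3_cont r : {for r, continuous u3}.
Proof. by have cf := @f_cont2 r 0; apply: (@c2_slicer _ (fun r _ => u3 r) r 0); rewrite /u3; c2. Qed.

Let u3i : leb.-integrable ray (fun r => (u3 r)%:E).
Proof.
have h := integrableZl (@measurable_ray R) (N ^+ 2) (bump_integrable (@ltr01 R)).
apply: le_integrable h => //; first exact: measurable_ray.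
  by apply/measurable_EFinP; apply: ray_measurable => r _; exact: u3_cont.
move=> r; rewrite /ray /= in_itv /= andbT => r0; rewrite lee_fin ger0_norm ?u3_ge0 //.
by apply: le_trans (fr_le r0) _; exact: ler_norm.
Qed.

(* On [1, s] one has [f r >= 1 / (8 r^2)]. *)
Let f_mass : ln s / 64 <= \int[leb]_(r in ray) u3 r.
Proof.
have s1 : 1 < s by move: s2; lra.
have mu : measurable_fun ray (fun r => (u3 r)%:E).
  by apply/measurable_EFinP; apply: ray_measurable => r _; exact: u3_cont.
have sub : (`[1%R, s]%classic : set (measurableTypeR R)) `<=` ray.
  by move=> r; rewrite /ray /= !in_itv /= andbT => /andP[r1 _]; lra.
rewrite /Rintegral -lee_fin fineK; last first.
  by apply: (integrable_fin_num _ u3i); exact: measurable_ray.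
have dl r : 1 <= r <= s -> is_derive r 1 (fun r => ln r / 64) (64^-1 / r).
  move=> /andP[r1 _]; have r0 : 0 < r by lra.
  have dln := is_derive1_ln r0.
  by apply: (derE (derM dln (der_cst 64^-1 r))); rewrite mulr0 addr0 mulrC.
have cl r : 1 <= r <= s -> {for r, continuous (fun r : R => 64^-1 / r)}.
  move=> /andP[r1 _]; have r0 : r != 0 by rewrite gt_eqF //; lra.
  have : exists c, is_derive r 1 (fun r : R => 64^-1 / r) c by eexists; der.
  by move=> [c /der_cont].
have := FTC_segment s1 dl cl; rewrite ln1 mul0r subr0 => <-.
apply: (@le_trans _ _ (\int[leb]_(r in `[1%R, s]) (u3 r)%:E)%E); last first.
  apply: ge0_subset_integral => //; first exact: measurable_ray.
  by move=> r; rewrite /ray /= in_itv /= andbT => r0; rewrite lee_fin u3_ge0.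
apply: ge0_le_integral => //.
- move=> r; rewrite /= in_itv /= => /andP[r1 _]; rewrite lee_fin divr_ge0 //; lra.
- apply/measurable_EFinP; apply: subspace_continuous_measurable_fun => //.
  by apply: continuous_in_subspaceT => r /set_mem /=; rewrite in_itv /=; exact: cl.
- exact: (measurable_funS (@measurable_ray R) sub mu).
- move=> r; rewrite /= in_itv /= => /andP[r1 rs]; rewrite lee_fin /u3.
  have r0 : 0 < r by lra.
  have rN : r ^+ 2 <= N by rewrite /N ler_pXn2r ?nnegrE //; lra.
  have f8 : 8^-1 / r ^+ 2 <= f r.
    have x1 : 1 <= r ^+ 2 by rewrite exprn_ege1.
    rewrite fE; move: (r ^+ 2) x1 rN N4 => x x1; move: (N) => n xn n4.
    have -> : 8^-1 / x = ((1 + x) * (n + x)) / (8 * x) / ((1 + x) * (n + x)).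
      by field; rewrite !gt_eqF //; lra.
    rewrite ler_wpM2r ?invr_ge0 ?mulr_ge0 //; try lra.
    rewrite ler_pdivrMr; last lra.
    have h1 : 0 <= (x - 1) * (n - x) by rewrite mulr_ge0; lra.
    have h2 : 0 <= (x - 1) * (n - 4) by rewrite mulr_ge0; lra.
    nra.
  have -> : 64^-1 / r = (8^-1 / r ^+ 2) ^+ 2 * r ^+ 3 by field; rewrite gt_eqF.
  rewrite ler_wpM2r ?exprn_ge0 ?(ltW r0) // ler_pXn2r ?nnegrE ?f_ge0 //.
  by rewrite divr_ge0 ?sqr_ge0 // invr_ge0.
Qed.

Let p r z := profile N d r z.

Let drE r z : dr p r z = 2 * r * ((N + r ^+ 2)^-1 ^+ 2 - (1 + r ^+ 2)^-1 ^+ 2) * gprof d z.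
Proof.
have p1 : 1 + r ^+ 2 != 0 by rewrite gt_eqF ?pos.
have pN : N + r ^+ 2 != 0 by rewrite gt_eqF ?pos.
apply: der_derive1; rewrite /p /profile /fprof; eapply derE; first by der.
by move: (gprof d z) (N) pN => g n pN; field; rewrite p1 pN.
Qed.

Let dzE r z : dz p r z = - (f r * (2 * d * (d * z) * gprof d z ^+ 2)).
Proof.
have pz : 1 + d ^+ 2 * z ^+ 2 != 0 by rewrite gt_eqF ?gpos.
apply: der_derive1; rewrite /p /profile -/f /gprof; eapply derE; first by der.
by move: (f r) pz => x; move: (d) => e pz; field; rewrite exprMn.
Qed.

Let dz_le r z : dz p r z ^+ 2 <= d ^+ 2 * (f r ^+ 2 * w z).
Proof.
rewrite dzE sqrrN; have h : (2 * (d * z) * gprof d z) ^+ 2 <= 1.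
  have := gpos z; rewrite /gprof -exprMn; move: (d * z) => x q.
  rewrite expr_div_n ler_pdivrMr ?exprn_gt0 // mul1r -subr_ge0.
  have -> : (1 + x ^+ 2) ^+ 2 - (2 * x) ^+ 2 = (1 - x ^+ 2) ^+ 2 by ring.
  exact: sqr_ge0.
have -> : (f r * (2 * d * (d * z) * gprof d z ^+ 2)) ^+ 2 =
  (2 * (d * z) * gprof d z) ^+ 2 * (d ^+ 2 * (f r ^+ 2 * w z)) by rewrite /w; ring.
rewrite -[leRHS]mul1r ler_wpM2r //.
by apply: mulr_ge0; rewrite ?sqr_ge0 // mulr_ge0 ?sqr_ge0.
Qed.

Let B r z := bump 1 r * w z.

Let bump_w_integrable (a : R) : 0 < a -> hp_integrable (fun r z => bump a r * w z).
Proof.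
move=> a0; apply: product_integrable => //.
- by move=> r _; exact: bump_continuous.
- by move=> r; exact: bump_ge0.
- exact: bump_integrable.
Qed.

Let bump_w_integral (a : R) : 0 < a -> hp_integral (fun r z => bump a r * w z) <= 4^-1 * Iv.
Proof.
move=> a0; rewrite product_integral //.
- by rewrite ler_wpM2r ?(ltW Iv0) ?bump_Rintegral_le.
- by move=> r _; exact: bump_continuous.
- by move=> r; exact: bump_ge0.
- exact: bump_integrable.
Qed.

Let dz5_le r z : 0 < r -> (r * dz p r z) ^+ 2 * r ^+ 3 <= B r z.
Proof.
move=> r0; have r5 : 0 <= r ^+ 5 by rewrite exprn_ge0 // ltW.
have -> : (r * dz p r z) ^+ 2 * r ^+ 3 = dz p r z ^+ 2 * r ^+ 5 by ring.
apply: le_trans (ler_wpM2r r5 (dz_le r z)) _.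
have -> : d ^+ 2 * (f r ^+ 2 * w z) * r ^+ 5 = d ^+ 2 * (f r ^+ 2 * r ^+ 5) * w z by ring.
rewrite ler_wpM2r //; apply: le_trans (ler_wpM2l (sqr_ge0 d) (fr5_le r0)) _.
by rewrite mulrA -exprMn dN expr1n mul1r.
Qed.

(** A crude bound whose factor [N^2] is harmless: it serves only to show that the energy is finite.
    The estimate uniform in [s] is [square_le]. *)
Let dr5_le r z : 0 < r -> (r * dr p r z) ^+ 2 * r ^+ 3 <= 16 * N ^+ 2 * B r z.
Proof.
move=> r0; have r3 : 0 <= r ^+ 3 by rewrite exprn_ge0 // ltW.
have -> : 16 * N ^+ 2 * B r z = N ^+ 2 * bump 1 r * (16 * w z) by rewrite /B; ring.
have h : 0 <= 16 * w z by rewrite mulr_ge0.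
apply: le_trans (ler_wpM2r h (fr_le r0)); rewrite [leRHS]mulrAC ler_wpM2r // drE /f /fprof /w.
have pN : 0 < N + r ^+ 2 by rewrite pos.
have ra : r ^+ 2 * (1 + r ^+ 2)^-1 <= 1 by have [] := inv1 r.
have rb : r ^+ 2 * (N + r ^+ 2)^-1 <= 1.
  by rewrite ler_pdivrMr // mul1r lerDr ltW.
have ra0 : 0 <= r ^+ 2 * (1 + r ^+ 2)^-1 by rewrite mulr_ge0 ?sqr_ge0 // invr_ge0 ltW ?pos.
have rb0 : 0 <= r ^+ 2 * (N + r ^+ 2)^-1 by rewrite mulr_ge0 ?sqr_ge0 // invr_ge0 ltW.
move: (gprof d z) ((1 + r ^+ 2)^-1) ((N + r ^+ 2)^-1) ra rb ra0 rb0 => g a b ra rb ra0 rb0.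
have -> : (r * (2 * r * (b ^+ 2 - a ^+ 2) * g)) ^+ 2 =
  (2 * (r ^+ 2 * a + r ^+ 2 * b)) ^+ 2 * ((a - b) ^+ 2 * g ^+ 2) by ring.
have -> : (a - b) ^+ 2 * (16 * g ^+ 2) = 16 * ((a - b) ^+ 2 * g ^+ 2) by ring.
rewrite ler_wpM2r //; first by rewrite mulr_ge0 ?sqr_ge0.
by move: (r ^+ 2 * a) (r ^+ 2 * b) ra rb ra0 rb0 => x y *; nra.
Qed.

(** The function [r^(-2)] is annihilated by [r d/dr + 2], so only the truncations remain. With
    [a = 1 / (1 + r^2)] and [b = 1 / (N + r^2)], the relations [r^2 a = 1 - a] and [r^2 b = 1 - N b]
    reduce the radial factor to [2 (a^2 - N b^2)], dominated by the bumps at radii 1 and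
    [sqrt N]. *)
Let square_le r z : 0 < r -> (r * dr p r z + 2 * p r z) ^+ 2 * r ^+ 3 <=
  8 * (bump 1 r * w z) + 8 * (bump N r * w z).
Proof.
move=> r0; rewrite drE /p /profile /fprof /w /bump -!exprVn.
have [a0 a1 _] := inv1 r; have pN : 0 < N + r ^+ 2 by rewrite pos.
have b0 : 0 < (N + r ^+ 2)^-1 by rewrite invr_gt0.
have b1 : N * (N + r ^+ 2)^-1 <= 1 by rewrite ler_pdivrMr // mul1r lerDl sqr_ge0.
have r3 : 0 <= r ^+ 3 by rewrite exprn_ge0 // ltW.
have ea : r ^+ 2 * (1 + r ^+ 2)^-1 = 1 - (1 + r ^+ 2)^-1 by field; rewrite gt_eqF ?pos.
have eb : r ^+ 2 * (N + r ^+ 2)^-1 = 1 - N * (N + r ^+ 2)^-1 by field; rewrite gt_eqF.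
have eab : (1 + r ^+ 2)^-1 - (N + r ^+ 2)^-1 =
    (N - 1) * ((1 + r ^+ 2)^-1 * (N + r ^+ 2)^-1) by field; rewrite !gt_eqF ?pos.
move: ((1 + r ^+ 2)^-1) ((N + r ^+ 2)^-1) a0 a1 b0 b1 ea eb eab => a b a0 a1 b0 b1 ea eb eab.
move: (gprof d z) (N) N0 b1 eb eab => g n n0 b1 eb eab.
have -> : r * (2 * r * (b ^+ 2 - a ^+ 2) * g) + 2 * ((a - b) * g) = 2 * g * (a ^+ 2 - n * b ^+ 2).
  have -> : r * (2 * r * (b ^+ 2 - a ^+ 2) * g) = 2 * g * ((r ^+ 2 * b) * b - (r ^+ 2 * a) * a) by ring.
  by rewrite ea eb; ring.
have -> : 8 * (1 * r ^+ 3 * a ^+ 3 * g ^+ 2) + 8 * (n * r ^+ 3 * b ^+ 3 * g ^+ 2) =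
   8 * g ^+ 2 * (a ^+ 3 + n * b ^+ 3) * r ^+ 3 by ring.
rewrite ler_wpM2r //.
have -> : (2 * g * (a ^+ 2 - n * b ^+ 2)) ^+ 2 = 8 * g ^+ 2 * ((a ^+ 2 - n * b ^+ 2) ^+ 2 / 2) by field.
apply: ler_wpM2l; first by rewrite mulr_ge0 ?sqr_ge0.
have h1 : a ^+ 4 <= a ^+ 3 by rewrite exprS ler_piMl // exprn_ge0 // ltW.
have h2 : n ^+ 2 * b ^+ 4 <= n * b ^+ 3.
  have -> : n ^+ 2 * b ^+ 4 = (n * b) * (n * b ^+ 3) by ring.
  by rewrite ler_piMl // mulr_ge0 ?(ltW n0) // exprn_ge0 // ltW.
have h3 := sqr_ge0 (a ^+ 2 + n * b ^+ 2).
have e1 : (a ^+ 2 - n * b ^+ 2) ^+ 2 / 2 =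
   a ^+ 4 + n ^+ 2 * b ^+ 4 - (a ^+ 2 + n * b ^+ 2) ^+ 2 / 2 by field.
by rewrite e1; move: h1 h2 h3; move: (_ ^+ 2) => y h1 h2 h3; lra.
Qed.

Let pow5 r : 0 < r -> r `^ 5 = r ^+ 5.
Proof. by move=> r0; rewrite (powR_mulrn 5 (ltW r0)). Qed.

Let pow3 r : 0 < r -> r `^ (5 - 2) = r ^+ 3.
Proof.
move=> r0; have -> : 5 - 2 = 3%:R :> R by ring.
by rewrite (powR_mulrn 3 (ltW r0)).
Qed.

Let p_sqE r z : 0 < r -> u3 r * w z = p r z ^+ 2 * r `^ (5 - 2).
Proof. by move=> r0; rewrite pow3 // /u3 /w /p /profile -/f; ring. Qed.

Let u3w_integrable : hp_integrable (fun r z => u3 r * w z).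
Proof. by apply: product_integrable. Qed.

Let g_cont2 r z : cont2 (fun _ z => gprof d z) r z.
Proof.
have pz : 1 + d ^+ 2 * z ^+ 2 != 0 by rewrite gt_eqF ?gpos.
by rewrite /gprof; c2.
Qed.

Let grad_integrable : hp_integrable (fun r z => grad_sq p r z * r `^ 5).
Proof.
pose D1 r z := 2 * r * ((N + r ^+ 2)^-1 ^+ 2 - (1 + r ^+ 2)^-1 ^+ 2) * gprof d z.
pose D2 r z := - (f r * (2 * d * (d * z) * gprof d z ^+ 2)).
apply: (@hp_integrable_eq _ (fun r z => (D1 r z ^+ 2 + D2 r z ^+ 2) * r ^+ 5)).
  by move=> r z r0; rewrite /grad_sq drE dzE pow5.
have b1 := bump_w_integrable (@ltr01 R).
apply: hp_integrable_le (hp_integrableD (hp_integrableZ (16 * N ^+ 2) b1) b1) _.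
  move=> r z r0; have p1 : 1 + r ^+ 2 != 0 by rewrite gt_eqF ?pos.
  have pN : N + r ^+ 2 != 0 by rewrite gt_eqF ?pos.
  have cf := @f_cont2 r z; have cg := @g_cont2 r z.
  by rewrite /D1 /D2; c2.
move=> r z r0; have r5 : 0 <= r ^+ 5 by rewrite exprn_ge0 // ltW.
rewrite ger0_norm; last by rewrite mulr_ge0 // addr_ge0 ?sqr_ge0.
have := dr5_le z r0; have := dz5_le z r0; rewrite drE dzE -/(D1 r z) -/(D2 r z) -/(B r z).
have -> : (D1 r z ^+ 2 + D2 r z ^+ 2) * r ^+ 5 =
   (r * D1 r z) ^+ 2 * r ^+ 3 + (r * D2 r z) ^+ 2 * r ^+ 3 by ring.
by move=> h1 h2; exact: lerD.
Qed.

Let profile_dom : Q_domain 5 p.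
Proof.
split; first by apply: profile_axis_compatible; move: N4; lra.
  exact: grad_integrable.
have -> : (5 == 1 :> R) = false by apply/negbTE; rewrite gt_eqF //; lra.
exact: hp_integrable_eq p_sqE u3w_integrable.
Qed.

Let five1 : 1 < 5 :> R. Proof. lra. Qed.

Let profile_Q : Q 5 p <= 5 * Iv.
Proof.
have [si sE] := completed_square five1 profile_dom 2.
have b1 := bump_w_integrable (@ltr01 R); have bN := bump_w_integrable N0.
have c1 := hp_integrableZ 8 b1; have cN := hp_integrableZ 8 bN.
have := hp_integral_le si (hp_integrableD (hp_integrableD c1 cN) b1).
rewrite sE (hp_integralD (hp_integrableD c1 cN) b1) (hp_integralD c1 cN).
rewrite (hp_integralZ _ b1) (hp_integralZ _ bN) (Q_gt1 p five1).
have := bump_w_integral (@ltr01 R); have := bump_w_integral N0; have := Iv0.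
move: (hp_integral (fun r z => bump 1 r * w z)) (hp_integral (fun r z => bump N r * w z)).
move: (energy 5 p) (hp_integral _) Iv => E W I x y I0 hy hx.
have -> : E + (3 - 5) * (5 - 1) / 2 * W = E + (2 ^+ 2 - 2 * (5 - 1)) * W by field.
(* Each bump integral is at most [Iv / 4], so the total is at most [(8 + 8 + 1) / 4], below 5, times
   [Iv]. *)
move=> h; apply: (@le_trans _ _ (8 * x + 8 * y + x)); last lra.
apply: h => r z r0; rewrite pow3 // mulrDl lerD //; [exact: square_le|exact: dz5_le].
Qed.

(** Nonnegativity of [Q 5] says that the energy is at least 4 times the weighted mass, and [f_mass]
    bounds the mass from below by [ln s / 64] times [Iv]. *)
Let profile_energy : ln s / 16 * Iv <= energy 5 p.
Proof.
have := Q_ge0 (al := 5) _ profile_dom; rewrite (Q_gt1 p five1).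
rewrite -(hp_integral_eq p_sqE) product_integral // => /(_ ltac:(lra)).
have := f_mass; have := Iv0; rewrite -/Iv.
move: (\int[leb]_(r in ray) u3 r) (energy 5 p) Iv (ln s) => m E I l I0 lm h.
have : 0 <= (m - l / 64) * I by rewrite mulr_ge0 ?subr_ge0 // ltW.
move: h; have -> : E + (3 - 5) * (5 - 1) / 2 * (m * I) = E - 4 * (m * I) by field.
have -> : (m - l / 64) * I = m * I - l * I / 64 by ring.
have -> : l / 16 * I = l * I / 16 by ring.
by move: (m * I) (l * I) => x y; lra.
Qed.

(** The ratio of energy to form is at least [ln s / 80], where [80 = 16 * 5] combines the lower
    bound on the energy with the upper bound on [Q 5]. *)
Lemma concentration : exists phi : R -> R -> R, [/\ Q_domain 5 phi, 0 < energy 5 phi &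
   ln s / 80 * Q 5 phi <= energy 5 phi].
Proof.
have l0 : 0 < ln s by rewrite ln_gt0 //; move: s2; lra.
exists p; split; first exact: profile_dom.
  by apply: lt_le_trans profile_energy; rewrite mulr_gt0 // divr_gt0.
have l80 : 0 <= ln s / 80 by rewrite divr_ge0 // ltW.
apply: le_trans (ler_wpM2l l80 profile_Q) _.
have -> : ln s / 80 * (5 * Iv) = ln s / 16 * Iv by field.
exact: profile_energy.
Qed.

End Concentration.

Lemma no_gradient_gap (R : realType) : ~ exists c : R, 0 < c /\
  forall phi : R -> R -> R, Q_domain 5 phi -> c * energy 5 phi <= Q 5 phi.
Proof.
(* With [s = expR x] one has [ln s = x], and [x] is taken so that [c * x / 80] exceeds 1; positivity
   of the energy then gives the contradiction. *)
move=> [c [c0 gap]]; pose x := 1 + 80 / c.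
have x1 : 1 < x by rewrite ltrDl divr_gt0.
have s2 : 2 <= expR x by apply: le_trans (expR_ge1Dx x); lra.
have [phi [dom E0]] := concentration s2; rewrite expRK => h.
have x80 : 0 <= x / 80 by rewrite divr_ge0 //; lra.
have := le_trans (ler_wpM2l x80 (gap _ dom)) h.
rewrite mulrA -[leRHS]mul1r ler_pM2r // leNgt => /negP; apply.
have -> : x / 80 * c = c / 80 + 1 by rewrite /x; field; rewrite gt_eqF.
by rewrite ltrDr divr_gt0.
Qed.

(** [K2] is linear in its velocity argument, so along the perturbation it is affine in [e] with
    slope minus the pairing. Integrability of both integrands is what allows the integral to be
    split. *)
Lemma K2_response (R : realType) (F phi U : R -> R -> R) (al : R) :
  rapidly_decaying F -> is_phi_src F phi -> 1 <= al <= 5 ->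
  hp_integrable (fun r z => U r z * F r z ^+ 2 * r `^ al) ->
  is_derive (0 : R) 1
    (fun e : R => K2 al F (fun r z => U r z + e * Udot_src phi r z)) (- Q al phi).
Proof.
move=> hF hphi /andP[a1 a5] Ui.
have a8 : al < 8 by lra.
have [si sE] := source_pairing hF hphi a1 (phi_Q_domain hF hphi a1 a8).
have -> : (fun e : R => K2 al F (fun r z => U r z + e * Udot_src phi r z)) =
    fun e => - (hp_integral (fun r z => U r z * F r z ^+ 2 * r `^ al) + e * Q al phi).
  apply/funext => e; rewrite /K2 -sE -(hp_integralZ e si).
  rewrite -(hp_integralD Ui (hp_integrableZ e si)); apply: congr1.
  by apply: hp_integral_eq => r z _; rewrite !mulrDl !mulrA.
move: (hp_integral _) (Q al phi) => k q.
by eapply derE; [der|ring].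
Qed.

(** Convergence and identity are separated in the first conjunct: [alpha < 8] guarantees that the
    integrals of [Q] converge, and wherever they converge the identity holds. Integrability is
    asserted next to the equality because the real-valued integral of a non-integrable function
    carries no information. *)
Theorem theorem6p1 (R : realType) :
  (forall (F phi : R -> R -> R), rapidly_decaying F -> is_phi_src F phi ->
   forall alpha : R, 1 <= alpha ->
     (alpha < 8 -> Q_domain alpha phi) /\
     (Q_domain alpha phi ->
        hp_integrable
          (fun r z => Udot_src phi r z * F r z ^+ 2 * r `^ alpha) /\
        hp_integral (fun r z => Udot_src phi r z * F r z ^+ 2 * r `^ alpha)
          = Q alpha phi)) /\
  (forall (alpha : R) (phi : R -> R -> R), 1 <= alpha <= 5 ->
     Q_domain alpha phi -> 0 <= Q alpha phi) /\
  (forall (alpha : R) (phi : R -> R -> R), 1 < alpha <= 3 ->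
     Q_domain alpha phi -> energy alpha phi <= Q alpha phi) /\
  (forall (alpha : R) (phi : R -> R -> R), 3 < alpha < 5 ->
     Q_domain alpha phi ->
     (5 - alpha) / (alpha - 1) * energy alpha phi <= Q alpha phi) /\
  (~ exists c : R, 0 < c /\
     forall phi : R -> R -> R, Q_domain 5 phi -> c * energy 5 phi <= Q 5 phi) /\
  (forall (F phi : R -> R -> R), rapidly_decaying F -> is_phi_src F phi ->
   forall (alpha : R) (U : R -> R -> R), 1 <= alpha <= 5 ->
     hp_integrable (fun r z => U r z * F r z ^+ 2 * r `^ alpha) ->
     derivable
       (fun e : R => K2 alpha F (fun r z => U r z + e * Udot_src phi r z)) 0 1 /\
     derive1
       (fun e : R => K2 alpha F (fun r z => U r z + e * Udot_src phi r z)) 0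
       <= 0).
Proof.
split.
  move=> F phi hF hphi al a1; split; first by move=> a8; exact: (phi_Q_domain hF hphi a1 a8).
  by move=> dom; exact: (source_pairing hF hphi a1 dom).
split; first exact: Q_ge0.
split.
  by move=> al phi /andP[a1 a3] _; exact: (Q_ge_energy phi a1 a3).
split.
  move=> al phi /andP[a3 _] dom; have al1 : 1 < al by lra.
  exact: (Q_ge_gap al1 dom a3).
split; first exact: no_gradient_gap.
move=> F phi hF hphi al U hal Ui.
have dK := K2_response hF hphi hal Ui; split; first by case: dK.
rewrite (der_derive1 dK) oppr_le0; apply: Q_ge0 => //.
by case/andP: hal => a1 a5; apply: (phi_Q_domain hF hphi a1); lra.
Qed.
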